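(* For each $\alpha$, $0<\alpha<1$, there exists a bounded domain $D\subseteq\mathbb R^2$ such that its boundary is $C^{1,\alpha}$-smooth, $1_D\in A_p(\mathbb R^2)$ for all $p>1+\alpha/(2+\alpha)$, and the boundary of $D$ does not contain (nondegenerate) straight line intervals.
   Context: A domain is a (nonempty) open connected set. $1_D$ denotes the characteristic function of $D$. The Fourier transform is $\widehat f(\xi)=\int_{\mathbb R^n} f(t)e^{-i(\xi,t)}\,dt$ for integrable $f$, where $(\cdot,\cdot)$ is the inner product in $\mathbb R^n$, and is extended to tempered distributions as usual. For $1\leq p\leq\infty$, $A_p(\mathbb R^n)$ is the space of tempered distributions $f$ on $\mathbb R^n$ such that $\widehat f\in L^p(\mathbb R^n)$, with norm $\|f\|_{A_p(\mathbb R^n)}=\|\widehat f\|_{L^p(\mathbb R^n)}$. For a domain $D\subseteq\mathbb R^n$, the boundary $\partial D$ is $C^1$-smooth if in an appropriate neighborhood of each of its points $\partial D$ is (after a suitable choice of orthonormal coordinates) the graph of a real function of class $C^1$. For $D$ with $C^1$-smooth boundary let $\nu_D(x)\in S^{n-1}$ be the outer unit normal vector to $\partial D$ at $x\in\partial D$, and let $$ \omega(\nu_D,\delta)=\sup_{x,y\in\partial D;\ |x-y|\leq\delta}|\nu_D(x)-\nu_D(y)|,\qquad \delta\geq 0. $$ The boundary $\partial D$ is $C^{1,\alpha}$-smooth if it is $C^1$-smooth and $\omega(\nu_D,\delta)=O(\delta^\alpha)$ as $\delta\to+0$. *)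

(* Defs.v *)
From HB Require Import structures.
From mathcomp Require Import all_boot all_order all_algebra.
From mathcomp Require Import complex.
From mathcomp Require Import all_classical all_reals all_analysis.

Set Implicit Arguments.
Unset Strict Implicit.
Unset Printing Implicit Defensive.

Import Order.TTheory GRing.Theory Num.Theory.
Import numFieldNormedType.Exports.

Local Open Scope classical_set_scope.
Local Open Scope ring_scope.

Section Plane.
Context {R : realType}.

(* The library norm on R * R is the sup norm: it gives the usual topology and
   the usual bounded sets, but Euclidean lengths need [enorm]. *)
Definition dot (x y : R * R) : R := x.1 * y.1 + x.2 * y.2.
Definition enorm (x : R * R) : R := Num.sqrt (dot x x).

Definition orthonormal (e1 e2 : R * R) : Prop :=
  [/\ dot e1 e1 = 1, dot e2 e2 = 1 & dot e1 e2 = 0].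

Definition domain (D : set (R * R)) : Prop := [/\ D !=set0, open D & connected D].

Definition boundary (D : set (R * R)) : set (R * R) := closure D `\` interior D.

Definition segment (x y : R * R) : set (R * R) :=
  [set z | exists2 t : R, 0 <= t <= 1 & z = (1 - t) *: x + t *: y].

End Plane.

Section Boundary.
Context {R : realType}.
Implicit Types (D : set (R * R)) (x y : R * R).

(* In the orthonormal coordinates (e1, e2), the part of the boundary of D in
   the neighborhood U of x is the graph of a C^1 function h on ]a, b[, and x is
   the point of that graph with abscissa s. *)
Definition C1_chart D x (e1 e2 : R * R) (U : set (R * R)) (a b : R)
    (h : R -> R) (s : R) : Prop :=
  [/\ orthonormal e1 e2,
      open U /\ U x,
      forall r, a < r < b -> derivable h r 1 /\ {for r, continuous (derive1 h)},
      boundary D `&` U = [set r *: e1 + h r *: e2 | r in [set r | a < r < b]]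
    & a < s < b /\ x = s *: e1 + h s *: e2].

Definition C1_boundary D : Prop :=
  forall x, boundary D x -> exists e1 e2 U a b h s, C1_chart D x e1 e2 U a b h s.

(* nu is a unit vector orthogonal to the tangent line e1 + h'(s) e2 at x, and
   points out of D. *)
Definition outer_unit_normal D x (nu : R * R) : Prop :=
  [/\ enorm nu = 1,
      exists e1 e2 U a b h s,
        C1_chart D x e1 e2 U a b h s /\ dot nu (e1 + derive1 h s *: e2) = 0
    & \forall t \near 0^'+, ~ D (x + t *: nu) /\ D (x - t *: nu)].

(* Modulus of continuity of nu along the boundary. When nu consists of unit
   vectors and the boundary is nonempty, the set below is nonempty and bounded
   by 2 for every d >= 0, so that [sup] is the actual supremum. *)
Definition omega D (nu : R * R -> R * R) (d : R) : R :=
  sup [set r | exists x y, [/\ boundary D x, boundary D y, enorm (x - y) <= d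
                             & r = enorm (nu x - nu y)]].

(* A boundary point of a C^1 domain has at most one outer unit normal, so that
   nu is the outer normal field of D on the boundary. *)
Definition C1alpha_boundary (alpha : R) D : Prop :=
  C1_boundary D /\
  exists nu : R * R -> R * R,
    (forall x, boundary D x -> outer_unit_normal D x (nu x)) /\
    (omega D nu : R -> R^o) =O_ (0^'+) (fun d : R => (d `^ alpha : R^o)).

End Boundary.

Section Fourier.
Context {R : realType}.
Local Open Scope complex_scope.

Local Notation plane := (measurableTypeR R * measurableTypeR R)%type.

Definition lebesgue2 : {measure set plane -> \bar R} :=
  (@lebesgue_measure R \x @lebesgue_measure R)%E.

Definition Cintegrable (f : plane -> R[i]) : Prop :=
  lebesgue2.-integrable setT (fun t => (complex.Re (f t))%:E) /\
  lebesgue2.-integrable setT (fun t => (complex.Im (f t))%:E).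

Definition Cintegral (f : plane -> R[i]) : R[i] :=
  (Rintegral lebesgue2 setT (fun t => complex.Re (f t))) +i*
  (Rintegral lebesgue2 setT (fun t => complex.Im (f t))).

Definition expi (theta : R) : R[i] := cos theta +i* sin theta.

Definition fourier (f : plane -> R[i]) (xi : plane) : R[i] :=
  Cintegral (fun t => f t * expi (- dot xi t)).

Definition CLp (p : \bar R) (g : plane -> R[i]) : Prop :=
  [/\ measurable_fun setT (fun x => complex.Re (g x)),
      measurable_fun setT (fun x => complex.Im (g x))
    & (Lnorm lebesgue2 p (fun x => (ComplexField.Normc.normc (g x))%:E) < +oo)%E].

(* Membership in A_p(R^2) of an integrable function f: the Fourier transform of
   f as a tempered distribution is then the function [fourier f]. *)
Definition in_Ap (p : \bar R) (f : plane -> R[i]) : Prop :=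
  Cintegrable f /\ CLp p (fourier f).

Definition char_fun (D : set (R * R)) (t : plane) : R[i] := (\1_D t : R)%:C.

End Fourier.

(* Main.v *)
(** Let [a = 2 `^ (- 1 / alpha)], let [s] be an odd nondecreasing staircase whose
    points of increase form a Cantor set of dimension zero, and let
    [H t = \sum_j a ^ j * s (2 ^ j * t)].  As [H] grows by at least [a ^ n] over
    every interval of length [2 ^- n], its inverse, truncated to a function [G]
    with values in [[-1, 1]], is alpha-Hölder.  With [Psi] a primitive of [G], the
    domain [D] is the sublevel set of [Psi x + Psi y] bounded by the level curve
    through [(H 1, H 1)]; its normal is parallel to [(G x, G y)].  At least one of
    [G x], [G y] has modulus 1 there, and along each of the four arcs the other
    one is strictly monotone, so that the boundary contains no segment.

    In the direction [(t, 1)] the chords of [D] have a width concave on their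
    support, and comparing the oscillating integral with its translates by half a
    period bounds [|eta| * |F(t * eta, eta)|], [F] the transform of [1_D], by the
    width at distance [1 / |eta|] from the ends of the support, that is by
    [H (t + r) - H (t - r) + O (1 / (r * |eta|))] for every [r].  If
    [|eta| ~ (2 / a) ^ k], the choice [r = a ^- i * (a / 2) ^ k] gives [O (a ^ i)]
    unless [s] increases within [2 ^ j * r] of [2 ^ j * t] for some [j < i]; as
    the Cantor set has dimension zero, this happens on a set of [t] of measure
    [O (k * 2 ^ i * r)].  Summing [|eta| `^ (- q) * a `^ (q * i) * |eta|] over
    these sets and the shells [k] gives a series of ratio
    [(2 / a) `^ (2 - q) * a `^ q], which is below 1 exactly when
    [q > 1 + alpha / (2 + alpha)]. *)
Require Import Defs.
From mathcomp Require Import all_boot all_order all_algebra.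
From mathcomp Require Import all_classical all_reals all_analysis.
From mathcomp Require Import complex measurable_realfun ess_sup_inf zify ring lra.
Import Order.TTheory GRing.Theory Num.Theory.
Import numFieldNormedType.Exports.
Local Open Scope classical_set_scope.
Local Open Scope ring_scope.

Set Implicit Arguments.
Unset Strict Implicit.
Unset Printing Implicit Defensive.

(** * Dyadic series and generalized inverses *)

(** The transform of [1_D] is large in the directions normal to long, nearly flat boundary pieces; a
    polygon has only finitely many of these. Such a piece with normal along (t, 1) appears where H
    increases fast near t, so the increase of H should be concentrated on few t. Using the floor
    function in place of s would do this best, but a jump of H is an interval of constancy of G,
    hence a segment of the boundary. So s has to be continuous, and its points of increase are
    instead covered by O(K) balls of radius about 2 ^- K per unit length. This costs only powers of
    k, which the geometric ratio absorbs.

    The same dyadic series serves twice: with the floor function and doubly exponential weights its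
    inverse yields s, and with s and the weights a ^ j it is H, whose inverse is G.

    The exponent q is also kept below 1 + alpha, so that among the exceptional sets of index i <= k
    the last one dominates; larger exponents follow because the transform is bounded. *)

Section DyadicSeries.
Variables (R : realType) (w tau : nat -> R) (f : R -> R) (A : R).
Hypothesis w_ge0 : forall j, 0 <= w j.
Hypothesis w_tail : forall n m, \sum_(n <= j < m) w j * 2 ^+ j <= tau n.
Hypothesis A_ge0 : 0 <= A.
Hypothesis f0 : f 0 = 0.
Hypothesis f_nondec : {homo f : u v / u <= v}.
Hypothesis f_growth : forall u v, u <= v -> f v - f u <= A * (v - u + 1).

Definition dyadic_psum (t : R) : R^nat :=
  fun n => \sum_(0 <= j < n) w j * f (2 ^+ j * t).

Definition dyadic_series (t : R) : R := limn (dyadic_psum t).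

Local Lemma scale_le j t t' : t <= t' -> (2 : R) ^+ j * t <= 2 ^+ j * t'.
Proof. by move=> tt'; rewrite ler_wpM2l// exprn_ge0. Qed.

Lemma dyadic_term_ge0 j t t' : t <= t' ->
  0 <= w j * (f (2 ^+ j * t') - f (2 ^+ j * t)).
Proof. by move=> tt'; rewrite mulr_ge0// subr_ge0 f_nondec// scale_le. Qed.

(** After rescaling, the additive 1 of the growth hypothesis weighs 2 ^- j against the length t' -
    t, hence at most 2 ^- n for j >= n. A growth bound of this coarse kind also admits discontinuous
    functions such as the floor. *)
Lemma dyadic_tail n m t t' : t <= t' ->
  \sum_(n <= j < m) w j * (f (2 ^+ j * t') - f (2 ^+ j * t)) <=
    A * tau n * (t' - t + 2 ^- n).
Proof.
move=> tt'.
have h0 : 0 <= t' - t + 2 ^- n by rewrite addr_ge0 ?subr_ge0// invr_ge0 exprn_ge0.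
apply: (@le_trans _ _
    (\sum_(n <= j < m) A * (t' - t + 2 ^- n) * (w j * 2 ^+ j))).
  rewrite big_nat_cond [leRHS]big_nat_cond.
  apply: ler_sum => j; rewrite andbT => /andP[nj _].
  have -> : A * (t' - t + 2 ^- n) * (w j * 2 ^+ j) =
    w j * (A * (2 ^+ j * (t' - t) + 2 ^+ j * 2 ^- n)) by ring.
  rewrite ler_wpM2l//.
  apply: (le_trans (f_growth (scale_le j tt'))).
  rewrite ler_wpM2l// -mulrBr lerD2l.
  by rewrite ler_pdivlMr ?exprn_gt0// mul1r ler_eXn2l// ltr1n.
rewrite -mulr_sumr -mulrA [leRHS]mulrAC -mulrA ler_wpM2l// mulrC.
by rewrite mulrC ler_wpM2l.
Qed.

Lemma dyadic_psumB n m t t' : (n <= m)%N ->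
  dyadic_psum t' m - dyadic_psum t m =
  dyadic_psum t' n - dyadic_psum t n +
  \sum_(n <= j < m) w j * (f (2 ^+ j * t') - f (2 ^+ j * t)).
Proof.
move=> nm; rewrite /dyadic_psum (big_cat_nat (leq0n n) nm)/=.
rewrite [X in _ - X = _](big_cat_nat (leq0n n) nm)/=.
under [X in _ = _ + X]eq_bigr do rewrite mulrBr.
rewrite sumrB; lra.
Qed.

Lemma dyadic_psum_0 n : dyadic_psum 0 n = 0.
Proof. by rewrite /dyadic_psum big1// => j _; rewrite mulr0 f0 mulr0. Qed.

(** All partial sums vanish at 0, so they are increments between 0 and t: monotone in n, upwards or
    downwards with the sign of t, and bounded by the tail from index 0. *)
Lemma dyadic_cvg t : cvgn (dyadic_psum t).
Proof.
have [t0|/ltW t0] := leP 0 t.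
- apply: nondecreasing_is_cvgn.
    move=> n m nm; have := dyadic_psumB 0 t nm.
    rewrite !dyadic_psum_0 !subr0 => ->; rewrite lerDl.
    by apply: sumr_ge0 => j _; exact: dyadic_term_ge0.
  exists (A * tau 0%N * (t + 1)) => _ [n _ <-].
  have := @dyadic_psumB 0 n 0 t (leq0n _).
  rewrite !dyadic_psum_0 /dyadic_psum [X in _ = X - _ + _]big_geq// !subr0 add0r.
  move=> ->; apply: (le_trans (dyadic_tail 0 n t0)).
  by rewrite expr0 invr1 subr0.
- apply: nonincreasing_is_cvgn.
    move=> n m nm; have := dyadic_psumB t 0 nm.
    rewrite !dyadic_psum_0 !sub0r => h.
    rewrite -lerN2 h lerDl.
    by apply: sumr_ge0 => j _; exact: dyadic_term_ge0.
  exists (- (A * tau 0%N * (- t + 1))) => _ [n _ <-].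
  have := @dyadic_psumB 0 n t 0 (leq0n _).
  rewrite !dyadic_psum_0 !sub0r {2}/dyadic_psum big_geq// oppr0 add0r => h.
  rewrite lerNl h; apply: (le_trans (dyadic_tail 0 n t0)).
  by rewrite expr0 invr1 sub0r.
Qed.

Lemma dyadic_seriesB t t' : dyadic_series t' - dyadic_series t =
  limn (fun n => dyadic_psum t' n - dyadic_psum t n).
Proof. by rewrite /dyadic_series -limB//; exact: dyadic_cvg. Qed.

Lemma dyadic_series_ge n t t' : t <= t' ->
  dyadic_psum t' n - dyadic_psum t n <= dyadic_series t' - dyadic_series t.
Proof.
move=> tt'; rewrite dyadic_seriesB; apply: limr_ge.
  by apply: is_cvgB; exact: dyadic_cvg.
near=> m; rewrite (@dyadic_psumB n m) ?lerDl; last by near: m; exists n.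
by apply: sumr_ge0 => j _; exact: dyadic_term_ge0.
Unshelve. all: by end_near. Qed.

Lemma dyadic_series_le n t t' : t <= t' ->
  dyadic_series t' - dyadic_series t <=
  dyadic_psum t' n - dyadic_psum t n + A * tau n * (t' - t + 2 ^- n).
Proof.
move=> tt'; rewrite dyadic_seriesB; apply: limr_le.
  by apply: is_cvgB; exact: dyadic_cvg.
near=> m; rewrite (@dyadic_psumB n m); last by near: m; exists n.
by rewrite lerD2l dyadic_tail.
Unshelve. all: by end_near. Qed.

Lemma dyadic_series_term j t t' : t <= t' ->
  w j * (f (2 ^+ j * t') - f (2 ^+ j * t)) <=
  dyadic_series t' - dyadic_series t.
Proof.
move=> tt'; apply: le_trans (dyadic_series_ge j.+1 tt').
have p0 x : dyadic_psum x 0 = 0 by rewrite /dyadic_psum big_geq.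
rewrite (@dyadic_psumB 0)// !p0 subrr add0r.
rewrite big_nat_recr//= lerDr.
by apply: sumr_ge0 => i _; exact: dyadic_term_ge0.
Qed.

Lemma dyadic_series0 : dyadic_series 0 = 0.
Proof.
rewrite /dyadic_series (_ : dyadic_psum 0 = fun=> 0) ?lim_cst//.
by apply/funext => n; exact: dyadic_psum_0.
Qed.

Lemma dyadic_series_nondec : {homo dyadic_series : t t' / t <= t'}.
Proof.
move=> t t' tt'; rewrite -subr_ge0.
by apply: le_trans (dyadic_series_term 0 tt'); exact: dyadic_term_ge0.
Qed.

End DyadicSeries.

Section GeneralizedInverse.
Variables (R : realType) (M : R -> R).
Hypothesis M_nondec : {homo M : s t / s <= t}.
Hypothesis M_lo : forall u, exists s, M s <= u.
Hypothesis M_hi : forall u, exists s, u < M s.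

Definition ginv (u : R) : R := sup [set s | M s <= u].

Local Lemma ginv_has_sup u : has_sup [set s | M s <= u].
Proof.
split; first exact: M_lo.
have [s us] := M_hi u; exists s => s' /= Ms'.
by rewrite leNgt; apply/negP => /ltW /M_nondec; rewrite leNgt (le_lt_trans Ms').
Qed.

Lemma ginv_ge s u : M s <= u -> s <= ginv u.
Proof. by move=> su; apply: ub_le_sup => //; case: (ginv_has_sup u). Qed.

Lemma ginv_le s u : u < M s -> ginv u <= s.
Proof.
move=> us; apply: ge_sup; first by case: (ginv_has_sup u).
move=> s' /= Ms'.
by rewrite leNgt; apply/negP => /ltW /M_nondec; rewrite leNgt (le_lt_trans Ms').
Qed.

Lemma ginv_gtP s u : ginv u < s -> u < M s.
Proof. by rewrite !ltNge; apply: contra; exact: ginv_ge. Qed.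

Lemma ginv_ltP s u : s < ginv u -> M s <= u.
Proof. by rewrite ltNge [M s <= u]leNgt; apply: contra; exact: ginv_le. Qed.

Lemma ginv_nondec : {homo ginv : u v / u <= v}.
Proof.
move=> u v uv; apply: ge_sup; first by case: (ginv_has_sup u).
by move=> s /= su; apply: ginv_ge; exact: le_trans uv.
Qed.

(** Expansion of [M] turns into a modulus of continuity of the inverse. As [M] may jump, it is
    evaluated strictly between the two suprema. *)
Lemma ginv_modulus u v d e :
  (forall s s', d < s' - s -> e <= M s' - M s) -> v - u <= e ->
  ginv v - ginv u <= d.
Proof.
move=> Mde uve; rewrite leNgt; apply/negP => duv.
(* A third of the excess: moving both ends inwards by it leaves a gap still longer than d. *)
pose k := (ginv v - ginv u - d) / 3.
have hs : ginv u < ginv u + k by rewrite ltrDl divr_gt0// subr_gt0.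
have hs' : ginv v - k < ginv v by rewrite ltrBlDr ltrDl divr_gt0// subr_gt0.
have k1 := ginv_gtP hs; have k2 := ginv_ltP hs'.
have := Mde (ginv u + k) (ginv v - k).
have -> : d < ginv v - k - (ginv u + k) by rewrite /k; lra.
by move=> /(_ isT) ?; lra.
Qed.

Lemma ginvK : {homo M : s t / s < t} -> cancel M ginv.
Proof.
move=> M_inc s; apply/eqP; rewrite eq_le ginv_ge// andbT.
by apply/ler_addgt0Pr => e e0; apply: ginv_le; rewrite M_inc// ltrDl.
Qed.

End GeneralizedInverse.

(** * The staircase and the slope function *)

Section ThinStaircase.
Variable R : realType.
Implicit Types (s t u v : R) (n j : nat).

Definition rfloor (s : R) : R := (Num.floor s)%:~R.

Lemma rfloor_le s : rfloor s <= s.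
Proof. exact: floor_le. Qed.

Lemma rfloor_gt s : s < rfloor s + 1.
Proof. by have := floorD1_gt s; rewrite rmorphD. Qed.

Lemma rfloor_nondec : {homo rfloor : s t / s <= t}.
Proof. by move=> s t st; rewrite ler_int le_floor. Qed.

Lemma rfloor0 : rfloor 0 = 0.
Proof. by rewrite /rfloor floor0. Qed.

Lemma rfloor_growth s t : s <= t -> rfloor t - rfloor s <= 1 * (t - s + 1).
Proof. by move=> _; have := rfloor_le t; have := rfloor_gt s; lra. Qed.

Lemma rfloorD1 s t : 1 <= t - s -> 1 <= rfloor t - rfloor s.
Proof.
move=> st; have : rfloor (s + 1) <= rfloor t by apply: rfloor_nondec; lra.
by rewrite {1}/rfloor floorDrz// floor1 rmorphD/= -/(rfloor s); lra.
Qed.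

(** Each weight is the square of the previous one, so that between neighbouring dyadic points of
    level n the later terms vary by at most 2 ^- (2 ^ n). The base 4 is fixed by [dust_add1]. *)
Definition jump j : R := 4^-1 ^+ (2 ^ j).

Lemma jump_gt0 j : 0 < jump j.
Proof. by rewrite exprn_gt0// invr_gt0. Qed.

Lemma jump_ge0 j : 0 <= jump j.
Proof. exact/ltW/jump_gt0. Qed.

Lemma jumpS j : jump j.+1 = jump j ^+ 2.
Proof. by rewrite /jump -exprM expnSr. Qed.

Lemma jump0 : jump 0 = 4^-1.
Proof. by rewrite /jump expn0 expr1. Qed.

Lemma jump_le j : jump j <= 4^-1.
Proof.
rewrite -[leRHS]expr1 ler_wiXn2l ?invr_ge0 ?expn_gt0//.
by rewrite invf_le1// ler1n.
Qed.

Definition jump_tail n : R := 2 * jump n * 2 ^+ n.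

Lemma jump_tail_ge0 n : 0 <= jump_tail n.
Proof. by rewrite /jump_tail !mulr_ge0// ?exprn_ge0// jump_ge0. Qed.

Lemma jump_tailP n m : \sum_(n <= j < m) jump j * 2 ^+ j <= jump_tail n.
Proof.
have [nm|mn] := leqP n m; last by rewrite big_geq ?jump_tail_ge0// ltnW.
rewrite -(subnKC nm); move: (m - n)%N => k.
(* Telescoping: [jump p.+1] is at most a quarter of [jump p], so [jump_tail p - jump_tail p.+1]
   dominates the term of index p. *)
suff : \sum_(n <= j < n + k) jump j * 2 ^+ j <=
    jump_tail n - jump_tail (n + k).
  by move/le_trans; apply; rewrite gerBl jump_tail_ge0.
elim: k => [|k IH]; first by rewrite addn0 big_geq// subrr.
rewrite addnS big_nat_recr ?leq_addr//=; move: IH.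
set p := (n + k)%N => IH.
have := ler_wpM2l (jump_ge0 p) (jump_le p).
move=> /(ler_wpM2r (exprn_ge0 p (ler0n R 2))).
have -> : jump p * 4^-1 * 2 ^+ p = jump p * 2 ^+ p / 4 by ring.
rewrite {2}/jump_tail jumpS expr2 exprS; move: IH; rewrite {2}/jump_tail.
set y := jump p * jump p * _; have -> : 2 * (jump p * jump p) * (2 * 2 ^+ p) = 4 * y.
  by rewrite /y; ring.
have -> : 2 * jump p * 2 ^+ p = 2 * (jump p * 2 ^+ p) by ring.
lra.
Qed.

(* Strictly increasing, with a jump at every dyadic point: the closure of its
   range is a Cantor set of dimension zero. *)
Definition dust : R -> R := dyadic_series jump rfloor.

Let Le := dyadic_series_le jump_ge0 jump_tailP ler01 rfloor0 rfloor_nondec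
  rfloor_growth.
Let Term := dyadic_series_term jump_ge0 jump_tailP ler01 rfloor0 rfloor_nondec
  rfloor_growth.

Lemma dust_nondec : {homo dust : s t / s <= t}.
Proof.
exact: (dyadic_series_nondec jump_ge0 jump_tailP ler01 rfloor0 rfloor_nondec
  rfloor_growth).
Qed.

Lemma dust_jump n s t : 2 ^- n <= t - s -> jump n <= dust t - dust s.
Proof.
move=> nst; have st : s <= t.
  by rewrite -subr_ge0; apply: le_trans nst; rewrite invr_ge0 exprn_ge0.
apply: le_trans (Term n st); rewrite -[leLHS]mulr1 ler_wpM2l ?jump_ge0//.
apply: rfloorD1; rewrite -mulrBr mulrC -ler_pdivrMr ?exprn_gt0//.
by rewrite div1r.
Qed.

Lemma exists_pow2V_le (e : R) : 0 < e -> exists n, 2 ^- n <= e.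
Proof.
move=> e0; exists (Num.bound e^-1).
rewrite invf_ple ?posrE ?exprn_gt0//.
apply: le_trans (ltW (archi_boundP _)) _; first by rewrite invr_ge0 ltW.
by rewrite -natrX ler_nat ltnW// ltn_expl.
Qed.

Lemma dust_inc : {homo dust : s t / s < t}.
Proof.
move=> s t st; have [n hn] : exists n, 2 ^- n <= t - s.
  by apply: exists_pow2V_le; rewrite subr_gt0.
by rewrite -subr_gt0; apply: lt_le_trans (dust_jump hn); exact: jump_gt0.
Qed.

Lemma dust0 : dust 0 = 0.
Proof. exact: (dyadic_series0 _ rfloor0). Qed.

(** The tail bound from index 0 is [jump_tail 0] = 1/2 times 1 + 1. For the inverse this becomes the
    unit growth [staircase_add1]. *)
Lemma dust_add1 s : dust (s + 1) <= dust s + 1.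
Proof.
have : s <= s + 1 by rewrite lerDl.
move=> /(Le 0); rewrite -/dust /dyadic_psum !big_geq// /jump_tail jump0 expr0.
by rewrite invr1; lra.
Qed.

Lemma dust_growth s t : s <= t -> 4^-1 * (t - s - 1) <= dust t - dust s.
Proof.
move=> st; apply: le_trans (Term 0 st); rewrite jump0 expr0 !mul1r.
rewrite ler_wpM2l ?invr_ge0//.
by have := rfloor_gt t; have := rfloor_le s; lra.
Qed.

Lemma dust_lo u : exists s, dust s <= u.
Proof.
exists (- (4 * `|u| + 1)).
have : - (4 * `|u| + 1) <= 0 by have := normr_ge0 u; lra.
move=> /dust_growth; rewrite dust0; have := ler_norm (- u); rewrite normrN; lra.
Qed.

Lemma dust_hi u : exists s, u < dust s.
Proof.
exists (4 * `|u| + 5).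
have : 0 <= 4 * `|u| + 5 by have := normr_ge0 u; lra.
move=> /dust_growth; rewrite dust0; have := ler_norm u; lra.
Qed.

Lemma rfloor_dyadic j n s : (j <= n)%N ->
  rfloor (2 ^+ j * (2 ^- n * rfloor (2 ^+ n * s))) = rfloor (2 ^+ j * s).
Proof.
move=> jn; have p2 k : 0 < (2 : R) ^+ k by rewrite exprn_gt0.
apply/eqP; rewrite eq_le; apply/andP; split.
  apply: rfloor_nondec; rewrite ler_pM2l// mulrC ler_pdivrMr// mulrC.
  by rewrite rfloor_le.
rewrite {2}/rfloor ler_int floor_ge_int -/(rfloor _).
have -> : 2 ^+ j * (2 ^- n * rfloor (2 ^+ n * s)) =
    rfloor (2 ^+ n * s) / 2 ^+ (n - j).
  by rewrite -{1}(subnKC jn) exprD invfM; field; rewrite !gt_eqF.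
rewrite ler_pdivlMr// mulrC.
have e : 2 ^+ (n - j) * rfloor (2 ^+ j * s) =
    (2 ^+ (n - j) * Num.floor (2 ^+ j * s))%:~R :> R.
  by rewrite rmorphM/= rmorphXn.
rewrite e ler_int floor_ge_int -e -[in leRHS](subnKC jn) exprD.
by rewrite (mulrC (2 ^+ j) (2 ^+ (n - j))) -mulrA ler_pM2l// rfloor_le.
Qed.

(** Here q is s cut after n binary digits, so the floors of index at most n agree at s and q. With y
    = 2 ^- (2 ^ n), the terms from n.+1 on differ by at most 6 * y ^ 4, and y <= 1/2. *)
Lemma dust_near n s (q := 2 ^- n * rfloor (2 ^+ n * s)) :
  dust q <= dust s <= dust q + 2 ^- (2 ^ n).
Proof.
have p2 k : 0 < (2 : R) ^+ k by rewrite exprn_gt0.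
have qs : q <= s by rewrite /q mulrC ler_pdivrMr// mulrC rfloor_le.
have sq : s - q <= 2 * 2 ^- n.+1.
  have -> : 2 * 2 ^- n.+1 = 2 ^- n :> R by rewrite exprS; field; rewrite gt_eqF.
  have : s <= 2 ^- n * (rfloor (2 ^+ n * s) + 1).
    by rewrite mulrC ler_pdivlMr// mulrC ltW// rfloor_gt.
  by rewrite mulrDr mulr1 -/q; lra.
rewrite dust_nondec//= -lerBlDl; apply: (le_trans (Le n.+1 qs)).
have -> : dyadic_psum jump rfloor s n.+1 = dyadic_psum jump rfloor q n.+1.
  by apply: eq_big_nat => j /andP[_ jn]; rewrite /q rfloor_dyadic.
rewrite subrr add0r mul1r.
apply: (@le_trans _ _ (jump_tail n.+1 * (3 * 2 ^- n.+1))).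
  by rewrite ler_wpM2l ?jump_tail_ge0//; lra.
have -> : jump_tail n.+1 * (3 * 2 ^- n.+1) = 6 * jump n ^+ 2.
  by rewrite /jump_tail jumpS; field; rewrite gt_eqF.
have -> : jump n = (2 ^- (2 ^ n)) ^+ 2.
  by rewrite /jump -exprVn -!exprM mulnC exprM; congr (_ ^+ _); field.
have y0 : 0 < (2 : R) ^- (2 ^ n) by rewrite invr_gt0.
have : (2 : R) ^- (2 ^ n) <= 2^-1.
  by rewrite lef_pV2 ?posrE// -[leLHS]expr1 ler_weXn2l ?expn_gt0// ler1n.
move: (2 ^- (2 ^ n)) y0 => y y0 y1.
have h1 : y ^+ 2 <= 4^-1.
  by rewrite (_ : 4^-1 = 2^-1 ^+ 2); [rewrite ler_pXn2r// ?nnegrE; lra|field].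
have : y ^+ 2 * y ^+ 2 <= 4^-1 * (2^-1 * y).
  by rewrite ler_pM ?exprn_ge0 ?(ltW y0)// expr2 ler_wpM2r ?(ltW y0).
by rewrite -(exprM y 2 2) -exprD; lra.
Qed.

(* Continuous, and locally constant off the closure of the range of [dust]. *)
Definition staircase (u : R) : R := ginv dust u - ginv dust (- u).

Let N := ginv dust.
Let Nge := ginv_ge dust_nondec dust_lo dust_hi.
Let Nmod := ginv_modulus dust_nondec dust_lo dust_hi.
Let NgtP := ginv_gtP dust_nondec dust_lo dust_hi.
Let NltP := ginv_ltP dust_nondec dust_lo dust_hi.
Let Nnondec := ginv_nondec dust_nondec dust_lo dust_hi.

Local Lemma ginv_dust0 : N 0 = 0.
Proof.
by rewrite -{1}dust0; exact: (ginvK dust_nondec dust_lo dust_hi dust_inc).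
Qed.

Local Lemma ginv_dust_growth u v : u <= v -> N v - N u <= 4 * (v - u) + 1.
Proof.
move=> uv; apply: (@Nmod _ _ _ (v - u)) => // s s' ss'.
have s0 : s <= s' by lra.
by have := dust_growth s0; lra.
Qed.

Local Lemma ginv_dust_mod n u v : v - u <= jump n -> N v - N u <= 2 ^- n.
Proof.
by move=> uv; apply: Nmod uv => s s' /ltW; exact: dust_jump.
Qed.

Local Lemma ginv_dust_norm u : `|N u| <= 4 * `|u| + 1.
Proof.
have [u0|/ltW u0] := leP 0 u.
  rewrite !ger0_norm//; last by rewrite -ginv_dust0 Nnondec.
  by have := ginv_dust_growth u0; rewrite ginv_dust0; lra.
rewrite !ler0_norm//; last by rewrite -ginv_dust0 Nnondec.
by have := ginv_dust_growth u0; rewrite ginv_dust0; lra.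
Qed.

Lemma staircaseN u : staircase (- u) = - staircase u.
Proof. by rewrite /staircase opprK opprB. Qed.

Lemma staircase0 : staircase 0 = 0.
Proof. by rewrite /staircase oppr0 subrr. Qed.

Lemma staircase_nondec : {homo staircase : u v / u <= v}.
Proof. by move=> u v uv; rewrite lerB// Nnondec// lerN2. Qed.

Lemma staircase_growth u v : u <= v ->
  staircase v - staircase u <= 8 * (v - u + 1).
Proof.
move=> uv; have vu : - v <= - u by rewrite lerN2.
by have := ginv_dust_growth uv; have := ginv_dust_growth vu; rewrite /staircase -/N; lra.
Qed.

Lemma staircase_add1 u v : 1 <= v - u -> 1 <= staircase v - staircase u.
Proof.
move=> uv; have : N (- v) <= N (- u) by apply: Nnondec; lra.
suff : N u + 1 <= N v by rewrite /staircase -/N; lra.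
apply/ler_addgt0Pr => e e0; rewrite -lerBlDr; apply: Nge.
rewrite (_ : N u + 1 - e = N u - e + 1); last by lra.
have /NltP h : N u - e < N u by rewrite ltrBlDr ltrDl.
by have := dust_add1 (N u - e); lra.
Qed.

Lemma staircase_mod n u v : u <= v -> v - u <= jump n ->
  staircase v - staircase u <= 2 * 2 ^- n.
Proof.
move=> uv vu; have := ginv_dust_mod vu.
have /ginv_dust_mod : - u - - v <= jump n by lra.
by rewrite /staircase -/N; lra.
Qed.

Lemma staircase_continuous : continuous staircase.
Proof.
move=> u; apply/cvgrPdist_le => e e0.
have [n hn] : exists n, 2 ^- n <= e / 2 by apply: exists_pow2V_le; rewrite divr_gt0.
near=> v; have hv : `|u - v| < jump n.
  by near: v; apply: cvgr_dist_lt; [exact: cvg_id|exact: jump_gt0].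
have [uv|/ltW vu] := leP u v.
  have := staircase_mod uv; rewrite distrC ger0_norm ?subr_ge0 ?staircase_nondec//.
  by move: hv; rewrite distrC ger0_norm ?subr_ge0// => /ltW hv /(_ _ hv); lra.
have := staircase_mod vu; rewrite ger0_norm ?subr_ge0 ?staircase_nondec//.
by move: hv; rewrite ger0_norm ?subr_ge0// => /ltW hv /(_ _ hv); lra.
Unshelve. all: by end_near. Qed.

(** [dust_near] offers only the precisions 2 ^- (2 ^ n); rounding K up to a power of 2 keeps the
    number of grid points linear in K. *)
Lemma exists_pow2_near K : exists n, (K <= 2 ^ n <= 2 * K + 1)%N.
Proof.
elim: K => [|K [n /andP[h1 h2]]]; first by exists 0%N.
have [h|h] := leqP K.+1 (2 ^ n); first by exists n; lia.
by exists n.+1; rewrite expnS; have := expn_gt0 2 n; lia.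
Qed.

(** If the inverse grows between u - rho and u + rho, some value [dust s] lies between these bounds,
    and by [dust_near] it is within 2 ^- K of the value at a dyadic point of level n. Dimension zero
    shows in the count of such points: linear in K, where a set of positive dimension would need
    exponentially many. *)
Local Lemma staircase_thin_half (K U : nat) : exists z : seq R,
  (size z <= 50 * (K + 1) * (U + 1))%N /\
    forall u rho : R, 0 <= rho <= 1 -> `|u| <= U%:R -> N (u - rho) < N (u + rho) ->
    exists2 x, x \in z & `|u - x| <= rho + 2 ^- K.
Proof.
have [n /andP[Kn nK]] := exists_pow2_near K.
(* The linear growth of the inverse gives s modulus at most 4 * U + 5; one further unit leaves room
   for rounding down to the grid. *)
pose B := (2 ^ n * (4 * U + 6))%N.
exists [seq dust (2 ^- n * (i%:R - B%:R)) | i <- iota 0 (2 * B + 1)].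
rewrite size_map size_iota; split.
  have : (B <= (2 * K + 1) * (4 * U + 6))%N by rewrite leq_mul2r nK orbT.
  by nia.
move=> u rho /andP[rho0 rho1] uU Nlt.
pose s := (N (u - rho) + N (u + rho)) / 2.
have s1 : N (u - rho) < s by rewrite /s; lra.
have s2 : s < N (u + rho) by rewrite /s; lra.
have Ms1 := NgtP s1; have Ms2 := NltP s2.
have p2 : 0 < (2 : R) ^+ n by rewrite exprn_gt0.
have hs : `|s| <= 4 * U%:R + 5.
  have := ginv_dust_norm (u - rho); have := ginv_dust_norm (u + rho).
  have := ler_normD u rho; have := ler_normB u rho.
  rewrite (ger0_norm rho0) => ? ?; rewrite !ler_norml => /andP[? ?] /andP[? ?].
  by apply/andP; split; lra.
have /andP[d1 d2] := dust_near n s.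
set q := _ * _ in d1 d2; exists (dust q); last first.
  rewrite ler_norml.
  have : (2 : R) ^- (2 ^ n) <= 2 ^- K.
    by rewrite lef_pV2 ?posrE ?exprn_gt0// ler_weXn2l// ler1n.
  have : 0 <= (2 : R) ^- K by rewrite invr_ge0 exprn_ge0.
  by move=> ? ?; apply/andP; split; lra.
pose m := (Num.floor (2 ^+ n * s) + B%:Z)%R.
have BE : B%:R = 2 ^+ n * (4 * U%:R + 6) :> R.
  by rewrite /B natrM natrX natrD natrM.
have fl := rfloor_le (2 ^+ n * s); have fg := rfloor_gt (2 ^+ n * s).
have p1 : 1 <= (2 : R) ^+ n by rewrite exprn_ege1// ler1n.
have hs' : `|2 ^+ n * s| <= B%:R - 1.
  rewrite normrM (gtr0_norm p2) BE.
  by have := ler_wpM2l (ltW p2) hs; lra.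
move: hs'; rewrite ler_norml => /andP[hs1 hs2].
have m0 : (0 <= m)%R.
  by rewrite -(ler_int R) /m rmorphD/= -/(rfloor _) -pmulrn; lra.
have mE : (`|m|%N)%:R = rfloor (2 ^+ n * s) + B%:R :> R.
  by rewrite natr_absz ger0_norm// /m rmorphD/= -pmulrn.
apply/mapP; exists `|m|%N.
  rewrite mem_iota leq0n add0n /= -(ltr_nat R) mE natrD natrM; lra.
by rewrite mE /q; congr (dust (_ * _)); lra.
Qed.

Lemma staircase_thin (K U : nat) : exists z : seq R,
  (size z <= 100 * (K + 1) * (U + 1))%N /\
    forall u rho : R, 0 <= rho <= 1 -> `|u| <= U%:R ->
    staircase (u - rho) != staircase (u + rho) ->
    exists2 x, x \in z & `|u - x| <= rho + 2 ^- K.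
Proof.
have [z [sz hz]] := staircase_thin_half K U.
exists (z ++ map -%R z); rewrite size_cat size_map; split.
  have -> : (100 * (K + 1) * (U + 1) =
    50 * (K + 1) * (U + 1) + 50 * (K + 1) * (U + 1))%N by lia.
  exact: leq_add.
move=> u rho rho01 uU hu; have rho0 : 0 <= rho by case/andP: rho01.
have [h|h] := ltP (N (u - rho)) (N (u + rho)).
  have [x xz hx] := hz u rho rho01 uU h.
  by exists x => //; rewrite mem_cat xz.
have [h'|h'] := ltP (N (- u - rho)) (N (- u + rho)).
  have [|x xz hx] := hz (- u) rho rho01 _ h'; first by rewrite normrN.
  exists (- x); first by rewrite mem_cat map_f ?orbT.
  by rewrite opprK -normrN opprD.
have e1 : N (u - rho) = N (u + rho).
  by apply/eqP; rewrite eq_le h andbT Nnondec//; lra.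
have e2 : N (- u - rho) = N (- u + rho).
  by apply/eqP; rewrite eq_le h' andbT Nnondec//; lra.
by move: hu; rewrite /staircase !opprD opprK -/N e1 e2 eqxx.
Qed.

End ThinStaircase.

Section Slope.
Variables (R : realType) (a : R).
Hypotheses (a_gt0 : 0 < a) (a_lt : 2 * a < 1).
Implicit Types (s t u v x y : R) (n j : nat).

Local Lemma a_ge0 : 0 <= a. Proof. exact: ltW. Qed.
Local Lemma a1_gt0 : 0 < 1 - 2 * a. Proof. by rewrite subr_gt0. Qed.

Local Lemma a_lt1 : a < 1.
Proof. by have := a_gt0; have := a_lt; lra. Qed.

Local Lemma pow_ge0 j : 0 <= a ^+ j. Proof. by rewrite exprn_ge0// a_ge0. Qed.

Local Lemma geom_tailP n m :
  \sum_(n <= j < m) a ^+ j * 2 ^+ j <= (2 * a) ^+ n / (1 - 2 * a).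
Proof.
have p0 k : 0 <= (2 * a) ^+ k / (1 - 2 * a).
  by rewrite divr_ge0 ?(ltW a1_gt0)// exprn_ge0// mulr_ge0// a_ge0.
have [nm|mn] := leqP n m; last by rewrite big_geq// ltnW.
rewrite -(subnKC nm); move: (m - n)%N => k.
suff -> : \sum_(n <= j < n + k) a ^+ j * 2 ^+ j =
    (2 * a) ^+ n / (1 - 2 * a) - (2 * a) ^+ (n + k) / (1 - 2 * a).
  by rewrite gerBl.
elim: k => [|k IH]; first by rewrite addn0 big_geq// subrr.
rewrite addnS big_nat_recr ?leq_addr//= IH -exprMn (mulrC a 2) exprS.
by field; rewrite gt_eqF// a1_gt0.
Qed.

Definition abscissa : R -> R := dyadic_series (fun j => a ^+ j) (@staircase R).

Local Notation H := abscissa.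

Let A8 : 0 <= 8 :> R. Proof. by []. Qed.
Let Le := dyadic_series_le pow_ge0 geom_tailP A8 (staircase0 R)
  (@staircase_nondec R) (@staircase_growth R).
Let Term := dyadic_series_term pow_ge0 geom_tailP A8 (staircase0 R)
  (@staircase_nondec R) (@staircase_growth R).

Lemma abscissaN t : H (- t) = - H t.
Proof.
have psumN : dyadic_psum (fun j => a ^+ j) (@staircase R) (- t) =
    - dyadic_psum (fun j => a ^+ j) (@staircase R) t.
  apply/funext => n; rewrite /dyadic_psum fctE -sumrN.
  by apply: eq_bigr => j _; rewrite mulrN staircaseN mulrN.
rewrite /H /dyadic_series psumN limN//.
exact: (dyadic_cvg pow_ge0 geom_tailP A8 (staircase0 R)
  (@staircase_nondec R) (@staircase_growth R)).
Qed.

Lemma abscissa0 : H 0 = 0.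
Proof. exact: (dyadic_series0 _ (staircase0 R)). Qed.

Lemma abscissa_nondec : {homo H : s t / s <= t}.
Proof.
exact: (dyadic_series_nondec pow_ge0 geom_tailP A8 (staircase0 R)
  (@staircase_nondec R) (@staircase_growth R)).
Qed.

Lemma abscissa_add j s t : 2 ^- j <= t - s -> a ^+ j <= H t - H s.
Proof.
move=> jst; have st : s <= t.
  by rewrite -subr_ge0; apply: le_trans jst; rewrite invr_ge0 exprn_ge0.
apply: le_trans (Term j st); rewrite -[leLHS]mulr1 ler_wpM2l ?pow_ge0//.
apply: staircase_add1; rewrite -mulrBr mulrC -ler_pdivrMr ?exprn_gt0//.
by rewrite div1r.
Qed.

Lemma abscissa_inc : {homo H : s t / s < t}.
Proof.
move=> s t st; have [n hn] : exists n, 2 ^- n <= t - s.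
  by apply: exists_pow2V_le; rewrite subr_gt0.
by rewrite -subr_gt0; apply: lt_le_trans (abscissa_add hn); exact: exprn_gt0.
Qed.

Definition tail_const : R := 8 / (1 - 2 * a).

Lemma tail_const_ge0 : 0 <= tail_const.
Proof. by rewrite divr_ge0// ltW// a1_gt0. Qed.

(** For t - s of order 2 ^- n the bound is of order a ^ n, the same as the lower bound
    [abscissa_add]: where the first n terms are flat, H grows no faster than it must. *)
Lemma abscissa_tail n s t : s <= t ->
  (forall j, (j < n)%N -> staircase (2 ^+ j * s) = staircase (2 ^+ j * t)) ->
  H t - H s <= tail_const * (2 * a) ^+ n * (t - s + 2 ^- n).
Proof.
move=> st e; apply: (le_trans (Le n st)).
have -> : dyadic_psum (fun j => a ^+ j) (@staircase R) t n =
    dyadic_psum (fun j => a ^+ j) (@staircase R) s n.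
  by apply: eq_big_nat => j /andP[_ jn]; rewrite e.
rewrite subrr add0r le_eqVlt; apply/orP; left; apply/eqP; rewrite /tail_const.
by ring.
Qed.

Local Lemma abscissa_nat n : n%:R <= H n%:R.
Proof.
elim: n => [|n IH]; first by rewrite abscissa0.
have : (2 : R) ^- 0 <= n.+1%:R - n%:R by rewrite -natrB// subSnn expr0 invr1.
move=> /abscissa_add; rewrite expr0 [n.+1%:R in X in X -> _]mulrSr.
by rewrite mulrSr; move: IH; lra.
Qed.

Lemma abscissa_hi x : exists t, x < H t.
Proof.
exists (Num.bound `|x|)%:R; apply: lt_le_trans (abscissa_nat _).
by apply: le_lt_trans (archi_boundP _); rewrite ?ler_norm.
Qed.

Lemma abscissa_lo x : exists t, H t <= x.
Proof.
have [t tx] := abscissa_hi (- x); exists (- t).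
by rewrite abscissaN lerNl ltW.
Qed.

Lemma exists_expr_le (b e : R) : 0 <= b < 1 -> 0 < e -> exists n, b ^+ n <= e.
Proof.
move=> /andP[b0 b1] e0.
have : (b ^+ n @[n --> \oo] --> 0)%classic by apply: cvg_expr; rewrite ger0_norm.
move=> /cvgrPdist_le /(_ _ e0) [n _ /(_ n (leqnn n))] /=.
by rewrite sub0r normrN ger0_norm ?exprn_ge0//; exists n.
Qed.

Lemma abscissa_continuous : continuous H.
Proof.
move=> t; apply/cvgrPdist_le => e e0.
have c0 := tail_const_ge0.
have [n hn] : exists n, a ^+ n <= e / (4 * (tail_const + 1)).
  apply: exists_expr_le; first by rewrite a_ge0 a_lt1.
  by rewrite divr_gt0// mulr_gt0//; lra.
pose psum t := dyadic_psum (fun j => a ^+ j) (@staircase R) t n.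
have psum_cont : continuous psum.
  rewrite (_ : psum = fun t => \sum_(i < n) a ^+ i * staircase (2 ^+ i * t)).
    apply: continuous_big => [|i _]; first exact: add_continuous.
    move=> x; apply: cvgM; first exact: cvg_cst.
    apply: (@continuous_comp _ _ _ (fun t => 2 ^+ i * t)).
      by apply: cvgM; [exact: cvg_cst|exact: cvg_id].
    exact: staircase_continuous.
  by apply/funext => x; rewrite /psum /dyadic_psum big_mkord.
have p2 : 0 < (2 : R) ^- n by rewrite invr_gt0 exprn_gt0.
have key s u : s <= u -> `|s - u| <= 2 ^- n -> `|psum s - psum u| <= e / 2 ->
    H u - H s <= e.
  move=> su hsu hp; apply: (le_trans (Le n su)).
  have : psum u - psum s <= e / 2 by apply: le_trans hp; rewrite distrC ler_norm.
  rewrite -/(psum u) -/(psum s).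
  have -> : 8 * ((2 * a) ^+ n / (1 - 2 * a)) = tail_const * (2 * a) ^+ n.
    by rewrite /tail_const; ring.
  have h : u - s + 2 ^- n <= 2 * 2 ^- n.
    by move: hsu; rewrite distrC ger0_norm ?subr_ge0//; lra.
  suff : tail_const * (2 * a) ^+ n * (u - s + 2 ^- n) <= e / 2 by lra.
  apply: (@le_trans _ _ (tail_const * (2 * a) ^+ n * (2 * 2 ^- n))).
    by rewrite ler_wpM2l// mulr_ge0// exprn_ge0// mulr_ge0// a_ge0.
  have -> : tail_const * (2 * a) ^+ n * (2 * 2 ^- n) = 2 * tail_const * a ^+ n.
    by rewrite exprMn; field; rewrite gt_eqF// exprn_gt0.
  apply: (@le_trans _ _ (2 * (tail_const + 1) * a ^+ n)).
    by rewrite ler_wpM2r ?pow_ge0//; lra.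
  rewrite (_ : e / 2 = 2 * (tail_const + 1) * (e / (4 * (tail_const + 1)))).
    by rewrite ler_wpM2l//; lra.
  by field; lra.
near=> u.
have h1 : `|t - u| <= 2 ^- n.
  by near: u; apply: cvgr_dist_le => //; exact: cvg_id.
have h2 : `|psum t - psum u| <= e / 2.
  near: u; apply: cvgr_dist_le; first exact: psum_cont.
  by rewrite divr_gt0.
have [tu|/ltW ut] := leP t u.
  by rewrite distrC ger0_norm ?subr_ge0 ?abscissa_nondec// key.
by rewrite ger0_norm ?subr_ge0 ?abscissa_nondec// key// distrC.
Unshelve. all: by end_near. Qed.

Lemma abscissa_surj x : exists t, H t = x.
Proof.
have [s hs] := abscissa_lo x; have [u hu] := abscissa_hi x.
have su : s <= u.
  rewrite leNgt; apply/negP => /ltW /abscissa_nondec.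
  by rewrite leNgt (le_lt_trans hs).
have [||t _ <-] := @IVT _ H s u x su; last by exists t.
  exact/continuous_subspaceT/abscissa_continuous.
by rewrite ge_min hs/= le_max (ltW hu) orbT.
Qed.

(** Clamping makes the primitive affine beyond [H 1]. On the level curve one component of the
    gradient is then 1 or -1, and the direction of the normal is carried by the other one. *)
Definition slope (x : R) : R := Num.max (-1) (Num.min 1 (ginv H x)).

Local Notation G := slope.

Let Gmod := ginv_modulus abscissa_nondec abscissa_lo abscissa_hi.

Local Lemma slope_clamp t : G (H t) = Num.max (-1) (Num.min 1 t).
Proof.
by rewrite /G (ginvK abscissa_nondec abscissa_lo abscissa_hi abscissa_inc).
Qed.

Lemma slope_abscissa t : `|t| <= 1 -> G (H t) = t.
Proof.
rewrite ler_norml slope_clamp => /andP[t1 t2].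
by rewrite min_r// max_r.
Qed.

Lemma slope_norm x : `|G x| <= 1.
Proof.
rewrite ler_norml /G le_max lexx/= ge_max ge_min lexx/= andbT; lra.
Qed.

Lemma slope_nondec : {homo G : x y / x <= y}.
Proof.
move=> x y xy; rewrite /G.
apply: le_max2 => //; apply: le_min2 => //.
exact: (ginv_nondec abscissa_nondec abscissa_lo abscissa_hi).
Qed.

Lemma slope_eq1 x : H 1 <= x -> G x = 1.
Proof.
have [t <-] := abscissa_surj x => h.
have t1 : 1 <= t.
  by rewrite leNgt; apply/negP => /abscissa_inc; rewrite ltNge h.
by rewrite slope_clamp min_l// max_r//; lra.
Qed.

Lemma slopeN x : G (- x) = - G x.
Proof.
have [t <-] := abscissa_surj x; rewrite -abscissaN !slope_clamp.
by case: (leP 1 t) => ?; case: (leP 1 (- t)) => ?; do ?[case: leP => ?]; lra.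
Qed.

Lemma slope_inj x y : `|x| <= H 1 -> `|y| <= H 1 -> G x = G y -> x = y.
Proof.
have h x' : `|x'| <= H 1 -> exists2 t, `|t| <= 1 & x' = H t.
  have [t <-] := abscissa_surj x'; rewrite ler_norml -abscissaN => /andP[h1 h2].
  exists t => //; rewrite ler_norml; apply/andP; split.
    by rewrite leNgt; apply/negP => /abscissa_inc; rewrite ltNge h1.
  by rewrite leNgt; apply/negP => /abscissa_inc; rewrite ltNge h2.
by move=> /h[s s1 ->] /h[t t1 ->]; rewrite !slope_abscissa// => ->.
Qed.

Lemma slope_mod j x y : x <= y -> y - x <= a ^+ j -> G y - G x <= 2 ^- j.
Proof.
move=> xy hxy; have : ginv H y - ginv H x <= 2 ^- j.
  by apply: Gmod hxy => s s' /ltW; exact: abscissa_add.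
have := ginv_nondec abscissa_nondec abscissa_lo abscissa_hi xy.
rewrite /G; move: (ginv H x) (ginv H y) => u v uv h.
have p2 : 0 < (2 : R) ^- j by rewrite invr_gt0 exprn_gt0.
by case: (leP 1 u) => ?; case: (leP 1 v) => ?;
  do ?[case: (leP (-1) _) => ?]; lra.
Qed.

Lemma slope_continuous : continuous G.
Proof.
move=> x; apply/cvgrPdist_le => e e0.
have [n hn] : exists n, 2 ^- n <= e by exact: exists_pow2V_le.
near=> y; have hy : `|x - y| < a ^+ n.
  by near: y; apply: cvgr_dist_lt; [exact: cvg_id|exact: exprn_gt0].
have [xy|/ltW yx] := leP x y.
  rewrite distrC ger0_norm ?subr_ge0 ?slope_nondec//; apply: le_trans hn.
  by apply: slope_mod => //; rewrite ltW//; move: hy; rewrite distrC ger0_norm ?subr_ge0.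
rewrite ger0_norm ?subr_ge0 ?slope_nondec//; apply: le_trans hn.
by apply: slope_mod => //; rewrite ltW//; move: hy; rewrite ger0_norm ?subr_ge0.
Unshelve. all: by end_near. Qed.

Lemma slope_holder (alpha x y : R) : 0 < alpha -> a `^ alpha = 2^-1 ->
  x <= y -> G y - G x <= 2 * (y - x) `^ alpha.
Proof.
move=> alpha0 a_alpha; rewrite le_eqVlt => /predU1P[->|xy].
  by rewrite subrr mulr_ge0// powR_ge0.
have [h1|h1] := leP (y - x) 1; last first.
  have : 1 <= (y - x) `^ alpha.
    rewrite (_ : 1 = 1 `^ alpha); last by rewrite powR1.
    by rewrite ge0_ler_powR ?nnegrE// ltW//; lra.
  have := slope_norm x; have := slope_norm y; rewrite !ler_norml.
  by move=> /andP[? ?] /andP[? ?]; lra.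
have yx : 0 < y - x by rewrite subr_gt0.
have ex : exists n, a ^+ n <= y - x.
  by apply: exists_expr_le => //; rewrite a_ge0 a_lt1.
case: (ex_minnP ex) => -[|n] hn hmin.
  have xy1 : y - x <= a ^+ 0 by rewrite expr0.
  apply: (le_trans (slope_mod (ltW xy) xy1)).
  have -> : y - x = 1 by apply/eqP; rewrite eq_le h1; move: hn; rewrite expr0.
  by rewrite powR1/= expr0 invr1; lra.
have hn' : y - x <= a ^+ n.
  by rewrite leNgt; apply/negP => /ltW /hmin; rewrite ltnn.
apply: (le_trans (slope_mod (ltW xy) hn')).
have <- : 2 * (a ^+ n.+1) `^ alpha = 2 ^- n.
  rewrite -powR_mulrn ?a_ge0// powRAC a_alpha powR_mulrn//.
  by rewrite exprS mulrA divff// mul1r exprVn.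
by rewrite ler_wpM2l// ge0_ler_powR ?nnegrE ?pow_ge0// ltW.
Qed.

End Slope.

(** * The domain and its boundary *)

Section Potential.
Variables (R : realType) (a : R).
Hypotheses (a_gt0 : 0 < a) (a_lt : 2 * a < 1).
Implicit Types (r s t x y : R).

Local Notation H := (abscissa a).
Local Notation G := (slope a).
Local Notation mu := (@lebesgue_measure R).

Definition corner : R := H 1.
Local Notation X := corner.

Lemma corner_gt0 : 0 < X.
Proof. by rewrite /X -(abscissa0 a); exact: abscissa_inc. Qed.

Lemma slope_corner x : X <= x -> G x = 1.
Proof. exact: slope_eq1. Qed.

Lemma slope0 : G 0 = 0.
Proof. by rewrite -{1}(abscissa0 a) slope_abscissa// normr0. Qed.

Lemma slope_gt0 x : 0 < x -> 0 < G x.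
Proof.
move=> x0; rewrite lt_neqAle -{2}slope0 slope_nondec ?ltW// andbT eq_sym.
have [xX|Xx] := leP x X; last by rewrite slope_corner ?oner_eq0// ltW.
have h1 : `|x| <= H 1 by rewrite gtr0_norm.
have h2 : `|0 : R| <= H 1 by rewrite normr0 ltW ?corner_gt0.
apply/eqP => e; have := slope_inj a_gt0 a_lt h1 h2.
by rewrite slope0 => /(_ e) x_eq0; rewrite x_eq0 ltxx in x0.
Qed.

Lemma slope_ge0 x : 0 <= x -> 0 <= G x.
Proof. by move=> x0; rewrite -slope0 slope_nondec. Qed.

(* The slope is -1 near -oo, so that [slope + 1] is integrable there. *)
Definition potential x : R :=
  \int[mu]_(t in `]-oo, x]) (G t + 1) - \int[mu]_(t in `]-oo, (0 : R)]) (G t + 1)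
  - x.

Local Notation Psi := potential.

Local Lemma slopeD1_continuous : continuous (fun t => G t + 1).
Proof.
move=> t; apply: cvgD; last exact: cvg_cst.
exact: slope_continuous.
Qed.

Local Lemma slopeD1_integrable x :
  mu.-integrable `]-oo, x] (EFin \o (fun t => G t + 1)).
Proof.
pose f := EFin \o (fun t => G t + 1).
apply: (proj2 (@integrable_mkcond _ _ R mu `]-oo, x]%classic f
  (measurable_itv _))).
have -> : f \_ `]-oo, x] = f \_ `[- X, x].
  apply/funext => t; rewrite /patch !mem_setE !in_itv/=.
  have [//|tX] := leP (- X) t; case: ifP => //= _; rewrite /f/=.
  have -> : G t = -1.
    by rewrite -[t]opprK slopeN// slope_corner// lerNr ltW.
  by rewrite addNr.
apply: (proj1 (@integrable_mkcond _ _ R mu `[- X, x]%classic f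
  (measurable_itv _))).
apply: continuous_compact_integrable.
  exact: segment_compact.
exact/continuous_subspaceT/slopeD1_continuous.
Qed.

Lemma potential_is_derive x : is_derive x 1 Psi (G x).
Proof.
pose F y := \int[mu]_(t in `]-oo, y]) (G t + 1).
have [F1 F2] : derivable F x 1 /\ derive1 F x = G x + 1.
  apply: (@continuous_FTC1 _ (fun t => G t + 1) -oo%O x (x + 1)) => //.
  - by rewrite ltrDl.
  - exact: slopeD1_integrable.
  - by rewrite ltNyr.
  - exact: slopeD1_continuous.
have dF : is_derive x 1 F (G x + 1)
  by apply: DeriveDef; [exact: F1|rewrite -derive1E; exact: F2].
have -> : Psi = (F - cst (F 0)) - id by apply/funext => y; rewrite /Psi.
have -> : G x = (G x + 1 - 0) - 1 by ring.
by apply: is_deriveB; apply: is_deriveB.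
Qed.

Lemma potential_continuous : continuous Psi.
Proof.
move=> x; apply/differentiable_continuous/derivable1_diffP.
by have h := potential_is_derive x; exact: ex_derive.
Qed.

Lemma potential0 : Psi 0 = 0.
Proof. by rewrite /Psi subrr subr0. Qed.

(** The supporting-line form of convexity, on which the geometric estimates rest; it follows from
    the mean value theorem and the monotonicity of G. *)
Lemma potential_subgrad x y : Psi x + G x * (y - x) <= Psi y.
Proof.
have [xy|/ltW yx] := leP x y.
  have [|c] := MVT_segment xy (fun z _ => potential_is_derive z).
    exact/continuous_subspaceT/potential_continuous.
  rewrite in_itv/= => /andP[xc _] e.
  suff : G x * (y - x) <= G c * (y - x) by lra.
  by rewrite ler_wpM2r ?subr_ge0// slope_nondec.
have [|c] := MVT_segment yx (fun z _ => potential_is_derive z).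
  exact/continuous_subspaceT/potential_continuous.
rewrite in_itv/= => /andP[_ cx] e.
suff : G c * (x - y) <= G x * (x - y) by lra.
by rewrite ler_wpM2r ?subr_ge0// slope_nondec.
Qed.

Lemma potentialN x : Psi (- x) = Psi x.
Proof.
pose F y := Psi y - Psi (- y).
have : F x = F 0.
  apply: is_derive_0_is_cst => y.
  have -> : F = Psi - (Psi \o -%R) by [].
  have -> : 0 = G y - G (- y) * (- 1) by rewrite slopeN//; lra.
  apply: is_deriveB; first exact: potential_is_derive.
  apply: is_derive1_comp; first exact: potential_is_derive.
by rewrite /F oppr0 subrr => /eqP; rewrite subr_eq0 => /eqP ->.
Qed.

Lemma potential_norm x : Psi `|x| = Psi x.
Proof. by case: (ger0P x) => // _; rewrite potentialN. Qed.

Lemma potential_corner x : X <= x -> Psi x = Psi X + (x - X).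
Proof.
move=> Xx; apply/eqP; rewrite eq_le; apply/andP; split.
  by have := potential_subgrad x X; rewrite slope_corner//; lra.
by have := potential_subgrad X x; rewrite slope_corner//; lra.
Qed.

Lemma potential_inc x y : 0 <= x -> x < y -> Psi x < Psi y.
Proof.
move=> x0 xy; pose m := (x + y) / 2.
have := potential_subgrad x m; have := potential_subgrad m y.
have : 0 < G m * (y - m) by rewrite mulr_gt0 ?slope_gt0// /m; lra.
have : 0 <= G x * (m - x) by rewrite mulr_ge0 ?slope_ge0// /m; lra.
lra.
Qed.

Lemma potential_le x y : 0 <= x -> 0 <= y -> (Psi x <= Psi y) = (x <= y).
Proof.
move=> x0 y0; apply/idP/idP; last first.
  by rewrite le_eqVlt => /predU1P[->//|xy]; exact/ltW/potential_inc.
by apply: contraLR; rewrite -!ltNge; exact: potential_inc.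
Qed.

Lemma potential_le_norm x y : (Psi x <= Psi y) = (`|x| <= `|y|).
Proof. by rewrite -(potential_le (normr_ge0 x) (normr_ge0 y)) !potential_norm. Qed.

Lemma potential_lt_norm x y : (Psi x < Psi y) = (`|x| < `|y|).
Proof. by rewrite !ltNge potential_le_norm. Qed.

Lemma potential_ge0 x : 0 <= Psi x.
Proof. by rewrite -potential0 potential_le_norm normr0. Qed.

Lemma potential_gt0 x : x != 0 -> 0 < Psi x.
Proof. by move=> x0; rewrite -potential0 potential_lt_norm normr0 normr_gt0. Qed.

Lemma potential_convex t x y : 0 <= t <= 1 ->
  Psi ((1 - t) * x + t * y) <= (1 - t) * Psi x + t * Psi y.
Proof.
move=> /andP[t0 t1]; set z := _ + _.
have h1 : 0 <= 1 - t by lra.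
have := ler_wpM2l h1 (potential_subgrad z x).
have := ler_wpM2l t0 (potential_subgrad z y).
have : (1 - t) * (Psi z + G z * (x - z)) + t * (Psi z + G z * (y - z)) = Psi z.
  by rewrite /z; ring.
lra.
Qed.

(* [top] is the half-width of the domain. *)
Definition top : R := X + Psi X.

Lemma potential_top : Psi top = Psi X + Psi X.
Proof.
rewrite /top [LHS]potential_corner ?lerDl ?potential_ge0//.
by ring.
Qed.

Lemma top_gt0 : 0 < top.
Proof. by rewrite ltr_pwDl ?corner_gt0// potential_ge0. Qed.

Definition potential_inv y : R := sup [set s | 0 <= s /\ Psi s <= y].

Lemma potential_invK s : 0 <= s -> potential_inv (Psi s) = s.
Proof.
move=> s0; have us : ubound [set r | 0 <= r /\ Psi r <= Psi s] s.
  by move=> r /= [r0]; rewrite potential_le.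
apply/eqP; rewrite eq_le; apply/andP; split.
  by apply: ge_sup => //; exists s.
by apply: ub_le_sup => //; exists s.
Qed.

Lemma potential_onto y : 0 <= y <= Psi X + Psi X ->
  exists2 s, 0 <= s & Psi s = y.
Proof.
move=> hy; have [||s] := @IVT _ Psi 0 top y (ltW top_gt0).
- exact/continuous_subspaceT/potential_continuous.
- have h : 0 <= Psi X + Psi X by rewrite addr_ge0 ?potential_ge0.
  by rewrite potential0 potential_top (min_l h) (max_r h).
- by rewrite in_itv/= => /andP[s0 _] <-; exists s.
Qed.

Lemma potential_inv_is_derive s : 0 < s ->
  is_derive (Psi s) 1 potential_inv (G s)^-1.
Proof.
move=> s0; apply: is_derive_inverse.
- near=> r; rewrite potential_invK//.
  by near: r; apply: (cvgr_ge s); [exact: cvg_id|exact: s0].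
- by near=> r; exact: potential_continuous.
- exact: potential_is_derive.
- by rewrite gt_eqF// slope_gt0.
Unshelve. all: by end_near. Qed.

End Potential.

Section Domain.
Variables (R : realType) (a : R).
Hypotheses (a_gt0 : 0 < a) (a_lt : 2 * a < 1).
Implicit Types (r s t x y : R) (z w : R * R).

Local Notation G := (slope a).
Local Notation X := (corner a).
Local Notation Psi := (potential a).
Local Notation top := (top a).

Definition level z : R := Psi z.1 + Psi z.2.

Definition cap : R := Psi X + Psi X.

Definition dom : set (R * R) := [set z | level z < cap].

Lemma cap_gt0 : 0 < cap.
Proof. by rewrite addr_gt0 ?potential_gt0 ?gt_eqF ?corner_gt0. Qed.

Lemma level_continuous : continuous level.
Proof.
move=> z; apply: cvgD.
  by apply: continuous_comp; [exact: cvg_fst|exact: potential_continuous].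
by apply: continuous_comp; [exact: cvg_snd|exact: potential_continuous].
Qed.

Lemma level_subgrad z w :
  level z + (G z.1 * (w.1 - z.1) + G z.2 * (w.2 - z.2)) <= level w.
Proof.
have := potential_subgrad a_gt0 a_lt z.1 w.1.
have := potential_subgrad a_gt0 a_lt z.2 w.2.
by rewrite /level; lra.
Qed.

Lemma level_scale t z : 0 <= t <= 1 -> level (t *: z) <= t * level z.
Proof.
move=> t01; rewrite /level.
rewrite -[(t *: z).1]/(t * z.1) -[(t *: z).2]/(t * z.2).
have := potential_convex a_gt0 a_lt 0 z.1 t01.
have := potential_convex a_gt0 a_lt 0 z.2 t01.
rewrite !mulr0 !add0r potential0 mulr0 !add0r; lra.
Qed.

Lemma levelN z : level (- z) = level z.
Proof. by rewrite /level !potentialN. Qed.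

Lemma level_le_top z : level z <= cap -> `|z.1| <= top /\ `|z.2| <= top.
Proof.
have t0 := ltW (top_gt0 a_gt0 a_lt).
have h x y : Psi x + Psi y <= cap -> `|x| <= top.
  move=> xy; rewrite -[leRHS]ger0_norm// -(potential_le_norm a_gt0 a_lt).
  rewrite potential_top//; have := potential_ge0 a_gt0 a_lt y; move: xy.
  by rewrite /cap; lra.
by rewrite /level => zc; split; [exact: h zc|apply: (h _ z.1); rewrite addrC].
Qed.

Lemma dom_open : open dom.
Proof.
apply: (@open_comp _ _ level [set x | x < cap]) => [z _|].
  exact: level_continuous.
exact: open_lt.
Qed.

Lemma dom_bounded : bounded_set dom.
Proof.
exists top; split; first exact: num_real.
move=> M topM z /ltW /level_le_top[z1 z2] /=.
by rewrite prod_normE ge_max !(le_trans _ (ltW topM)).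
Qed.

Lemma dom_connected : connected dom.
Proof.
(* The domain is star-shaped about 0. *)
have -> : dom = \bigcup_(z in dom) ((fun t : R => t *: z) @` `[0, 1]%classic).
  apply/seteqP; split => z.
    by move=> zD; exists z => //; exists 1; rewrite ?scale1r//= in_itv/= ler01 lexx.
  move=> [w wD [t /=]]; rewrite in_itv/= => t01 <-.
  apply: (le_lt_trans (level_scale w t01)); case/andP: t01 => t0 t1.
  have : 0 <= level w by rewrite addr_ge0// potential_ge0.
  by move: wD; rewrite /dom/=; nra.
apply: bigcup_connected.
  exists 0 => z zD; exists 0; rewrite ?scale0r//= in_itv/= ler01 lexx//.
move=> z zD; apply: connected_continuous_connected.
  exact: segment_connected.
by apply: continuous_subspaceT => t; exact: scalel_continuous.
Qed.

Lemma dom_domain : domain dom.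
Proof.
split; [exists 0|exact: dom_open|exact: dom_connected].
by rewrite /dom/= /level/= potential0 addr0 cap_gt0.
Qed.

Lemma boundary_dom : boundary dom = [set z | level z = cap].
Proof.
rewrite /boundary (proj1 (interior_id _) dom_open); apply/seteqP; split => z /=.
  move=> [cz nz]; apply/eqP; rewrite eq_le; apply/andP; split; last first.
    by rewrite leNgt; apply/negP.
  have cl : closed [set w | level w <= cap].
    apply: (@preimage_closed _ _ level [set x | x <= cap]) => [w _|].
      exact: level_continuous.
    exact: closed_le.
  have /closure_id clE := cl.
  suff : closure dom `<=` [set w | level w <= cap] by exact.
  by rewrite clE; apply: closure_subset => w /ltW.
move=> zc; split; last by rewrite /dom/= zc ltxx.
move=> B zB.
(* Shrinking a point of the level curve towards 0 strictly lowers its level, so that the point is a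
   limit of points of the domain. *)
have : \forall t \near 0^'+, B ((1 - t) *: z).
  have : (1 - t) *: z @[t --> 0^'+] --> (1 - 0 : R) *: z.
    apply: cvgZl; apply: cvgB; first exact: cvg_cst.
    by apply: cvg_at_right_filter; exact: cvg_id.
  by rewrite subr0 scale1r; exact.
move=> hB; near (0 : R)^'+ => t.
exists ((1 - t) *: z); split; last by near: t.
have t0 : 0 < t by near: t; exact: nbhs_right_gt.
have t1 : t < 1 by near: t; exact: nbhs_right_lt.
have t01 : 0 <= 1 - t <= 1 by apply/andP; split; lra.
rewrite /dom/=; apply: (le_lt_trans (level_scale z t01)).
by rewrite zc; have := cap_gt0; nra.
Unshelve. all: by end_near. Qed.

Definition grad z : R * R := (G z.1, G z.2).

Definition normal z : R * R := (enorm (grad z))^-1 *: grad z.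

End Domain.

(** * Charts of the boundary and its outer normal *)

Section Smoothness.
Variables (R : realType) (a : R).
Hypotheses (a_gt0 : 0 < a) (a_lt : 2 * a < 1).
Implicit Types (r s t x y : R) (z w : R * R).

Local Notation G := (slope a).
Local Notation X := (corner a).
Local Notation Psi := (potential a).
Local Notation top := (top a).
Local Notation cap := (cap a).
Local Notation level := (level a).
Local Notation dom := (dom a).
Local Notation grad := (grad a).
Local Notation normal := (normal a).

Definition graph r : R := potential_inv a (cap - Psi r).

Lemma graphP r : `|r| < top ->
  [/\ 0 < graph r & Psi (graph r) = cap - Psi r].
Proof.
have t0 := ltW (top_gt0 a_gt0 a_lt); move=> rt.
have h : Psi r < cap.
  by rewrite /cap -potential_top// potential_lt_norm// (ger0_norm t0).
have [|s s0 se] := potential_onto a_gt0 a_lt (y := cap - Psi r).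
  by rewrite subr_ge0 (ltW h)/= gerBl potential_ge0.
have gs : graph r = s by rewrite /graph -se potential_invK.
rewrite gs; split => //; rewrite lt_neqAle s0 andbT eq_sym.
by apply: contraTneq h => s_0; rewrite -leNgt -subr_le0 -se s_0 potential0.
Qed.

Lemma graph_is_derive r : `|r| < top ->
  is_derive r 1 graph (- (G r / G (graph r))).
Proof.
move=> /graphP[g0 ge].
have -> : - (G r / G (graph r)) = (G (graph r))^-1 * (0 - G r) by ring.
apply: (@is_derive1_comp _ (potential_inv a) (cst cap - Psi)).
  by rewrite [X in is_derive X](esym ge); exact: potential_inv_is_derive.
by apply: is_deriveB; exact: potential_is_derive.
Qed.

Lemma near_lt_top r : `|r| < top -> \forall x \near r, `|x| < top.
Proof.
have h : `|x| @[x --> r] --> `|r| by apply: cvg_norm; exact: cvg_id.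
exact: cvgr_lt h _.
Qed.

Lemma derive1_graph r : `|r| < top -> derive1 graph r = - (G r / G (graph r)).
Proof. by move=> /graph_is_derive h; rewrite derive1E derive_val. Qed.

Lemma derive1_graph_continuous r : `|r| < top ->
  {for r, continuous (derive1 graph)}.
Proof.
move=> rt; rewrite /prop_for /continuous_at derive1_graph//.
have [g0 _] := graphP rt; have hd := graph_is_derive rt.
have cg : {for r, continuous graph}.
  exact/differentiable_continuous/derivable1_diffP.
have h : - (G x / G (graph x)) @[x --> r] --> - (G r / G (graph r)).
  apply: cvgN; apply: cvgM; first exact: slope_continuous.
  apply: cvgV; first by rewrite gt_eqF ?slope_gt0.
  by apply: continuous_comp; [exact: cg|exact: slope_continuous].
apply: cvg_trans h; apply: near_eq_cvg; near=> x.
by rewrite derive1_graph//; near: x; exact: near_lt_top.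
Unshelve. all: by end_near. Qed.

(** Sign changes and the exchange of coordinates preserve [level]; frames obtained from them reduce
    all charts to the single function [graph]. *)
Definition axes (e1 e2 : R * R) : Prop :=
  [/\ Defs.orthonormal e1 e2,
      forall z, z = dot z e1 *: e1 + dot z e2 *: e2,
      forall r s, level (r *: e1 + s *: e2) = Psi r + Psi s
    & forall r s, grad (r *: e1 + s *: e2) = G r *: e1 + G s *: e2].

Lemma axes_exists z : z != 0 -> exists e1 e2, axes e1 e2 /\ 0 < dot z e2.
Proof.
move=> z0.
have sq (b : bool) : ((-1) ^+ b * (-1) ^+ b : R) = 1.
  by rewrite -expr2 sqrr_sign.
have Ps (b : bool) s : Psi (s * (-1) ^+ b) = Psi s.
  by case: b; rewrite ?expr1 ?expr0 ?mulr1// mulrN1 potentialN.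
have Gs (b : bool) s : G (s * (-1) ^+ b) = G s * (-1) ^+ b.
  by case: b; rewrite ?expr1 ?expr0 ?mulr1// !mulrN1 slopeN.
have pair_scale (k p q : R) : k *: ((p, q) : R * R) = (k * p, k * q) by [].
have pair_add (p q p' q' : R) : ((p, q) : R * R) + (p', q') = (p + p', q + q').
  by [].
have [z20|z20] := eqVneq z.2 0; last first.
  exists (1, 0), (0, (-1) ^+ (z.2 < 0)%R); split; last first.
    by rewrite /dot/= mulr0 add0r mulrC -normrEsign normr_gt0.
  split => [|[p q]|r s|r s].
  - by split; rewrite /dot/= ?mulr0 ?mul0r ?mulr1 ?addr0 ?add0r ?sq.
  - by rewrite /dot/= !pair_scale pair_add !(mulr0, mulr1, addr0, add0r) -mulrA sq mulr1.
  - by rewrite !pair_scale pair_add /level/= !(mulr0, mulr1, addr0, add0r) Ps.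
  - by rewrite !pair_scale !pair_add /grad/= !(mulr0, mulr1, addr0, add0r) Gs.
exists (0, 1), ((-1) ^+ (z.1 < 0)%R, 0); split; last first.
  rewrite /dot/= mulr0 addr0 mulrC -normrEsign normr_gt0.
  by apply: contra_neq z0 => z10; case: z z10 z20 => ? ? /= -> ->.
split => [|[p q]|r s|r s].
- by split; rewrite /dot/= ?mulr0 ?mul0r ?mulr1 ?addr0 ?add0r ?sq.
- by rewrite /dot/= !pair_scale pair_add !(mulr0, mulr1, addr0, add0r) -mulrA sq mulr1.
- by rewrite !pair_scale pair_add /level/= !(mulr0, mulr1, addr0, add0r) Ps addrC.
- by rewrite !pair_scale !pair_add /grad/= !(mulr0, mulr1, addr0, add0r) Gs.
Qed.

Lemma dot_axes (e1 e2 : R * R) (p q p' q' : R) : Defs.orthonormal e1 e2 ->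
  dot (p *: e1 + q *: e2) (p' *: e1 + q' *: e2) = p * p' + q * q'.
Proof.
move=> [h1 h2 h3].
transitivity (p * p' * dot e1 e1 + q * q' * dot e2 e2 +
    (p * q' + q * p') * dot e1 e2); last by rewrite h1 h2 h3; ring.
by rewrite /dot/= /GRing.scale/=; ring.
Qed.

(** A whole open half-plane can serve as neighbourhood, since the part of the level curve in it is a
    graph over ]-top, top[. The half-planes of the frames in [axes_exists] cover everything but the
    origin. *)
Lemma graph_chart z (e1 e2 : R * R) : axes e1 e2 -> level z = cap ->
  0 < dot z e2 ->
  C1_chart dom z e1 e2 [set w | 0 < dot w e2] (- top) top graph (dot z e1).
Proof.
move=> [on dec lev _]; have t0 := top_gt0 a_gt0 a_lt.
have graphE w : level w = cap -> 0 < dot w e2 ->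
    `|dot w e1| < top /\ graph (dot w e1) = dot w e2.
  move=> wc w2; have := wc; rewrite {1}[w]dec lev => e; split.
    rewrite -[ltRHS](ger0_norm (ltW t0)) -(potential_lt_norm a_gt0 a_lt).
    rewrite potential_top// -/cap -e ltrDl.
    by rewrite potential_gt0// gt_eqF.
  by rewrite /graph -e addrAC subrr add0r potential_invK// ltW.
move=> zc z2; have [z1 zg] := graphE z zc z2.
split => //.
- split=> //; apply: (@open_comp _ _ (fun w => dot w e2) [set x | 0 < x]) => [w _|].
    by rewrite /dot; apply: cvgD; apply: cvgMl; [exact: cvg_fst|exact: cvg_snd].
  exact: open_gt.
- move=> r; rewrite -ltr_norml => rt; split.
    by have h := graph_is_derive rt; exact: ex_derive.
  exact: derive1_graph_continuous.
- rewrite boundary_dom//; apply/seteqP; split => w /=.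
    move=> [wc w2]; have [w1 wg] := graphE w wc w2.
    by exists (dot w e1); rewrite -?ltr_norml// wg -dec.
  move=> [r]; rewrite -ltr_norml => rt <-; have [g0 ge] := graphP rt.
  rewrite lev ge addrC subrK; split => //.
  have := dot_axes r (graph r) 0 1 on.
  by rewrite scale0r add0r scale1r => ->; rewrite mulr0 add0r mulr1.
- by rewrite -ltr_norml z1 zg -dec.
Qed.

Lemma level_neq0 z : level z = cap -> z != 0.
Proof.
apply: contra_eqN => /eqP ->; rewrite /level/= potential0 addr0 eq_sym gt_eqF//.
exact: cap_gt0.
Qed.

Lemma dom_C1_boundary : C1_boundary dom.
Proof.
move=> z; rewrite boundary_dom// => zc.
have [e1 [e2 [ax z2]]] := axes_exists (level_neq0 zc).
exists e1, e2, [set w | 0 < dot w e2], (- top), top, graph, (dot z e1).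
exact: graph_chart.
Qed.

Lemma dot_ge0 z : 0 <= dot z z.
Proof. by rewrite /dot -!expr2 addr_ge0 ?sqr_ge0. Qed.

Lemma enorm_scale k z : enorm (k *: z) = `|k| * enorm z.
Proof.
rewrite /enorm -sqrtr_sqr -sqrtrM ?sqr_ge0//; congr Num.sqrt.
by rewrite /dot/= /GRing.scale/=; ring.
Qed.

Lemma sqr_enorm z : enorm z ^+ 2 = dot z z.
Proof. by rewrite sqr_sqrtr ?dot_ge0. Qed.

Lemma slope_sqr_corner x : X <= `|x| -> G x ^+ 2 = 1.
Proof.
case: (ger0P x) => _ h; first by rewrite slope_corner// expr1n.
by rewrite -[x]opprK slopeN// sqrrN slope_corner// expr1n.
Qed.

(** With both coordinates below X in modulus the level would be below [Psi X + Psi X], which is why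
    this value was taken for [cap]. The bound allows the gradient to be normalized without loss of
    regularity. *)
Lemma grad_ge1 z : level z = cap -> 1 <= enorm (grad z).
Proof.
move=> zc; suff : 1 <= dot (grad z) (grad z).
  by move=> h; rewrite -sqrtr1 ler_sqrt// (le_trans ler01 h).
have X0 := ltW (corner_gt0 a_gt0 a_lt).
rewrite /dot/= -!expr2.
have [h|h] := leP X `|z.1|; first by rewrite (slope_sqr_corner h) lerDl sqr_ge0.
have [h'|h'] := leP X `|z.2|; first by rewrite (slope_sqr_corner h') lerDr sqr_ge0.
suff : level z < cap by rewrite zc ltxx.
by rewrite /level /cap ltrD// potential_lt_norm// (ger0_norm X0).
Qed.

Lemma enorm_normal z : level z = cap -> enorm (normal z) = 1.
Proof.
move=> /grad_ge1 h; have h0 : 0 < enorm (grad z) by exact: lt_le_trans h.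
by rewrite /normal enorm_scale ger0_norm ?invr_ge0 ?ltW// mulVf// gt_eqF.
Qed.

Lemma dot_grad_normal z : level z = cap -> 0 < dot (grad z) (normal z).
Proof.
move=> /grad_ge1 h; have h0 : 0 < enorm (grad z) by exact: lt_le_trans h.
have -> : dot (grad z) (normal z) = (enorm (grad z))^-1 * dot (grad z) (grad z).
  by rewrite /normal /dot/= /GRing.scale/=; ring.
by rewrite -sqr_enorm mulr_gt0 ?invr_gt0// exprn_gt0.
Qed.

Lemma normal_outer z : level z = cap -> outer_unit_normal dom z (normal z).
Proof.
move=> zc; split; first exact: enorm_normal.
  have [e1 [e2 [ax z2]]] := axes_exists (level_neq0 zc).
  have [on dec _ gr] := ax.
  exists e1, e2, [set w | 0 < dot w e2], (- top), top, graph, (dot z e1).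
  have ch := graph_chart ax zc z2; split => //.
  case: ch => _ _ _ _ [zt ze]; rewrite -ltr_norml in zt.
  have [g0 _] := graphP zt.
  rewrite derive1_graph// /normal {2}ze gr scalerDr !scalerA.
  have := dot_axes (_ * G (dot z e1)) (_ * G (graph (dot z e1))) 1 _ on.
  rewrite scale1r => ->.
  by field; rewrite gt_eqF ?slope_gt0// gt_eqF// (lt_le_trans _ (grad_ge1 zc)).
(* Outwards, the supporting line at z suffices. Inwards it is taken at the displaced point, where by
   continuity the gradient still has a positive product with the normal at z. *)
near=> t; split.
  apply/negP; rewrite /dom/= -leNgt -zc.
  apply: le_trans (level_subgrad a_gt0 a_lt z (z + t *: normal z)).
  rewrite lerDl /=.
  have -> : G z.1 * (z.1 + t *: (normal z).1 - z.1) +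
      G z.2 * (z.2 + t *: (normal z).2 - z.2) = t * dot (grad z) (normal z).
    by rewrite /dot/= /GRing.scale/=; ring.
  rewrite mulr_ge0// ?ltW ?dot_grad_normal//.
have t0 : 0 < t by near: t; exact: nbhs_right_gt.
have gt : 0 < dot (grad (z - t *: normal z)) (normal z).
  near: t; apply: (cvgr_gt (dot (grad z) (normal z))); last exact: dot_grad_normal.
  have cz : z - t *: normal z @[t --> 0^'+] --> z.
    have : z - t *: normal z @[t --> 0^'+] --> z - (0 : R) *: normal z.
      apply: cvgB; first exact: cvg_cst.
      by apply: cvgZl; apply: cvg_at_right_filter; exact: cvg_id.
    by rewrite scale0r subr0.
  rewrite /dot; apply: cvgD; apply: cvgMl.
    apply: (cvg_comp _ _ (cvg_comp _ _ cz cvg_fst)).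
    exact: slope_continuous.
  apply: (cvg_comp _ _ (cvg_comp _ _ cz cvg_snd)).
  exact: slope_continuous.
rewrite /dom/= -zc.
apply: lt_le_trans (level_subgrad a_gt0 a_lt (z - t *: normal z) z).
rewrite ltrDl /=.
have -> : G (z.1 - t *: (normal z).1) * (z.1 - (z.1 - t *: (normal z).1)) +
    G (z.2 - t *: (normal z).2) * (z.2 - (z.2 - t *: (normal z).2)) =
    t * dot (grad (z - t *: normal z)) (normal z).
  by rewrite /dot/= /GRing.scale/=; ring.
by rewrite mulr_gt0.
Unshelve. all: by end_near. Qed.

End Smoothness.

(** * Hölder continuity of the normal, and absence of segments *)

Section BoundaryRegularity.
Variables (R : realType) (a alpha : R).
Hypotheses (a_gt0 : 0 < a) (a_lt : 2 * a < 1).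
Hypotheses (alpha_gt0 : 0 < alpha) (a_alpha : a `^ alpha = 2^-1).
Implicit Types (r s t x y : R) (z w : R * R).

Local Notation G := (slope a).
Local Notation X := (corner a).
Local Notation Psi := (potential a).
Local Notation top := (top a).
Local Notation cap := (cap a).
Local Notation level := (level a).
Local Notation dom := (dom a).
Local Notation grad := (grad a).
Local Notation normal := (normal a).

(** Radial projection to the unit circle does not increase distances outside the unit disc: for
    lengths p, q >= 1 and inner product d, the squared distance of the projections is (2pq - 2d) /
    (pq), while that of the vectors is p^2 + q^2 - 2d. *)
Lemma normal_lipschitz z w : level z = cap -> level w = cap ->
  enorm (normal z - normal w) <= enorm (grad z - grad w).
Proof.
move=> /(grad_ge1 a_gt0 a_lt) h /(grad_ge1 a_gt0 a_lt) h'.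
have := sqr_enorm (grad z); have := sqr_enorm (grad w).
move=> q2 p2; apply: ler_wsqrtr; move: h h' q2 p2; rewrite /normal.
set p := enorm (grad z); set q := enorm (grad w) => p1 q1 q2 p2.
have p0 : p != 0 by rewrite gt_eqF// (lt_le_trans _ p1).
have q0 : q != 0 by rewrite gt_eqF// (lt_le_trans _ q1).
pose d := dot (grad z) (grad w).
have -> : dot (grad z - grad w) (grad z - grad w) = p ^+ 2 + q ^+ 2 - 2 * d.
  by rewrite q2 p2 /d /dot/=; ring.
have -> : dot (p^-1 *: grad z - q^-1 *: grad w) (p^-1 *: grad z - q^-1 *: grad w)
    = p^-1 ^+ 2 * p ^+ 2 + q^-1 ^+ 2 * q ^+ 2 - 2 * (p^-1 * q^-1 * d).
  by rewrite q2 p2 /d /dot/= /GRing.scale/=; ring.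
have -> : p^-1 ^+ 2 * p ^+ 2 + q^-1 ^+ 2 * q ^+ 2 - 2 * (p^-1 * q^-1 * d) =
    (2 * (p * q) - 2 * d) / (p * q).
  by field; rewrite p0 q0.
have pq1 : 1 <= p * q by rewrite mulr_ege1.
rewrite ler_pdivrMr ?(lt_le_trans _ pq1)//.
have d0 : 0 <= p ^+ 2 + q ^+ 2 - 2 * d.
  have -> : p ^+ 2 + q ^+ 2 - 2 * d = dot (grad z - grad w) (grad z - grad w).
    by rewrite q2 p2 /d /dot/=; ring.
  exact: dot_ge0.
apply: (@le_trans _ _ (p ^+ 2 + q ^+ 2 - 2 * d)); last by rewrite ler_peMr.
by have := sqr_ge0 (p - q); rewrite sqrrB; lra.
Qed.

Lemma enorm_ge z : `|z.1| <= enorm z /\ `|z.2| <= enorm z.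
Proof.
by split; rewrite -sqrtr_sqr; apply: ler_wsqrtr;
  rewrite /dot -!expr2 ?lerDl ?lerDr sqr_ge0.
Qed.

Lemma enorm_le z : enorm z <= `|z.1| + `|z.2|.
Proof.
rewrite -[leRHS]ger0_norm ?addr_ge0// -sqrtr_sqr.
apply: ler_wsqrtr; rewrite /dot sqrrD -!expr2 !real_normK ?num_real//.
by rewrite lerD2r lerDl mulrn_wge0// mulr_ge0.
Qed.

Lemma slope_holder_norm x y : `|G x - G y| <= 2 * `|x - y| `^ alpha.
Proof.
have [xy|/ltW yx] := leP x y.
  rewrite distrC (distrC x) !ger0_norm ?subr_ge0 ?slope_nondec//.
  exact: slope_holder.
by rewrite !ger0_norm ?subr_ge0 ?slope_nondec//; exact: slope_holder.
Qed.

Lemma normal_holder z w : level z = cap -> level w = cap ->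
  enorm (normal z - normal w) <= 4 * enorm (z - w) `^ alpha.
Proof.
move=> zc wc; apply: (le_trans (normal_lipschitz zc wc)).
apply: (le_trans (enorm_le _)) => /=.
have [h1 h2] := enorm_ge (z - w).
have h x y : `|x - y| <= enorm (z - w) ->
    `|G x - G y| <= 2 * enorm (z - w) `^ alpha.
  move=> xy; apply: (le_trans (slope_holder_norm x y)).
  by rewrite ler_wpM2l// ge0_ler_powR ?nnegrE ?sqrtr_ge0// ltW.
by have := h _ _ h1; have := h _ _ h2; lra.
Qed.

Lemma dom_C1alpha_boundary : C1alpha_boundary alpha dom.
Proof.
split; first exact: dom_C1_boundary.
exists normal; split.
  by move=> z; rewrite boundary_dom//; exact: normal_outer.
apply/eqOP; near=> k; near=> d.
have d0 : 0 < d by near: d; exact: nbhs_right_gt.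
have hub : ubound [set r : R | exists z w, [/\ boundary dom z, boundary dom w,
    enorm (z - w) <= d & r = enorm (normal z - normal w)]] (4 * d `^ alpha).
  move=> x [z [w [+ + zw ->]]]; rewrite boundary_dom// => zc wc.
  apply: (le_trans (normal_holder zc wc)).
  by rewrite ler_wpM2l// ge0_ler_powR ?nnegrE ?sqrtr_ge0// ltW.
(* A concrete boundary point keeps the set under the supremum nonempty. *)
have w0 : boundary dom (0, top).
  by rewrite boundary_dom//= /level/= potential0 add0r potential_top.
have h0 : [set r : R | exists z w, [/\ boundary dom z, boundary dom w,
    enorm (z - w) <= d & r = enorm (normal z - normal w)]] 0.
  exists (0, top), (0, top); split => //; rewrite !subrr.
    by rewrite /enorm /dot/= mulr0 addr0 sqrtr0 ltW.
  by rewrite /enorm /dot/= mulr0 addr0 sqrtr0.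
rewrite /omega ger0_norm; last by apply: ub_le_sup => //; eexists; exact: hub.
rewrite (@ger0_norm _ (d `^ alpha)) ?powR_ge0//.
apply: (@le_trans _ _ (4 * d `^ alpha)); first by apply: ge_sup => //; exists 0.
by rewrite ler_wpM2r ?powR_ge0//; near: k; exact: nbhs_pinfty_ge.
Unshelve. all: by end_near. Qed.

(** Equality at the midpoint m makes G constant on an interval to the right of m. As G is injective
    on [-X, X], m cannot lie strictly inside; the point u is cut off at X to stay in the range of
    injectivity. *)
Lemma potential_affine_mid p q : p != q ->
  Psi ((p + q) / 2) = (Psi p + Psi q) / 2 -> X <= `|(p + q) / 2|.
Proof.
wlog pq : p q / p < q.
  move=> wl pq; have [h|h|e] := ltgtP p q; first exact: (wl _ _ h).
    by rewrite addrC [Psi p + _]addrC; apply: wl => //; rewrite eq_sym.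
  by rewrite e eqxx in pq.
move=> _; set m := (p + q) / 2 => e; rewrite leNgt; apply/negP => mX.
have h1 := potential_subgrad a_gt0 a_lt m p.
have h2 := potential_subgrad a_gt0 a_lt m q.
have mq : m < q by rewrite /m; lra.
pose m' := (m + q) / 2.
have h3 := potential_subgrad a_gt0 a_lt m' q.
have h4 := potential_subgrad a_gt0 a_lt m m'.
have hG : G m' <= G m.
  have q' : 0 < q - m' by rewrite /m'; lra.
  rewrite -(ler_pM2r q').
  have : G m * (p - m) + G m * (q - m) = 0 by rewrite /m; field.
  have : G m * (q - m') = G m * (q - m) - G m * (m' - m) by ring.
  lra.
pose u := Num.min m' X.
have mm' : m < m' by rewrite /m'; lra.
have um : m < u.
  by rewrite /u lt_min mm'/=; move: mX; rewrite ltr_norml => /andP[].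
have uX : u <= X by rewrite /u ge_min lexx orbT.
have um' : u <= m' by rewrite /u ge_min lexx.
have Gu : G u = G m.
  apply/eqP; rewrite eq_le (slope_nondec a_gt0 a_lt (ltW um)) andbT.
  by apply: le_trans hG; exact: slope_nondec.
have unX : `|u| <= X.
  by rewrite ler_norml uX andbT; move: mX; rewrite ltr_norml => /andP[? _]; lra.
have := slope_inj a_gt0 a_lt unX (ltW mX) Gu.
by move=> uE; rewrite uE ltxx in um.
Qed.

(** Two convex functions with constant sum along a segment are both affine along it, so |P| >= X in
    its interior. If the other coordinate U varies, also |U| >= X, and the value [cap] forces |P| =
    X; if it does not vary, Psi (P t) is constant. Either way |P| is constant, which is impossible
    for a nonconstant affine P. *)
Local Lemma no_segment_aux (p q u v : R) : p != q ->
  ~ (forall t, 0 <= t <= 1 ->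
      Psi ((1 - t) * p + t * q) + Psi ((1 - t) * u + t * v) = cap).
Proof.
move=> pq h.
pose P t := (1 - t) * p + t * q; pose U t := (1 - t) * u + t * v.
have half : 0 <= (2^-1 : R) <= 1 by lra.
have mid s t : 0 <= s <= 1 -> 0 <= t <= 1 ->
    Psi ((P s + P t) / 2) = (Psi (P s) + Psi (P t)) / 2 /\
    Psi ((U s + U t) / 2) = (Psi (U s) + Psi (U t)) / 2.
  move=> hs ht; have := h s hs; have := h t ht.
  have := h ((s + t) / 2); rewrite -!/(P _) -!/(U _).
  have -> : P ((s + t) / 2) = (P s + P t) / 2 by rewrite /P; field.
  have -> : U ((s + t) / 2) = (U s + U t) / 2 by rewrite /U; field.
  have -> : 0 <= (s + t) / 2 <= 1 by move: hs ht => /andP[? ?] /andP[? ?]; lra.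
  have := potential_convex a_gt0 a_lt (P s) (P t) half.
  have := potential_convex a_gt0 a_lt (U s) (U t) half.
  have -> : (1 - 2^-1) * P s + 2^-1 * P t = (P s + P t) / 2 by field.
  have -> : (1 - 2^-1) * U s + 2^-1 * U t = (U s + U t) / 2 by field.
  by move=> ? ? /(_ isT) ? ? ?; split; lra.
have interior_mid (f : R -> R) (f0 f1 t : R) : f0 != f1 -> 0 < t < 1 ->
    (forall t, f t = (1 - t) * f0 + t * f1) ->
    (forall s t, 0 <= s <= 1 -> 0 <= t <= 1 ->
      Psi ((f s + f t) / 2) = (Psi (f s) + Psi (f t)) / 2) -> X <= `|f t|.
  move=> f01 /andP[t0 t1] fE fmid; pose e := Num.min t (1 - t).
  have e0 : 0 < e by rewrite /e lt_min t0/=; lra.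
  have e1 : e <= t by rewrite /e ge_min lexx.
  have e2 : e <= 1 - t by rewrite /e ge_min lexx orbT.
  have -> : f t = (f (t - e) + f (t + e)) / 2 by rewrite !fE; field.
  apply: potential_affine_mid; last by apply: fmid; apply/andP; split; lra.
  rewrite -subr_eq0.
  have -> : f (t - e) - f (t + e) = 2 * e * (f0 - f1) by rewrite !fE; ring.
  by apply: mulf_neq0; [apply: mulf_neq0 => //; rewrite gt_eqF|rewrite subr_eq0].
have PX t : 0 < t < 1 -> X <= `|P t|.
  by move=> t01; apply: (interior_mid P p q) => // s r hs hr;
    have [] := mid s r hs hr.
have X0 := ltW (corner_gt0 a_gt0 a_lt).
have PsiE x y : Psi x = Psi y -> `|x| = `|y|.
  move=> xy; apply/eqP; rewrite eq_le -!(potential_le_norm a_gt0 a_lt).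
  by rewrite xy lexx.
have P_half t : 0 < t < 1 -> `|P t| = `|P 2^-1|.
  move=> t01; have [uv|uv] := eqVneq u v.
    have t01' : 0 <= t <= 1 by case/andP: t01 => ? ?; apply/andP; split; exact: ltW.
    apply: PsiE; have := h t t01'; have := h _ half; rewrite -!/(P _).
    have e s : (1 - s) * u + s * v = u by rewrite uv; ring.
    by rewrite !e; lra.
  suff PX' s : 0 < s < 1 -> `|P s| = `|X|.
    by rewrite !PX'//; apply/andP; split; lra.
  move=> s01; apply: PsiE.
  have s01' : 0 <= s <= 1 by case/andP: s01 => ? ?; apply/andP; split; exact: ltW.
  have UX : X <= `|U s|.
    by apply: (interior_mid U u v) => // r r' hr hr'; have [] := mid r r' hr hr'.
  have := h s s01'; rewrite -/(P s) -/(U s) /cap.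
  have : Psi X <= Psi (P s) by rewrite potential_le_norm// (ger0_norm X0) PX.
  have : Psi X <= Psi (U s) by rewrite potential_le_norm// (ger0_norm X0).
  lra.
(* An injective affine map takes a given modulus at two parameters at most, so three interior
   parameters give the contradiction. *)
have h1 : `|P (4^-1)| = `|P 2^-1| by apply: P_half; apply/andP; split; lra.
have h2 : `|P (3 / 4)| = `|P 2^-1| by apply: P_half; apply/andP; split; lra.
have p1 : P 4^-1 = 3 / 4 * p + 1 / 4 * q by rewrite /P; field.
have p2 : P 2^-1 = 1 / 2 * p + 1 / 2 * q by rewrite /P; field.
have p3 : P (3 / 4) = 1 / 4 * p + 3 / 4 * q by rewrite /P; field.
move/eqP: h1; move/eqP: h2; rewrite !eqr_norm2 p1 p2 p3.
by move=> /orP[] /eqP h1 /orP[] /eqP h2; move/eqP: pq; apply; lra.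
Qed.

Lemma boundary_no_segment z w : z <> w -> ~ (segment z w `<=` boundary dom).
Proof.
move=> zw; rewrite boundary_dom// => zwD.
have h t : 0 <= t <= 1 -> Psi ((1 - t) * z.1 + t * w.1) +
    Psi ((1 - t) * z.2 + t * w.2) = cap.
  by move=> t01; apply: (zwD ((1 - t) *: z + t *: w)); exists t.
have [e1|n1] := eqVneq z.1 w.1; last exact: (no_segment_aux n1 h).
have [e2|n2] := eqVneq z.2 w.2.
  by apply: zw; case: z e1 e2 {zwD h} => ? ?; case: w => ? ? /= -> ->.
by apply: (@no_segment_aux _ _ z.1 w.1 n2) => t t01; rewrite addrC h.
Qed.

End BoundaryRegularity.

(** * Pointwise decay of the Fourier transform *)

Section Translation.
Variable R : realType.
Local Notation mu := (@lebesgue_measure R).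

Definition translate (c x : R) : measurableTypeR R := x + c.

Lemma translate_measurable c :
  measurable_fun [set: measurableTypeR R] (translate c).
Proof. by apply: measurable_funD => //; exact: measurable_cst. Qed.

Lemma lebesgue_measure_translate c (A : set R) : measurable A ->
  pushforward mu (translate c) A = mu A.
Proof.
move=> mA; apply/esym/lebesgue_measure_unique => //=.
  exact: translate_measurable.
move=> _ _ [[u v]] _ <-.
rewrite /pushforward.
have -> : translate c @^-1` `]u, v]%classic = `]u - c, v - c]%classic.
  by apply/seteqP; split => x /=; rewrite !in_itv/= /translate ltrBlDr lerBrDr.
rewrite !lebesgue_measure_itv/= !lte_fin ltrD2r.
by case: ifP => // _; rewrite -!EFinB; congr (_%:E); ring.
Qed.

Lemma integral_translate c (f : R -> \bar R) : measurable_fun [set: R] f ->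
  (\int[mu]_x f (x + c)%R = \int[mu]_x f x)%E.
Proof.
have ge0 (g : R -> \bar R) : measurable_fun [set: R] g ->
    (forall x, 0 <= g x)%E -> (\int[mu]_x g (x + c)%R = \int[mu]_x g x)%E.
  move=> mg g0.
  have := @ge0_integral_pushforward _ _ (measurableTypeR R) (measurableTypeR R) R
    _ (translate_measurable c) mu setT g measurableT mg (fun x _ => g0 x).
  rewrite preimage_setT => <-.
  apply: eq_measure_integral => [|mt A mA _]; first exact: translate_measurable.
  exact: lebesgue_measure_translate.
move=> mf; rewrite integralE [RHS]integralE; congr (_ - _)%E.
  rewrite -[RHS](ge0 (f^\+)%E)//; last exact: measurable_funepos.
  by apply: eq_integral => x _; rewrite !funeposE.
rewrite -[RHS](ge0 (f^\-)%E)//; last exact: measurable_funeneg.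
by apply: eq_integral => x _; rewrite !funenegE.
Qed.

Lemma Rintegral_translate c (f : R -> R) : measurable_fun [set: R] f ->
  \int[mu]_x f (x + c) = \int[mu]_x f x.
Proof.
move=> mf; rewrite /Rintegral; congr fine.
by apply: (@integral_translate c (EFin \o f)); exact: measurableT_comp.
Qed.

Lemma bounded_support_integrable (f : R -> R) (M B : R) :
  measurable_fun [set: R] f -> (forall x, `|f x| <= M) ->
  (forall x, f x != 0 -> `|x| <= B) -> mu.-integrable setT (EFin \o f).
Proof.
move=> mf fM fB.
have -> : EFin \o f = (EFin \o f) \_ `[- B, B].
  apply/funext => x; rewrite /patch mem_setE in_itv/= -ler_norml.
  by case: ifPn => // h /=; case: (eqVneq (f x) 0) => [->//|/fB]; rewrite (negbTE h).
apply: (proj1 (@integrable_mkcond _ _ R mu `[- B, B]%classic _ _)) => //.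
apply: measurable_bounded_integrable => //.
- by rewrite /= lebesgue_measure_itv/=; case: ifP => // _; rewrite -EFinB ltry.
- exact: measurable_funS mf.
- exists M; split; first exact: num_real.
  by move=> N MN x _ /=; rewrite (le_trans (fM x))// ltW.
Qed.

Lemma plane_bounded_support_integrable (f : R * R -> R) (M B : R) :
  measurable_fun [set: measurableTypeR R * measurableTypeR R] f ->
  (forall z, `|f z| <= M) ->
  (forall z, f z != 0 -> `|z.1| <= B /\ `|z.2| <= B) ->
  (@lebesgue2 R).-integrable setT (EFin \o f).
Proof.
move=> mf fM fB.
pose box : set (measurableTypeR R * measurableTypeR R) :=
  `[- B, B]%classic `*` `[- B, B]%classic.
have mbox : measurable box by exact: measurableX.
have -> : EFin \o f = (EFin \o f) \_ box.
  apply/funext => z; rewrite /patch; case: ifPn => // h /=.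
  case: (eqVneq (f z) 0) => [->//|/fB[h1 h2]]; case/negP: h.
  by rewrite inE; split; rewrite /= in_itv/= -ler_norml.
apply: (proj1 (@integrable_mkcond _ _ R lebesgue2 box _ mbox)) => //.
apply: measurable_bounded_integrable => //.
- rewrite /lebesgue2 /box [X in (X < _)%E]product_measure1E//=.
  rewrite lebesgue_measure_itv/=.
  by case: ifP => // _; rewrite ?mule0// -EFinB -EFinM ltry.
- exact: measurable_funS mf.
- exists M; split; first exact: num_real.
  by move=> N MN x _ /=; rewrite (le_trans (fM x))// ltW.
Qed.

(** Within an end window one neighbour of s lies outside the support and the other contributes at
    most w, so D >= - w and |D| <= D + 2 * w. Elsewhere D is nonnegative. *)
Lemma second_difference_pointwise (A : R -> R) (S h w s : R)
  (D := 2 * A s - A (s + h) - A (s - h)) :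
  0 < h -> (forall u, 0 <= A u) -> (forall u, S <= `|u| -> A u = 0) ->
  (`|s| < S - h -> 0 <= D) ->
  (forall u, S - 2 * h <= `|u| -> A u <= w) ->
  `|D| <= D + 2 * w * (\1_(`[S - h, S + h]%classic) s +
                        \1_(`[- S - h, - S + h]%classic) s).
Proof.
move=> h0 A0 AS Ad Aw.
have w0 : 0 <= w.
  apply: le_trans (A0 `|S|) (Aw _ _); rewrite normr_id.
  by have := ler_norm S; lra.
set i1 : R := \1_ _ s; set i2 : R := \1_ _ s.
have W0 : 0 <= i1 by [].
have V0 : 0 <= i2 by [].
have [sS|Ss] := ltP `|s| (S - h).
  by rewrite ger0_norm ?Ad// lerDl mulr_ge0 ?addr_ge0// mulr_ge0.
have [Shs|sSh] := ltP (S + h) `|s|.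
  have e1 : A s = 0 by apply: AS; lra.
  have e2 : A (s + h) = 0.
    by apply: AS; have := lerB_normD s h; rewrite (gtr0_norm h0); lra.
  have e3 : A (s - h) = 0.
    by apply: AS; have := lerB_normD s (- h); rewrite normrN (gtr0_norm h0); lra.
  rewrite /D e1 e2 e3 mulr0 !subr0 normr0 add0r.
  by rewrite mulr_ge0 ?addr_ge0// mulr_ge0.
have Dw (u : R) : 0 <= u <= w -> D = 2 * A s - u -> 1 <= i1 + i2 ->
    `|D| <= D + 2 * w * (i1 + i2).
  move=> /andP[u0 uw] -> hW; have := A0 s.
  have := ler_wpM2l (mulr_ge0 (ler0n R 2) w0) hW; move: (2 * w * (i1 + i2)) => W.
  by rewrite ler_norml => ? ?; apply/andP; split; lra.
have [s0|s0] := leP 0 s.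
  move: Ss sSh; rewrite (ger0_norm s0) => Ss sSh.
  apply: (Dw (A (s - h))).
  - by rewrite A0; apply: Aw; have := ler_norm (s - h); lra.
  - by rewrite /D (AS (s + h)) ?subr0// ger0_norm; lra.
  - rewrite (_ : i1 = 1) ?lerDl//.
    by rewrite /i1 indicE mem_setE in_itv/= Ss sSh.
move: Ss sSh; rewrite (ltr0_norm s0) => Ss sSh.
apply: (Dw (A (s + h))).
- by rewrite A0; apply: Aw; have := ler_norm (- (s + h)); rewrite normrN; lra.
- by rewrite /D (AS (s - h)) ?subr0// ler0_norm; lra.
- rewrite (_ : i2 = 1) ?lerDr//.
  rewrite /i2 indicE mem_setE in_itv/= (_ : _ && _ = true)//.
  by apply/andP; split; lra.
Qed.

(* Replacing [cos] by its average with the half-period shifts turns [A] into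
   its second difference, which has total integral 0 and is nonnegative except
   in two windows of length 2h at the ends of the support. *)
Lemma second_difference_bound (A : R -> R) (S h w K eta beta : R) :
  0 < h -> eta * h = pi -> measurable_fun [set: R] A ->
  (forall s, 0 <= A s <= K) -> (forall s, S <= `|s| -> A s = 0) ->
  (forall s, `|s| < S - h -> 0 <= 2 * A s - A (s + h) - A (s - h)) ->
  (forall s, S - 2 * h <= `|s| -> A s <= w) ->
  `|\int[mu]_s (A s * cos (eta * s + beta))| <= 2 * w * h.
Proof.
move=> h0 etah mA A01 AS Ad Aw.
have A0 s : 0 <= A s by case/andP: (A01 s).
have AK s : `|A s| <= K by rewrite ger0_norm//; case/andP: (A01 s).
have K0 : 0 <= K by apply: le_trans (AK 0).
have As s : A s != 0 -> `|s| <= S.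
  by move=> h'; rewrite leNgt; apply: contra h' => /ltW /AS ->.
pose c s := cos (eta * s + beta).
have mc : measurable_fun [set: R] c.
  apply: (measurableT_comp (f := cos)).
    by apply: continuous_measurable_fun => x; exact: continuous_cos.
  by apply: measurable_funD => //; exact: measurable_funM.
have c1 s : `|c s| <= 1 by rewrite ler_norml cos_geN1 cos_le1.
have mt d : measurable_fun [set: R] (fun s => A (s + d)).
  by apply: (measurableT_comp mA); exact: translate_measurable.
have mtc d : measurable_fun [set: R] (fun s => A (s + d) * c s).
  exact: measurable_funM.
have iA d : mu.-integrable setT (EFin \o (fun s => A (s + d))).
  apply: (@bounded_support_integrable _ K (S + `|d|)) => // s /As sd.
  by have := ler_normB (s + d) d; rewrite addrK; lra.
have iAc d : mu.-integrable setT (EFin \o (fun s => A (s + d) * c s)).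
  apply: (@bounded_support_integrable _ K (S + `|d|)) => // s.
    by rewrite normrM -[leRHS]mulr1 ler_pM.
  rewrite mulf_eq0 negb_or => /andP[/As sd _].
  by have := ler_normB (s + d) d; rewrite addrK; lra.
pose J := \int[mu]_s (A s * c s).
pose Delta s := 2 * A (s + 0) - A (s + h) - A (s + - h).
have A0E : (fun s => A (s + 0)) = A by apply/funext => s; rewrite addr0.
have intA d : \int[mu]_s A (s + d) = \int[mu]_s A s.
  exact: Rintegral_translate.
have shift d e : c =1 (fun s => e * c (s + d)) ->
    \int[mu]_s (A (s + d) * c s) = e * J.
  move=> ce; rewrite /J -RintegralZl//; last first.
    by have := iAc 0; under eq_fun do rewrite addr0.
  rewrite -(@Rintegral_translate d (fun s => e * (A s * c s))); last first.
    by apply: measurable_funM => //; exact: measurable_funM.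
  by apply: eq_Rintegral => s _; rewrite ce mulrCA.
have cospiD x : cos (x + pi) = - cos x by rewrite cosD cospi sinpi; ring.
have Jp : \int[mu]_s (A (s + h) * c s) = -1 * J.
  apply: shift => s; rewrite /c mulrDr etah mulN1r.
  by rewrite addrAC cospiD opprK.
have Jm : \int[mu]_s (A (s + - h) * c s) = -1 * J.
  apply: shift => s; rewrite /c mulrBr etah mulN1r -cospiD; congr cos; ring.
have J0 : \int[mu]_s (A (s + 0) * c s) = J.
  by apply: eq_Rintegral => s _; rewrite addr0.
have iB (f g : R -> R) : mu.-integrable setT (EFin \o f) ->
    mu.-integrable setT (EFin \o g) ->
    mu.-integrable setT (EFin \o (fun s => f s - g s)).
  by move=> hf hg; exact: (integrableB measurableT hf hg).
have iZ (f : R -> R) k : mu.-integrable setT (EFin \o f) ->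
    mu.-integrable setT (EFin \o (fun s => k * f s)).
  by move=> hf; exact: (integrableZl measurableT k hf).
have iD' (f g : R -> R) : mu.-integrable setT (EFin \o f) ->
    mu.-integrable setT (EFin \o g) ->
    mu.-integrable setT (EFin \o (fun s => f s + g s)).
  by move=> hf hg; exact: (integrableD measurableT hf hg).
have i3 (f g k : R -> R) : mu.-integrable setT (EFin \o f) ->
    mu.-integrable setT (EFin \o g) -> mu.-integrable setT (EFin \o k) ->
    mu.-integrable setT (EFin \o (fun s => 2 * f s - g s - k s)) /\
    \int[mu]_s (2 * f s - g s - k s) =
    2 * \int[mu]_s f s - \int[mu]_s g s - \int[mu]_s k s.
  move=> hf hg hk; have h2 := iZ f 2 hf; have h3 := iB _ _ h2 hg.
  split; first exact: iB h3 hk.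
  by rewrite RintegralB// RintegralB// RintegralZl.
have [iD intD] := i3 _ _ _ (iA 0) (iA h) (iA (- h)).
have [iDc intDc] := i3 _ _ _ (iAc 0) (iAc h) (iAc (- h)).
move: iD intD; rewrite -/Delta !intA => iD intD.
have {}intD : \int[mu]_s Delta s = 0 by rewrite /Delta intD; ring.
move: iDc intDc; rewrite J0 Jp Jm.
have -> : (fun s => 2 * (A (s + 0) * c s) - A (s + h) * c s - A (s - h) * c s) =
    (fun s => Delta s * c s).
  by apply/funext => s; rewrite /Delta; ring.
move=> iDc intDc.
have {}intDc : \int[mu]_s (Delta s * c s) = 4 * J.
  rewrite -[LHS]/(\int[mu]_s (fun s => Delta s * c s) s) intDc; ring.
pose I1 : set R := `[S - h, S + h]%classic.
pose I2 : set R := `[- S - h, - S + h]%classic.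
have iI (I : set R) u v : I = `[u, v]%classic ->
    mu.-integrable setT (EFin \o (\1_I : R -> R)).
  move=> ->; apply: (@bounded_support_integrable _ 1 (`|u| + `|v|)).
  - exact: measurable_indic.
  - by move=> s; rewrite indicE; case: (_ \in _); rewrite ?normr1 ?normr0.
  - move=> s; rewrite indicE mem_setE in_itv/=; case: (boolP (u <= s <= v)) => [/andP[h1 h2] _|_].
      rewrite ler_norml; have := ler_norm v; have := ler_norm (- u).
      have := normr_ge0 u; have := normr_ge0 v; rewrite normrN.
      by move=> ? ? ? ?; apply/andP; split; lra.
    by rewrite eqxx.
have intI (I : set R) u : I = `[u - h, u + h]%classic ->
    \int[mu]_s (\1_I s) = 2 * h.
  move=> ->; rewrite /Rintegral integral_indic//= setIT lebesgue_measure_itv/=.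
  rewrite lte_fin; have -> : u - h < u + h by lra.
  by rewrite -EFinB/=; ring.
pose W s := 2 * w * (\1_I1 s + \1_I2 s).
have iI12 := iD' _ _ (iI I1 _ _ erefl) (iI I2 _ _ erefl).
have iW : mu.-integrable setT (EFin \o W).
  exact: (iZ _ (2 * w) iI12).
have intW : \int[mu]_s W s = 8 * w * h.
  rewrite /W RintegralZl// RintegralD//;
    [|exact: (iI I1 _ _ erefl)|exact: (iI I2 _ _ erefl)].
  by rewrite (intI I1 S)// (intI I2 (- S))//; ring.
have pointwise s : `|Delta s * c s| <= Delta s + W s.
  rewrite normrM; apply: (@le_trans _ _ `|Delta s|).
    by rewrite -[leRHS]mulr1 ler_wpM2l.
  rewrite /W /Delta addr0; apply: second_difference_pointwise => //; exact: Ad.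
(* [Delta] has integral 0, so only the correction W remains: height 2 * w over two windows of length
   2 * h. *)
have : `|4 * J| <= 8 * w * h.
  rewrite -intDc -intW -[leRHS]add0r -intD -RintegralD//.
  apply: (le_trans (le_normr_Rintegral _ iDc)) => //.
  apply: le_Rintegral; [by []|exact: integrable_norm|exact: (iD' _ _ iD iW)|].
  by move=> s _; exact: pointwise.
by rewrite normrM ger0_norm// -/J; lra.
Qed.

End Translation.

(** * Chords of the domain in the direction (t, 1) *)

Section Chords.
Variables (R : realType) (a : R).
Hypotheses (a_gt0 : 0 < a) (a_lt : 2 * a < 1).
Implicit Types (r s t x y h : R) (z w : R * R).

Local Notation H := (abscissa a).
Local Notation X := (corner a).
Local Notation Psi := (potential a).
Local Notation top := (top a).
Local Notation cap := (cap a).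
Local Notation level := (level a).
Local Notation dom := (dom a).
Local Notation mu := (@lebesgue_measure R).
Local Notation plane := (measurableTypeR R * measurableTypeR R)%type.

Lemma level_measurable : measurable_fun [set: plane] level.
Proof.
have mPsi : measurable_fun [set: measurableTypeR R] Psi.
  by apply: continuous_measurable_fun => x; exact: potential_continuous.
by apply: measurable_funD; apply: measurableT_comp.
Qed.

Lemma dom_measurable : measurable (dom : set plane).
Proof.
have -> : dom = level @^-1` `]-oo, cap[%classic.
  by apply/seteqP; split => z /=; rewrite in_itv.
rewrite -[X in measurable X]setTI; exact: level_measurable.
Qed.

(** The slice of the domain by the line t * x + y = s, parametrized by x instead of arc length: the
    change of variables from (x, y) to (x, s) is then a shear of determinant 1. *)
Definition chord t s : set R := [set x | level (x, s - t * x) < cap].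

Definition width t s : R := fine (mu (chord t s)).

Lemma level_convex (theta : R) z w : 0 <= theta <= 1 ->
  level ((1 - theta) *: z + theta *: w) <=
    (1 - theta) * level z + theta * level w.
Proof.
move=> h; rewrite /level.
rewrite -[(_ *: z + _).1]/((1 - theta) * z.1 + theta * w.1).
rewrite -[(_ *: z + _).2]/((1 - theta) * z.2 + theta * w.2).
apply: (le_trans (lerD (potential_convex a_gt0 a_lt z.1 w.1 h)
  (potential_convex a_gt0 a_lt z.2 w.2 h))).
by rewrite le_eqVlt; apply/orP; left; apply/eqP; ring.
Qed.

Lemma chord_convex t (theta : R) s s' x x' : 0 <= theta <= 1 ->
  chord t s x -> chord t s' x' ->
  chord t ((1 - theta) * s + theta * s') ((1 - theta) * x + theta * x').
Proof.
move=> h01 hx hx'; rewrite /chord /=.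
have -> : ((1 - theta) * x + theta * x', (1 - theta) * s + theta * s' -
    t * ((1 - theta) * x + theta * x')) =
    (1 - theta) *: (x, s - t * x) + theta *: (x', s' - t * x') :> R * R.
  by congr pair => /=; rewrite /GRing.scale/=; ring.
apply: (le_lt_trans (level_convex _ _ h01)); move: hx hx'; rewrite /chord/=.
move: (level _) (level _) h01 => u v /andP[t0 t1] hu hv.
have um : u <= Num.max u v by rewrite le_max lexx.
have vm : v <= Num.max u v by rewrite le_max lexx orbT.
have mc : Num.max u v < cap by rewrite gt_max hu hv.
apply: le_lt_trans mc.
have t2 : 0 <= 1 - theta by lra.
move: (ler_wpM2l t0 vm) (ler_wpM2l t0 um) (ler_wpM2l t2 um) (ler_wpM2l t2 vm).
by move: (Num.max u v) => m; lra.
Qed.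

Lemma chord_measurable t s : measurable (chord t s : set (measurableTypeR R)).
Proof.
have -> : chord t s = (fun x => level (x, s - t * x)) @^-1` `]-oo, cap[%classic.
  by apply/seteqP; split => z /=; rewrite in_itv.
rewrite -[X in measurable X]setTI.
apply: (measurableT_comp level_measurable) => //.
apply: measurable_fun_pair => //.
by apply: measurable_funB => //; apply: measurable_funM.
Qed.

Lemma chord_le_top t s x : chord t s x -> `|x| <= top /\ `|s - t * x| <= top.
Proof. by move=> /ltW /(level_le_top a_gt0 a_lt). Qed.

Lemma measure_subset_itv (A : set (measurableTypeR R)) (u v : R) : measurable A -> u <= v ->
  A `<=` `[u, v]%classic -> (mu A <= (v - u)%:E)%E.
Proof.
move=> mA uv Auv; apply: (@le_trans _ _ (mu `[u, v]%classic)).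
  by apply: le_measure => //; rewrite inE.
rewrite lebesgue_measure_itv/= lte_fin; case: ifP => [_|_]; first by rewrite -EFinB.
by rewrite lee_fin subr_ge0.
Qed.

Lemma chord_fin t s : mu (chord t s) = (width t s)%:E.
Proof.
rewrite /width fineK// ge0_fin_numE//.
apply: (@le_lt_trans _ _ (top - (- top))%:E); last exact: ltry.
apply: measure_subset_itv; first exact: chord_measurable.
  by have := ltW (top_gt0 a_gt0 a_lt); lra.
by move=> x /chord_le_top[h _] /=; rewrite in_itv/= -ler_norml.
Qed.

Lemma width_ge0 t s : 0 <= width t s.
Proof. by rewrite /width fine_ge0. Qed.

Lemma width_le t s (u v : R) : u <= v ->
  (forall x, chord t s x -> u <= x <= v) -> width t s <= v - u.
Proof.
move=> uv h; rewrite -lee_fin -chord_fin.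
by apply: measure_subset_itv => //; exact: chord_measurable.
Qed.

(** One-dimensional Brunn-Minkowski inequality: averages of points of the two outer chords lie in
    the middle one. Each outer width is at most sup minus inf, and the open interval between the
    averaged ends is filled by convex combinations of points close to those ends. *)
Lemma width_midpoint t s s' : chord t s !=set0 -> chord t s' !=set0 ->
  width t s + width t s' <= 2 * width t ((s + s') / 2).
Proof.
have top0 := top_gt0 a_gt0 a_lt.
have hs r : chord t r !=set0 -> has_sup (chord t r) /\ has_inf (chord t r).
  move=> r0; split; split => //.
    by exists top => x /chord_le_top[+ _]; rewrite ler_norml => /andP[].
  by exists (- top) => x /chord_le_top[+ _]; rewrite ler_norml => /andP[].
move=> s0 s0'; have [S1 I1] := hs s s0; have [S2 I2] := hs s' s0'.
set a1 := inf (chord t s); set b1 := sup (chord t s).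
set a2 := inf (chord t s'); set b2 := sup (chord t s').
have bnd r : chord t r !=set0 -> width t r <= sup (chord t r) - inf (chord t r).
  move=> /[dup] r0 /hs[[_ hsup] [_ hinf]]; apply: width_le.
    case: r0 => x xr; apply: (@le_trans _ _ x).
      exact: (ge_inf hinf).
    exact: (ub_le_sup hsup).
  by move=> x xr; rewrite (ge_inf hinf)//= (ub_le_sup hsup).
have h1 := bnd _ s0; have h2 := bnd _ s0'.
rewrite -/a1 -/b1 in h1; rewrite -/a2 -/b2 in h2.
have [ab|ab] := leP ((b1 + b2) / 2) ((a1 + a2) / 2).
  by have := width_ge0 t ((s + s') / 2); lra.
suff : (b1 + b2) / 2 - (a1 + a2) / 2 <= width t ((s + s') / 2) by lra.
rewrite -lee_fin -chord_fin.
apply: (@le_trans _ _ (mu `](a1 + a2) / 2, (b1 + b2) / 2[%classic)).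
  by rewrite lebesgue_measure_itv/= lte_fin ab EFinB.
apply: le_measure; rewrite ?inE; [exact: measurable_itv|exact: chord_measurable|].
move=> z /=; rewrite in_itv/= => /andP[z1 z2].
pose e1 := z - (a1 + a2) / 2; pose e2 := (b1 + b2) / 2 - z.
have e10 : 0 < e1 by rewrite /e1; lra.
have e20 : 0 < e2 by rewrite /e2; lra.
have [p1 p1s p1a] := inf_adherent e10 I1; have [p2 p2s p2a] := inf_adherent e10 I2.
have [q1 q1s q1b] := sup_adherent e20 S1; have [q2 q2s q2b] := sup_adherent e20 S2.
rewrite -/a1 in p1a; rewrite -/a2 in p2a; rewrite -/b1 in q1b; rewrite -/b2 in q2b.
pose P := (p1 + p2) / 2; pose Q := (q1 + q2) / 2.
have Pz : P < z by move: p1a p2a; rewrite /P /e1; lra.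
have zQ : z < Q by move: q1b q2b; rewrite /Q /e2; lra.
pose theta := (z - P) / (Q - P).
have QP : 0 < Q - P by lra.
have th : 0 <= theta <= 1.
  apply/andP; split; first by rewrite divr_ge0; lra.
  by rewrite ler_pdivrMr// mul1r; lra.
have x1 := chord_convex th p1s q1s; have x2 := chord_convex th p2s q2s.
have half : 0 <= (2^-1 : R) <= 1 by lra.
have := chord_convex half x1 x2.
have -> : (1 - 2^-1) * ((1 - theta) * s + theta * s) +
    2^-1 * ((1 - theta) * s' + theta * s') = (s + s') / 2 by field.
have -> // : (1 - 2^-1) * ((1 - theta) * p1 + theta * q1) +
    2^-1 * ((1 - theta) * p2 + theta * q2) = z.
transitivity (P + theta * (Q - P)); first by rewrite /P /Q; field.
by rewrite /theta divfK ?gt_eqF// addrC subrK.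
Qed.

(* The point of the upper boundary arc where the outer normal is parallel
   to (t, 1). *)
Definition summit t : R * R := (H t, X + Psi X - Psi (H t)).

Definition support t : R := (summit t).2 + t * (summit t).1.

Section Summit.
Variable t : R.
Hypothesis t1 : `|t| <= 1.

Lemma abscissa_norm : `|H t| <= X.
Proof.
move: t1; rewrite !ler_norml => /andP[h1 h2]; apply/andP; split.
  by rewrite /corner -(abscissaN a_gt0 a_lt); exact: abscissa_nondec.
exact: abscissa_nondec.
Qed.

Lemma summit_ge : X <= (summit t).2.
Proof.
rewrite /summit/= -addrA lerDl subr_ge0 potential_le_norm//.
by rewrite [leRHS]ger0_norm ?abscissa_norm// ltW ?corner_gt0.
Qed.

Lemma level_summit : level (summit t) = cap.
Proof.
by rewrite /level (potential_corner a_gt0 a_lt summit_ge) /cap /summit/=; ring.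
Qed.

Lemma summit_subgrad x y : cap + (t * (x - H t) + (y - (summit t).2)) <= level (x, y).
Proof.
have := level_subgrad a_gt0 a_lt (summit t) (x, y).
rewrite level_summit/= slope_abscissa//.
by rewrite (slope_corner a_gt0 a_lt summit_ge) mul1r.
Qed.

Lemma chordN s x : chord t s x -> chord t (- s) (- x).
Proof.
rewrite /chord/= -(levelN a_gt0 a_lt); congr (level _ < _).
by congr pair => /=; rewrite ?opprK//; ring.
Qed.

Lemma chord_support s x : chord t s x -> `|s| < support t.
Proof.
have h u y : chord t u y -> u < support t.
  by rewrite /chord/= => hu; have := summit_subgrad y (u - t * y);
    rewrite /support /summit/=; lra.
by move=> hs; rewrite ltr_norml (h _ _ hs) andbT ltrNl (h _ _ (chordN hs)).
Qed.

Lemma support_gt0 : 0 < support t.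
Proof.
have : chord t 0 0.
  by rewrite /chord/= mulr0 subrr /level/= potential0 addr0 cap_gt0.
by move=> /chord_support; rewrite normr0.
Qed.

Lemma chord_neq0 s : `|s| < support t -> chord t s !=set0.
Proof.
move=> sS; have S0 := support_gt0; pose k := s / support t.
exists (k * (summit t).1); rewrite /chord/=.
have -> : (k * (summit t).1, s - t * (k * (summit t).1)) = k *: summit t :> R * R.
  rewrite [RHS]surjective_pairing; congr pair => /=; rewrite /GRing.scale/=.
  have {1}-> : s = k * support t by rewrite /k divfK// gt_eqF.
  by rewrite /support/=; ring.
have k1 : 0 <= `|k| <= 1.
  by rewrite normr_ge0/= /k normrM normfV (gtr0_norm S0) ler_pdivrMr// mul1r ltW.
have -> : level (k *: summit t) = level (`|k| *: summit t).
  case: (ger0P k) => // _.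
  by rewrite -(levelN a_gt0 a_lt) -scaleNr.
apply: (le_lt_trans (level_scale a_gt0 a_lt _ k1)); rewrite level_summit.
rewrite -[ltRHS]mul1r ltr_pM2r ?cap_gt0// /k normrM normfV (gtr0_norm S0).
by rewrite ltr_pdivrMr// mul1r.
Qed.

(** Supporting planes with gradient (u, 1), u = t + r or t - r, taken at abscissa [H u] and the
    height of the summit, cut the chord off on either side. Compared with the plane at the summit
    they give (u - t) * (x - H u) < h, and |u - t| = r turns the depth h into h / r. *)
Lemma chord_near_summit r h s x : 0 < r -> `|t| + r <= 1 ->
  support t - h <= s -> chord t s x ->
  H (t - r) - h / r <= x <= H (t + r) + h / r.
Proof.
move=> r0 tr sh; rewrite /chord/= => xs.
have tn : `|t + r| <= 1 /\ `|t - r| <= 1.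
  have := ler_normD t r; have := ler_normB t r; rewrite (gtr0_norm r0).
  by move=> ? ?; split; lra.
have y0 := summit_ge.
have key u : `|u| <= 1 -> (u - t) * (x - H u) < h.
  move=> u1; have := level_subgrad a_gt0 a_lt (H u, (summit t).2) (x, s - t * x).
  rewrite /= slope_abscissa// (slope_corner a_gt0 a_lt y0).
  have := summit_subgrad (H u) (summit t).2; move: sh; rewrite /support /summit/=.
  lra.
case: tn => tp tm; have := key _ tp; have := key _ tm.
have -> : (t - r - t) * (x - H (t - r)) = r * (H (t - r) - x) by ring.
have -> : (t + r - t) * (x - H (t + r)) = r * (x - H (t + r)) by ring.
rewrite -![r * _ < h]ltr_pdivlMl// mulrC => ? ?; apply/andP; split; lra.
Qed.

Definition window r h : R := H (t + r) - H (t - r) + 2 * (h / r).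

Lemma width_near_summit r h s : 0 < h -> 0 < r -> `|t| + r <= 1 ->
  support t - h <= `|s| -> width t s <= window r h.
Proof.
move=> h0 r0 tr sh.
have hr : 0 < h / r by rewrite divr_gt0.
have hH : H (t - r) <= H (t + r) by apply: abscissa_nondec => //; lra.
have [s0|s0] := leP 0 s.
  have -> : window r h = H (t + r) + h / r - (H (t - r) - h / r).
    by rewrite /window; ring.
  apply: width_le; first lra.
  by move=> x; apply: chord_near_summit => //; rewrite -(ger0_norm s0).
have -> : window r h = - (H (t - r) - h / r) - (- (H (t + r) + h / r)).
  by rewrite /window; ring.
apply: width_le; first lra.
move=> x /chordN /(chord_near_summit r0 tr) => /(_ h).
rewrite -(ltr0_norm s0) => /(_ sh) /andP[? ?]; apply/andP; split; lra.
Qed.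

Lemma width_eq0 s : support t <= `|s| -> width t s = 0.
Proof.
move=> Ss; rewrite /width (_ : chord t s = set0) ?measure0//.
apply/seteqP; split => // x /chord_support.
by rewrite ltNge Ss.
Qed.

Lemma width_measurable : measurable_fun [set: measurableTypeR R] (width t).
Proof.
pose A : set plane := [set z | level (z.1, z.2 - t * z.1) < cap].
have mA : measurable A.
  have -> : A = (fun z => level (z.1, z.2 - t * z.1)) @^-1` `]-oo, cap[%classic.
    by apply/seteqP; split => z /=; rewrite in_itv.
  rewrite -[X in measurable X]setTI.
  apply: (measurableT_comp level_measurable) => //.
  apply: measurable_fun_pair => //.
  by apply: measurable_funB => //; apply: measurable_funM.
have -> : width t = fine \o (mu \o ysection A).
  apply/funext => s; rewrite /width/=; congr (fine (mu _)).
  by apply/seteqP; split => x; rewrite /ysection/= inE.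
apply: (measurableT_comp (f := fine)) => //.
exact: measurable_fun_ysection.
Qed.

End Summit.
End Chords.

(** * The transform as an oscillating integral of chord widths *)

Section Oscillation.
Variables (R : realType) (a : R).
Hypotheses (a_gt0 : 0 < a) (a_lt : 2 * a < 1).
Implicit Types (r s t x y h xi eta beta : R).

Local Notation top := (top a).
Local Notation cap := (cap a).
Local Notation level := (level a).
Local Notation dom := (dom a).
Local Notation mu := (@lebesgue_measure R).
Local Notation plane := (measurableTypeR R * measurableTypeR R)%type.

Lemma measurable_cos_comp d (T : measurableType d) (f : T -> R) :
  measurable_fun setT f -> measurable_fun setT (cos \o f).
Proof.
apply: measurableT_comp.
by apply: continuous_measurable_fun => x; exact: continuous_cos.
Qed.

(** The phase lets one real integral serve for both parts of the transform: beta = 0 gives the real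
    part and beta = pi / 2 the imaginary part. *)
Definition wave beta (zeta z : R * R) : R := \1_dom z * cos (dot zeta z + beta).

Lemma wave_measurable beta zeta :
  measurable_fun [set: plane] (wave beta zeta).
Proof.
apply: measurable_funM.
  by apply: measurable_indic; exact: dom_measurable.
apply: measurable_cos_comp; apply: measurable_funD => //.
by apply: measurable_funD; apply: measurable_funM.
Qed.

Lemma indic_le1 z : 0 <= (\1_dom z : R) <= 1.
Proof. by rewrite indicE; case: (_ \in _); rewrite ?lexx ?ler01. Qed.

Lemma wave_le1 beta zeta z : `|wave beta zeta z| <= \1_dom z.
Proof.
have /andP[h0 _] := indic_le1 z.
by rewrite normrM ger0_norm// ler_piMr// ler_norml cos_geN1 cos_le1.
Qed.

Lemma indic_support z : (\1_dom z : R) != 0 -> `|z.1| <= top /\ `|z.2| <= top.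
Proof.
rewrite indicE; case: (boolP (z \in dom)) => [|_]; last by rewrite eqxx.
by rewrite inE => /ltW /(level_le_top a_gt0 a_lt).
Qed.

Lemma wave_support beta zeta z : wave beta zeta z != 0 ->
  `|z.1| <= top /\ `|z.2| <= top.
Proof.
by rewrite mulf_eq0 negb_or => /andP[h _]; exact: indic_support.
Qed.

Lemma wave_integrable beta zeta :
  (@lebesgue2 R).-integrable setT (EFin \o wave beta zeta).
Proof.
apply: (plane_bounded_support_integrable (wave_measurable _ _) (M := 1)).
  by move=> z; apply: (le_trans (wave_le1 _ _ _)); case/andP: (indic_le1 z).
exact: wave_support.
Qed.

Lemma indic_integrable :
  (@lebesgue2 R).-integrable setT (EFin \o (\1_dom : R * R -> R)).
Proof.
apply: (@plane_bounded_support_integrable _ _ 1 top).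
- by apply: measurable_indic; exact: dom_measurable.
- by move=> z; have /andP[h0 h1] := indic_le1 z; rewrite ger0_norm.
- exact: indic_support.
Qed.

Definition osc beta (zeta : R * R) : R := \int[@lebesgue2 R]_z wave beta zeta z.

Definition area : R := \int[@lebesgue2 R]_z (\1_dom z : R).

Lemma osc_le_area beta zeta : `|osc beta zeta| <= area.
Proof.
have h := wave_integrable beta zeta.
apply: (le_trans (le_normr_Rintegral _ h)) => //.
apply: le_Rintegral => //; [exact: integrable_norm|exact: indic_integrable|].
by move=> z _; exact: wave_le1.
Qed.

Lemma oscN beta zeta : osc beta (- zeta) = osc (- beta) zeta.
Proof.
apply: eq_Rintegral => z _; rewrite /wave -cosN; congr (_ * cos _).
by rewrite /dot/=; ring.
Qed.

Lemma osc_iterated beta zeta : osc beta zeta =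
  fine (\int[mu]_x \int[mu]_y (wave beta zeta (x, y))%:E)%E.
Proof.
rewrite /osc /Rintegral; congr fine.
by rewrite -(integral12_prod_meas1 (wave_integrable beta zeta)).
Qed.

Lemma osc_swap beta xi eta : osc beta (xi, eta) = osc beta (eta, xi).
Proof.
rewrite !osc_iterated; congr fine.
rewrite (Fubini (wave_integrable beta (xi, eta))).
apply: eq_integral => y _; apply: eq_integral => x _; congr (_%:E).
rewrite /wave; congr (_ * cos _); last by rewrite /dot/=; ring.
rewrite !indicE (_ : ((x, y) \in dom) = ((y, x) \in dom))//.
by apply/idP/idP; rewrite !inE /dom/= /level/= addrC.
Qed.

(** The shear s = y + t * x preserves area and makes the phase depend on s alone; integrating x out
    leaves the chord width. *)
Lemma osc_width t eta beta : `|t| <= 1 -> osc beta (t * eta, eta) =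
  \int[mu]_s (width a t s * cos (eta * s + beta)).
Proof.
move=> t1; pose zeta := (t * eta, eta).
pose shear (z : R * R) : R * R := (z.1, z.2 - t * z.1).
have mshear : measurable_fun [set: plane] (shear : plane -> plane).
  apply: measurable_fun_pair => //.
  by apply: measurable_funB => //; apply: measurable_funM.
have mg : measurable_fun [set: plane] (wave beta zeta \o shear).
  by apply: measurableT_comp mshear; exact: wave_measurable.
have ig : (@lebesgue2 R).-integrable setT (EFin \o (wave beta zeta \o shear)).
  apply: (plane_bounded_support_integrable mg (M := 1) (B := top + top)).
    by move=> z; apply: (le_trans (wave_le1 _ _ _)); case/andP: (indic_le1 (shear z)).
  move=> z /wave_support/= [h1 h2]; split; first by have := normr_ge0 z.1; lra.
  have := ler_normD (z.2 - t * z.1) (t * z.1); rewrite subrK normrM.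
  have : `|t| * `|z.1| <= 1 * `|z.1| by rewrite ler_wpM2r.
  by lra.
rewrite osc_iterated.
have -> : (\int[mu]_x \int[mu]_y (wave beta zeta (x, y))%:E =
    \int[mu]_x \int[mu]_s (wave beta zeta (shear (x, s)))%:E)%E.
  apply: eq_integral => x _.
  rewrite -(@integral_translate _ (- (t * x)) (fun y => (wave beta zeta (x, y))%:E))//.
  apply: measurableT_comp => //; apply: (measurableT_comp (wave_measurable _ _)).
  exact: measurable_fun_pair.
rewrite (Fubini ig) /Rintegral; congr fine; apply: eq_integral => s _.
have -> : (fun x => (EFin \o (wave beta zeta \o shear)) (x, s)) =
    (fun x => (cos (eta * s + beta))%:E * (\1_(chord a t s) x)%:E)%E.
  apply/funext => x /=; rewrite /wave -EFinM mulrC; congr ((cos _ * _)%:E).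
    by rewrite /dot/=; ring.
have mc := chord_measurable a_gt0 a_lt t s.
rewrite integralZl//; last first.
  apply: (@bounded_support_integrable _ _ 1 top).
  - exact: measurable_indic.
  - by move=> x; rewrite indicE; case: (_ \in _); rewrite ?normr1 ?normr0.
  - move=> x; rewrite indicE; case: (boolP (x \in _)) => [|_]; last by rewrite eqxx.
    by rewrite inE => /(chord_le_top a_gt0 a_lt)[].
by rewrite integral_indic//= setIT (chord_fin a_gt0 a_lt) -EFinM mulrC.
Qed.

Lemma osc_bound t eta beta w (h := pi / eta) : 0 < eta -> `|t| <= 1 ->
  (forall s, support a t - 2 * h <= `|s| -> width a t s <= w) ->
  `|osc beta (t * eta, eta)| <= 2 * w * h.
Proof.
move=> eta0 t1 hw; have h0 : 0 < h by rewrite divr_gt0// pi_gt0.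
rewrite osc_width//.
apply: (@second_difference_bound R (width a t) (support a t) h w (top - (- top))) => //.
- by rewrite /h mulrC divfK// gt_eqF.
- exact: width_measurable.
- move=> s; rewrite width_ge0/=; apply: width_le => //.
    by have := ltW (top_gt0 a_gt0 a_lt); lra.
  by move=> x /(chord_le_top a_gt0 a_lt)[+ _]; rewrite ler_norml.
- by move=> s; exact: width_eq0.
- move=> s sS.
  have hp : `|s + h| < support a t.
    by have := ler_normD s h; rewrite (gtr0_norm h0); lra.
  have hm : `|s - h| < support a t.
    by have := ler_normB s h; rewrite (gtr0_norm h0); lra.
  have := width_midpoint a_gt0 a_lt (chord_neq0 a_gt0 a_lt t1 hp)
    (chord_neq0 a_gt0 a_lt t1 hm).
  have -> : (s + h + (s - h)) / 2 = s by field.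
  lra.
Qed.

Lemma osc_decay t eta beta r (h := pi / `|eta|) : eta != 0 -> 0 < r ->
  `|t| + r <= 1 ->
  `|osc beta (t * eta, eta)| <= 2 * window a t r (2 * h) * h.
Proof.
rewrite {}/h; wlog eta0 : beta eta / 0 < eta.
  move=> wl; rewrite neq_lt => /orP[eta0|eta0]; last by apply: wl; rewrite ?gt_eqF.
  move=> r0 tr; rewrite -(normrN eta).
  have -> : (t * eta, eta) = - (t * - eta, - eta) :> R * R.
    by rewrite -[RHS]/(- (t * - eta), - - eta) mulrN !opprK.
  by rewrite oscN; apply: wl => //; rewrite ?oppr_gt0// oppr_eq0 lt_eqF.
move=> _ r0 tr; rewrite (gtr0_norm eta0); apply: osc_bound => //; first lra.
move=> s; apply: width_near_summit => //; first lra.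
by rewrite mulr_gt0// divr_gt0// pi_gt0.
Qed.

Lemma osc_decay_trivial t eta beta : eta != 0 -> `|t| <= 1 ->
  `|osc beta (t * eta, eta)| <= 4 * top * (pi / `|eta|).
Proof.
wlog eta0 : beta eta / 0 < eta.
  move=> wl; rewrite neq_lt => /orP[eta0|eta0]; last by apply: wl; rewrite ?gt_eqF.
  move=> t1; rewrite -(normrN eta).
  have -> : (t * eta, eta) = - (t * - eta, - eta) :> R * R.
    by rewrite -[RHS]/(- (t * - eta), - - eta) mulrN !opprK.
  by rewrite oscN; apply: wl => //; rewrite ?oppr_gt0// oppr_eq0 lt_eqF.
move=> _ t1; rewrite (gtr0_norm eta0).
rewrite (_ : 4 * top = 2 * (top - (- top))); last by ring.
apply: osc_bound => // s _; apply: width_le => //.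
  by have := ltW (top_gt0 a_gt0 a_lt); lra.
by move=> x /(chord_le_top a_gt0 a_lt)[+ _]; rewrite ler_norml.
Qed.

Lemma osc_measurable beta : measurable_fun [set: plane] (osc beta).
Proof.
(* Adding 1 to the cosine makes the integrand nonnegative, as the Tonelli measurability results
   require; the area is subtracted again at the end. *)
pose F (u : (plane * measurableTypeR R) * measurableTypeR R) : \bar R :=
  (\1_dom (u.1.2, u.2) * (cos (dot u.1.1 (u.1.2, u.2) + beta) + 1))%:E.
have mF : measurable_fun setT F.
  apply: measurableT_comp => //; apply: measurable_funM.
    apply: (measurableT_comp (f := (\1_dom : plane -> R))) => //.
      by apply: measurable_indic; exact: dom_measurable.
    by apply: measurable_fun_pair => //; exact: measurableT_comp.
  apply: measurable_funD => //; apply: measurable_cos_comp.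
  apply: measurable_funD => //; rewrite /dot /=.
  apply: measurable_funD; apply: measurable_funM => //.
  - by apply: measurableT_comp => //; exact: measurableT_comp.
  - exact: measurableT_comp.
  - by apply: measurableT_comp => //; exact: measurableT_comp.
have F0 u : (0 <= F u)%E.
  have c0 : 0 <= cos (dot u.1.1 (u.1.2, u.2) + beta) + 1.
    by have := cos_geN1 (dot u.1.1 (u.1.2, u.2) + beta); lra.
  by rewrite lee_fin mulr_ge0.
pose F1 := fubini_F mu F.
have mF1 : measurable_fun setT F1 by exact: measurable_fun_fubini_tonelli_F.
have F10 v : (0 <= F1 v)%E by apply: integral_ge0 => y _; exact: F0.
pose F2 := fubini_F mu F1.
have mF2 : measurable_fun [set: plane] F2.
  exact: (@measurable_fun_fubini_tonelli_F _ _ plane _ R mu F1 mF1 F10).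
have -> : osc beta = (fun zeta => fine (F2 zeta) - area).
  apply/funext => zeta.
  have iw := wave_integrable beta zeta; have ii := indic_integrable.
  have -> : fine (F2 zeta) =
      \int[@lebesgue2 R]_z (wave beta zeta z + (\1_dom z : R)).
    rewrite /Rintegral; congr fine.
    rewrite -(integral12_prod_meas1 (integrableD measurableT iw ii)).
    apply: eq_integral => x _; apply: eq_integral => y _.
    by rewrite /F /wave/= -EFinD mulrDr mulr1.
  by rewrite RintegralD// -/area addrK.
apply: measurable_funB => //.
by apply: (measurableT_comp (f := fine)).
Qed.

End Oscillation.

(** * Good and bad directions at a given frequency *)

Section Slices.
Variables (R : realType) (a : R).
Hypotheses (a_gt0 : 0 < a) (a_lt : 2 * a < 1).
Implicit Types (r s t x y xi eta beta : R) (i j k K : nat).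

Local Notation top := (top a).
Local Notation mu := (@lebesgue_measure R).

Let lt_a1 : a < 1. Proof. by move: a_gt0 a_lt; lra. Qed.

Definition scale k : R := (2 / a) ^+ k.

(** Chosen to balance the two parts of [window]: for h of order 1 / [scale k] the quotient h / r is
    of order a ^ i, as is the growth of H at a good scale. *)
Definition radius k i : R := (scale k * a ^+ i)^-1.

Lemma scale_gt0 k : 0 < scale k.
Proof. by rewrite exprn_gt0// divr_gt0. Qed.

Lemma radius_gt0 k i : 0 < radius k i.
Proof. by rewrite invr_gt0 mulr_gt0 ?scale_gt0// exprn_gt0. Qed.

Lemma radius_le k i : (i <= k)%N -> radius k i <= 2 ^- k.
Proof.
move=> ik; rewrite lef_pV2 ?posrE ?exprn_gt0// ?mulr_gt0 ?scale_gt0 ?exprn_gt0//.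
rewrite /scale expr_div_n -mulrA ler_peMr ?exprn_ge0//.
rewrite mulrC ler_pdivlMr ?exprn_gt0// mul1r.
by rewrite ler_wiXn2l// ltW.
Qed.

Lemma radius_ge k i : (scale k)^-1 <= radius k i.
Proof.
rewrite lef_pV2 ?posrE ?scale_gt0// ?mulr_gt0 ?scale_gt0 ?exprn_gt0//.
apply: ler_piMr; first exact/ltW/scale_gt0.
by apply: exprn_ile1; exact: ltW.
Qed.

(* At a good scale the window of radius [radius k i] around t only sees the
   terms of index at least i of the series defining [abscissa]. *)
Definition good k i t : Prop := `|t| + radius k i <= 1 /\
  forall j, (j < i)%N -> staircase (2 ^+ j * (t - radius k i)) =
    staircase (2 ^+ j * (t + radius k i)).

(** The division by a pays for a bound at index i being used at i.+1; the last summand is the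
    constant of the trivial estimate, for index 0. *)
Definition decay_const : R :=
  (2 * pi * (3 * tail_const a + 4 * pi)) / a + 4 * top * pi.

Lemma good_const_ge0 : 0 <= 2 * pi * (3 * tail_const a + 4 * pi) :> R.
Proof.
have := tail_const_ge0 a_lt; have p0 := pi_ge0 R.
by move=> ?; rewrite !mulr_ge0// addr_ge0// mulr_ge0.
Qed.

Lemma osc_good k i t eta beta : (i <= k)%N -> scale k <= `|eta| -> good k i t ->
  `|eta| * `|osc a beta (t * eta, eta)| <=
    2 * pi * (3 * tail_const a + 4 * pi) * a ^+ i.
Proof.
move=> ik keta [tr hgood]; have k0 := scale_gt0 k.
have eta0 : 0 < `|eta| by exact: lt_le_trans keta.
have en0 : eta != 0 by rewrite -normr_gt0.
have r0 := radius_gt0 k i; have c0 := tail_const_ge0 a_lt.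
have p0 := pi_ge0 R; have ai : 0 < a ^+ i by rewrite exprn_gt0.
have := osc_decay a_gt0 a_lt beta en0 r0 tr.
set h := pi / `|eta| => /(ler_wpM2l (ltW eta0)) /le_trans; apply.
have -> : `|eta| * (2 * window a t (radius k i) (2 * h) * h) =
    2 * pi * window a t (radius k i) (2 * h).
  by rewrite /h; field; rewrite gt_eqF.
rewrite -[leRHS]mulrA ler_wpM2l ?mulr_ge0// /window.
rewrite [leRHS]mulrDl; apply: lerD.
  have st : t - radius k i <= t + radius k i by lra.
  apply: (le_trans (abscissa_tail a_gt0 a_lt st hgood)).
  have h2 : t + radius k i - (t - radius k i) + 2 ^- i <= 3 * 2 ^- i.
    have := radius_le ik; have : (2 : R) ^- k <= 2 ^- i.
      by rewrite lef_pV2 ?posrE ?exprn_gt0// ler_weXn2l// ler1n.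
    by lra.
  apply: (@le_trans _ _ (tail_const a * (2 * a) ^+ i * (3 * 2 ^- i))).
    by rewrite ler_wpM2l// mulr_ge0// exprn_ge0// mulr_ge0// ltW.
  rewrite exprMn le_eqVlt; apply/orP; left; apply/eqP.
  by field; rewrite gt_eqF// exprn_gt0.
have -> : 2 * (2 * h / radius k i) = 4 * (h * (scale k * a ^+ i)).
  by rewrite /radius invrK; ring.
rewrite -[leRHS]mulrA ler_wpM2l// mulrA ler_wpM2r ?(ltW ai)//.
by rewrite /h -mulrA ler_piMr// mulrC ler_pdivrMr// mul1r.
Qed.

(** The second case takes the least bad index: its predecessor is good and gives the decay up to a
    factor a, and if there is no predecessor the trivial bound applies. *)
Lemma osc_pointwise k t eta beta : scale k <= `|eta| -> `|t| <= 1 ->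
  `|eta| * `|osc a beta (t * eta, eta)| <= decay_const * a ^+ k \/
  exists2 i, (i <= k)%N & ~ good k i t /\
    `|eta| * `|osc a beta (t * eta, eta)| <= decay_const * a ^+ i.
Proof.
move=> keta t1; have p0 := pi_ge0 R.
have eta0 : 0 < `|eta| by exact: lt_le_trans (scale_gt0 k) keta.
have en0 : eta != 0 by rewrite -normr_gt0.
have g0 := good_const_ge0; have top0 := ltW (top_gt0 a_gt0 a_lt).
have tp : 0 <= 4 * top * pi by rewrite !mulr_ge0.
have hc : 2 * pi * (3 * tail_const a + 4 * pi) <= decay_const * a.
  rewrite /decay_const [leRHS]mulrDl divfK ?gt_eqF// lerDl.
  by rewrite mulr_ge0// ltW.
have hc1 : 2 * pi * (3 * tail_const a + 4 * pi) <= decay_const.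
  rewrite /decay_const.
  have : 2 * pi * (3 * tail_const a + 4 * pi) <=
      2 * pi * (3 * tail_const a + 4 * pi) / a.
    by rewrite ler_peMr// invf_ge1// ltW.
  lra.
have [[i [ik bad]]|all_good] :=
    pselect (exists i, (i <= k)%N /\ ~ good k i t); last first.
  left; have gk : good k k t.
    by apply: contrapT => nk; apply: all_good; exists k.
  apply: (le_trans (osc_good beta (leqnn k) keta gk)).
  by rewrite ler_wpM2r// exprn_ge0// ltW.
right.
have ex : exists i, `[< (i <= k)%N /\ ~ good k i t >].
  by exists i; apply/asboolP.
case: (ex_minnP ex) => {ik bad} m /asboolP[mk bad] mmin.
exists m => //; split => //; case: m mk bad mmin => [_ _ _|m mk _ mmin].
  rewrite expr0 mulr1.
  have := osc_decay_trivial a_gt0 a_lt beta en0 t1.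
  move=> /(ler_wpM2l (ltW eta0)).
  have -> : `|eta| * (4 * top * (pi / `|eta|)) = 4 * top * pi.
    by field; rewrite gt_eqF.
  by have : 0 <= 2 * pi * (3 * tail_const a + 4 * pi) / a;
    [rewrite divr_ge0// ltW|rewrite /decay_const; lra].
have gm : good k m t.
  apply: contrapT => nm.
  have : (m.+1 <= m)%N by apply: mmin; apply/asboolP; split => //; exact: ltnW.
  by rewrite ltnn.
apply: (le_trans (osc_good beta (ltnW mk) keta gm)).
by rewrite exprS mulrA ler_wpM2r// exprn_ge0// ltW.
Qed.

Lemma balls_measure (s : seq R) (rho : R) : 0 <= rho ->
  exists U : set (measurableTypeR R), [/\ measurable U,
    forall x z, z \in s -> `|x - z| <= rho -> U x &
    (mu U <= ((size s)%:R * (2 * rho))%:E)%E].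
Proof.
move=> rho0; elim: s => [|z s [U [mU hU sU]]].
  by exists set0; split => //=; rewrite measure0 mul0r.
have mI : measurable (`[z - rho, z + rho]%classic : set (measurableTypeR R)).
  exact: measurable_itv.
exists (`[z - rho, z + rho]%classic `|` U); split.
- exact: measurableU.
- move=> x w; rewrite inE => /predU1P[->|ws] h; last by right; exact: hU h.
  by left; rewrite /= in_itv/= -lter_distl.
- apply: (@le_trans _ _ (mu `[(z - rho)%R, (z + rho)%R]%classic + mu U)%E).
    exact: measureU2.
  have -> : (size (z :: s))%:R * (2 * rho) = 2 * rho + (size s)%:R * (2 * rho).
    by rewrite /= -natr1; ring.
  rewrite EFinD; apply: leeD => //.
  rewrite lebesgue_measure_itv/= lte_fin; case: ifP => _.
    by rewrite -EFinB lee_fin; lra.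
  by rewrite lee_fin mulr_ge0.
Qed.

(** With r the radius, a bad t lies within r of 1 or -1, or 2 ^ j * t lies within 2 ^ j * r + 2 ^- K
    of one of O(K * 2 ^ j) points for some j < i. The condition on K gives 2 ^- K <= r, so after
    division by 2 ^ j balls of radius 2 * r suffice, and the counts add up to O(K * 2 ^ i). *)
Lemma bad_cover k K : scale k <= 2 ^+ K -> forall i eta, (i <= k)%N -> eta != 0 ->
  exists U : set (measurableTypeR R), [/\ measurable U,
    forall xi, `|xi| <= `|eta| -> ~ good k i (xi / eta) -> U xi &
    (mu U <= (`|eta| * (1000 * (K + 1)%:R * (2 ^+ i * radius k i)))%:E)%E].
Proof.
move=> kK i eta ik eta0; pose rho := radius k i.
have e0 : 0 < `|eta| by rewrite normr_gt0.
have r0 : 0 < rho by exact: radius_gt0.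
have [Gam hGam] : exists Gam : nat -> seq R, forall j,
    (size (Gam j) <= 100 * (K + 1) * (2 ^ j + 1))%N /\
    forall u rho', 0 <= rho' <= 1 -> `|u| <= (2 ^ j)%:R ->
      staircase (u - rho') != staircase (u + rho') ->
      exists2 x, x \in Gam j & `|u - x| <= rho' + 2 ^- K.
  by exists (fun j => proj1_sig (cid (staircase_thin R K (2 ^ j)))) => j;
    case: cid.
pose L := [:: eta; - eta] ++
  flatten [seq [seq eta * (z / 2 ^+ j) | z <- Gam j] | j <- iota 0 i].
have rho2 : 0 <= `|eta| * (2 * rho) by rewrite !mulr_ge0// ltW.
have [U [mU hU sU]] := balls_measure L rho2.
exists U; split => //.
  move=> xi xeta bad; set t := xi / eta in bad.
  have xiE : xi = eta * t by rewrite /t mulrC divfK.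
  have t1 : `|t| <= 1 by rewrite /t normrM normfV ler_pdivrMr// mul1r.
  have [tr|tr] := ltP (1 - rho) `|t|.
    have [t0|t0] := leP 0 t.
      apply: (hU _ eta); first by rewrite inE eqxx.
      rewrite xiE (_ : eta * t - eta = eta * (t - 1)); last by ring.
      rewrite normrM ler_wpM2l//.
      move: tr t1; rewrite (ger0_norm t0) => ? ?.
      by rewrite ler0_norm; lra.
    apply: (hU _ (- eta)); first by rewrite !inE eqxx orbT.
    rewrite xiE (_ : eta * t - - eta = eta * (t + 1)); last by ring.
    rewrite normrM ler_wpM2l//.
    move: tr t1; rewrite (ltr0_norm t0) => ? ?.
    by rewrite ger0_norm; lra.
  have [j ji hj] : exists2 j, (j < i)%N &
      staircase (2 ^+ j * (t - rho)) != staircase (2 ^+ j * (t + rho)).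
    apply: contrapT => no; apply: bad; split; first by rewrite -/rho; lra.
    move=> j ji; apply/eqP; apply: contrapT => /negP hj.
    by apply: no; exists j.
  have p2 : 0 < (2 : R) ^+ j by rewrite exprn_gt0.
  have rj : 0 <= 2 ^+ j * rho <= 1.
    apply/andP; split; first by rewrite mulr_ge0// ltW.
    rewrite mulrC -ler_pdivlMr// div1r.
    apply: (le_trans (radius_le ik)).
    rewrite lef_pV2 ?posrE ?exprn_gt0// ler_weXn2l ?ler1n//.
    by apply: ltnW; exact: leq_trans ji ik.
  have uj : `|2 ^+ j * t| <= (2 ^ j)%:R.
    by rewrite normrM (gtr0_norm p2) natrX ler_piMr// ltW.
  rewrite mulrBr mulrDr in hj.
  have [z zG hz] := (hGam j).2 _ _ rj uj hj.
  apply: (hU _ (eta * (z / 2 ^+ j))).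
    rewrite mem_cat; apply/orP; right; apply/flatten_mapP.
    by exists j; [rewrite mem_iota|apply/mapP; exists z].
  rewrite xiE -mulrBr normrM ler_wpM2l//.
  have -> : t - z / 2 ^+ j = (2 ^+ j * t - z) / 2 ^+ j.
    by field; rewrite gt_eqF.
  rewrite normrM normfV (gtr0_norm p2) ler_pdivrMr//.
  apply: (le_trans hz).
  have : (2 : R) ^- K <= rho.
    apply: le_trans (radius_ge k i).
    by rewrite lef_pV2 ?posrE ?scale_gt0// exprn_gt0.
  have : rho <= 2 ^+ j * rho by rewrite ler_peMl ?(ltW r0)// exprn_ege1// ler1n.
  lra.
apply: (le_trans sU); rewrite lee_fin.
have sizeL : (size L <= 200 * (K + 1) * 2 ^ i + 2)%N.
  rewrite /L size_cat addnC leq_add2r size_flatten /shape -map_comp sumnE big_map.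
  apply: (@leq_trans (\sum_(0 <= j < i) 200 * (K + 1) * 2 ^ j)%N).
    rewrite /index_iota subn0; apply: leq_sum => j _ /=.
    rewrite size_map; apply: (leq_trans (hGam j).1).
    rewrite (_ : (200 = 100 * 2)%N)// -!mulnA leq_mul2l /= mulnCA leq_mul2l.
    by apply/orP; right; have := expn_gt0 2 j; lia.
  rewrite -big_distrr/= leq_mul2l; apply/orP; right.
  elim: i {ik rho r0 L rho2 U mU hU sU} => [|i IH]; first by rewrite big_geq.
  by rewrite big_nat_recr//= expnS; lia.
rewrite (_ : (size L)%:R * (2 * (`|eta| * (2 * rho))) =
  `|eta| * (4 * (size L)%:R * rho)); last by ring.
rewrite ler_wpM2l ?(ltW e0)// mulrA ler_wpM2r ?(ltW r0)//.
have : (size L)%:R <= 200 * (K + 1)%:R * 2 ^+ i + 2 :> R.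
  by move: sizeL; rewrite -(ler_nat R) natrD !natrM natrX.
have : 1 * 1 <= (K + 1)%:R * 2 ^+ i :> R.
  by rewrite ler_pM// ?exprn_ege1// ?ler1n// addn1.
rewrite -!mulrA; move: ((K + 1)%:R * 2 ^+ i) => p; lra.
Qed.

End Slices.

(** * Integrability of powers of the Fourier transform *)

Section LqBound.
Variables (R : realType) (a q : R).
Hypotheses (a_gt0 : 0 < a) (a_lt : 2 * a < 1).
Hypotheses (q_ge1 : 1 <= q) (q_hi : a <= 2 * a `^ q).
Implicit Types (r s t x y xi eta beta : R) (i j k K : nat).

Local Notation mu := (@lebesgue_measure R).
Local Notation plane := (measurableTypeR R * measurableTypeR R)%type.

Let b := a `^ q.
Let q_gt0 : 0 < q. Proof. exact: lt_le_trans q_ge1. Qed.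
Let b_gt0 : 0 < b. Proof. exact: powR_gt0. Qed.

Lemma decay_const_ge0 : 0 <= decay_const a.
Proof.
rewrite /decay_const addr_ge0//.
  by rewrite divr_ge0 ?(ltW a_gt0)// good_const_ge0.
by rewrite !mulr_ge0 ?pi_ge0// ltW// top_gt0.
Qed.

Definition cone : set (R * R) := [set z | `|z.1| <= `|z.2| /\ 1 <= `|z.2|].

Definition cone_power beta (z : R * R) : R := `|osc a beta z| `^ q * \1_cone z.

Lemma cone_measurable : measurable (cone : set plane).
Proof.
have -> : cone = ((fun z : plane => `|z.2| - `|z.1|) @^-1` `[0, +oo[%classic) `&`
    ((fun z : plane => `|z.2|) @^-1` `[1, +oo[%classic).
  by apply/seteqP; split => z /=; rewrite !in_itv/= !andbT subr_ge0.
apply: measurableI; rewrite -[X in measurable X]setTI.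
  have : measurable_fun [set: plane] (fun z => `|z.2| - `|z.1|).
    by apply: measurable_funB; apply: measurableT_comp.
  by apply.
have : measurable_fun [set: plane] (fun z => `|z.2|) by exact: measurableT_comp.
by apply.
Qed.

Lemma cone_power_measurable beta : measurable_fun [set: plane] (cone_power beta).
Proof.
apply: measurable_funM.
  apply: (measurableT_comp (measurable_powR q)).
  apply: measurableT_comp => //; exact: osc_measurable.
by apply: measurable_indic; exact: cone_measurable.
Qed.

Lemma cone_power_ge0 beta z : 0 <= cone_power beta z.
Proof. by rewrite mulr_ge0// powR_ge0. Qed.

(** The left side equals (2 * b / a) ^ i / [scale a k], nondecreasing in i because [q_hi] says 2 * b
    / a >= 1. No bad set thus contributes more than the one of index k. *)
Lemma radius_weight k i : (i <= k)%N -> b ^+ i * (2 ^+ i * radius a k i) <= b ^+ k.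
Proof.
move=> ik; have c1 : 1 <= 2 * b / a by rewrite ler_pdivlMr// mul1r.
have ai j : a ^+ j != 0 by rewrite gt_eqF// exprn_gt0.
have p2 j : (2 : R) ^+ j != 0 by rewrite gt_eqF// exprn_gt0.
have -> : b ^+ i * (2 ^+ i * radius a k i) = (2 * b / a) ^+ i * (scale a k)^-1.
  rewrite /radius /scale !exprMn !exprVn.
  by field; rewrite !ai !p2.
apply: (@le_trans _ _ ((2 * b / a) ^+ k * (scale a k)^-1)).
  by rewrite ler_wpM2r ?invr_ge0 ?(ltW (scale_gt0 a_gt0 k))// ler_weXn2l.
rewrite /scale !exprMn !exprVn le_eqVlt; apply/orP; left; apply/eqP.
by field; rewrite ai p2.
Qed.

Lemma pow_power (x : R) i : 0 <= x -> (x * a ^+ i) `^ q = x `^ q * b ^+ i.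
Proof.
move=> x0; have ai : 0 <= a ^+ i by rewrite exprn_ge0// ltW.
rewrite powRM//; congr (_ * _).
by rewrite -powR_mulrn ?ltW// powRAC powR_mulrn// powR_ge0.
Qed.

Lemma cone_slice k K eta beta : scale a k <= `|eta| -> scale a k <= 2 ^+ K ->
  (\int[mu]_xi (cone_power beta (xi, eta))%:E <=
   (decay_const a `^ q * (1002 * (K + 1)%:R * (k + 1)%:R) * b ^+ k *
     (scale a k `^ (1 - q)))%:E)%E.
Proof.
move=> keta kK; set Dq := decay_const a `^ q.
have k0 := scale_gt0 a_gt0 k.
have e0 : 0 < `|eta| by exact: lt_le_trans k0 keta.
have en0 : eta != 0 by rewrite -normr_gt0.
have Dq0 : 0 <= Dq by exact: powR_ge0.
have bk i : 0 <= b ^+ i by rewrite exprn_ge0// ltW.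
pose E := `|eta| `^ (- q).
have E0 : 0 <= E by exact: powR_ge0.
have /boolp.choice[U hU] : forall i, exists Ui : set (measurableTypeR R),
    measurable Ui /\ ((i <= k)%N ->
      (forall xi, `|xi| <= `|eta| -> ~ good a k i (xi / eta) -> Ui xi) /\
      (mu Ui <= (`|eta| * (1000 * (K + 1)%:R * (2 ^+ i * radius a k i)))%:E)%E).
  move=> i; have [ik|ki] := leqP i k; last by exists set0; split.
  by have [Ui [mU h1 h2]] := bad_cover a_gt0 a_lt kK ik en0; exists Ui.
pose I : set (measurableTypeR R) := `[- `|eta|, `|eta|]%classic.
have mI : measurable I by exact: measurable_itv.
pose F xi : \bar R := ((E * Dq * b ^+ k)%:E * (\1_I xi)%:E +
  \sum_(0 <= i < k.+1) (E * Dq * b ^+ i)%:E * (\1_(U i) xi)%:E)%E.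
have c0 i : (0 <= (E * Dq * b ^+ i)%:E)%E by rewrite lee_fin !mulr_ge0.
have mterm i (A : set (measurableTypeR R)) : measurable A ->
    measurable_fun setT (fun xi => (E * Dq * b ^+ i)%:E * (\1_A xi)%:E)%E.
  move=> mA; apply: emeasurable_funM => //.
  by apply: measurableT_comp => //; exact: measurable_indic.
have term0 i (A : set (measurableTypeR R)) xi :
    (0 <= (E * Dq * b ^+ i)%:E * (\1_A xi)%:E)%E.
  by rewrite mule_ge0// lee_fin.
have sum0 (r : seq nat) (P : pred nat) xi :
    (0 <= \sum_(i <- r | P i) (E * Dq * b ^+ i)%:E * (\1_(U i) xi)%:E)%E.
  by apply: sume_ge0 => i _; exact: term0.
have msum : measurable_fun setT (fun xi =>
    \sum_(0 <= i < k.+1) (E * Dq * b ^+ i)%:E * (\1_(U i) xi)%:E)%E.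
  by apply: emeasurable_sum => i; apply: mterm; exact: (hU i).1.
apply: (@le_trans _ _ (\int[mu]_xi F xi)%E).
  apply: ge0_le_integral => //.
  - by move=> xi _; rewrite lee_fin cone_power_ge0.
  - apply: measurableT_comp => //.
    apply: (measurableT_comp (cone_power_measurable beta)).
    exact: measurable_fun_pair.
  - by apply: emeasurable_funD => //; exact: mterm.
  move=> xi _; rewrite /cone_power /F.
  have [h|h] := leP `|xi| `|eta|; last first.
    have -> : \1_cone (xi, eta) = 0 :> R.
      have nc : ~ cone (xi, eta) by move=> -[/=]; rewrite leNgt h.
      by rewrite indicE memNset.
    by rewrite mulr0; apply: adde_ge0; [exact: term0|exact: sum0].
  apply: (@le_trans _ _ (`|osc a beta (xi, eta)| `^ q)%:E).
    by rewrite lee_fin ler_piMr ?powR_ge0.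
  have xiE : (xi, eta) = (xi / eta * eta, eta) by rewrite divfK.
  have t1 : `|xi / eta| <= 1 by rewrite normrM normfV ler_pdivrMr// mul1r.
  have key i : `|eta| * `|osc a beta (xi, eta)| <= decay_const a * a ^+ i ->
      `|osc a beta (xi, eta)| `^ q <= E * Dq * b ^+ i.
    move=> hi; rewrite -mulrA -pow_power ?decay_const_ge0// -ler_pdivrMl; last first.
      by rewrite powR_gt0.
    rewrite /E powRN invrK -powRM//.
    by rewrite ge0_ler_powR ?nnegrE ?mulr_ge0 ?decay_const_ge0 ?exprn_ge0// ltW.
  have II : \1_I xi = 1 :> R.
    have Ixi : I xi by rewrite /I/= in_itv/= -ler_norml.
    by rewrite indicE mem_set.
  have := osc_pointwise a_gt0 a_lt beta keta t1; rewrite -xiE.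
  move=> [hk|[i ik [bad hi]]].
    rewrite II mule1 -[leLHS]adde0; apply: leeD; last exact: sum0.
    by rewrite lee_fin key.
  have Ui : \1_(U i) xi = 1 :> R.
    by rewrite indicE mem_set//; apply: ((hU i).2 ik).1.
  rewrite -[leLHS]add0e; apply: leeD; first exact: term0.
  rewrite (bigD1_seq i) ?mem_index_iota ?iota_uniq//=.
  rewrite Ui mule1 -[leLHS]adde0; apply: leeD; last exact: sum0.
  by rewrite lee_fin key.
rewrite /F ge0_integralD//; last exact: mterm.
rewrite ge0_integral_sum//; last by move=> i; apply: mterm; exact: (hU i).1.
have iterm i (A : set (measurableTypeR R)) : measurable A ->
    (\int[mu]_xi ((E * Dq * b ^+ i)%:E * (\1_A xi)%:E) =
     (E * Dq * b ^+ i)%:E * mu A)%E.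
  move=> mA; rewrite ge0_integralZl//; last first.
    by apply: measurableT_comp => //; exact: measurable_indic.
  by rewrite integral_indic//= setIT.
rewrite iterm// (eq_bigr (fun i => (E * Dq * b ^+ i)%:E * mu (U i))%E); last first.
  by move=> i _; rewrite iterm//; exact: (hU i).1.
pose M := E * Dq * b ^+ k * `|eta|.
have M0 : 0 <= M by exact: mulr_ge0 (mulr_ge0 (mulr_ge0 _ _) _) (ltW e0).
apply: (@le_trans _ _ ((M * 2)%:E +
    \sum_(0 <= i < k.+1) (M * (1000 * (K + 1)%:R))%:E)%E).
  apply: leeD.
    rewrite lebesgue_measure_itv/= lte_fin; case: ifP => _.
      rewrite -EFinB -EFinM lee_fin /M le_eqVlt; apply/orP; left; apply/eqP; ring.
    by rewrite mule0 lee_fin mulr_ge0.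
  rewrite big_nat_cond [leRHS]big_nat_cond; apply: lee_sum => i.
  rewrite andbT => /andP[_ ik]; have [_ sU] := (hU i).2 ik.
  apply: (le_trans (lee_wpmul2l (c0 i) sU)); rewrite -EFinM lee_fin.
  rewrite (_ : E * Dq * b ^+ i * _ = E * Dq * `|eta| * (1000 * (K + 1)%:R) *
    (b ^+ i * (2 ^+ i * radius a k i))); last by ring.
  rewrite (_ : M * _ = E * Dq * `|eta| * (1000 * (K + 1)%:R) * b ^+ k); last first.
    by rewrite /M; ring.
  apply: ler_wpM2l; last exact: radius_weight.
  apply: mulr_ge0; last exact: mulr_ge0 (ler0n _ _) (ler0n _ _).
  by apply: mulr_ge0; [exact: mulr_ge0|exact: ltW].
rewrite sumEFin -EFinD lee_fin big_const_nat subn0 iter_addr addr0.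
have ME : M <= Dq * b ^+ k * scale a k `^ (1 - q).
  rewrite (_ : M = Dq * b ^+ k * (E * `|eta|)); last by rewrite /M; ring.
  apply: ler_wpM2l; first exact: mulr_ge0.
  rewrite /E -[X in _ * X]powRr1 ?(ltW e0)//.
  rewrite -powRD; last by rewrite (gt_eqF e0) implybT.
  have inv (x : R) : x `^ (- q + 1) = (x `^ (q - 1))^-1.
    by rewrite -powRN opprB addrC.
  rewrite inv (addrC 1) inv lef_pV2 ?posrE ?powR_gt0//.
  by apply: ge0_ler_powR; rewrite ?nnegrE ?subr_ge0// ltW.
rewrite -[X in _ + X]mulr_natr.
have -> : M * 2 + M * (1000 * (K + 1)%:R) * k.+1%:R =
  M * (2 + 1000 * ((K + 1)%:R * (k + 1)%:R)) by rewrite addn1; ring.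
(* 1002 is 2 from the length of the slice plus 1000 from the covers of the bad sets. *)
apply: (@le_trans _ _ (M * (1002 * (K + 1)%:R * (k + 1)%:R))).
  apply: ler_wpM2l => //.
  have : 1 * 1 <= (K + 1)%:R * (k + 1)%:R :> R.
    by rewrite ler_pM// !addn1 ler1n.
  rewrite -(mulrA 1002); move: ((K + 1)%:R * (k + 1)%:R) => p; lra.
rewrite mulrC [leRHS](_ : _ = 1002 * (K + 1)%:R * (k + 1)%:R *
  (Dq * b ^+ k * scale a k `^ (1 - q))); last by ring.
by apply: ler_wpM2l ME; exact: mulr_ge0 (mulr_ge0 (ler0n _ _) (ler0n _ _)) (ler0n _ _).
Qed.

End LqBound.

(* The quadratic [P] is chosen so that [P k * theta ^+ k - P k.+1 * theta ^+ k.+1]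
   dominates the general term. *)
Lemma square_geometric_sum (R : realType) (theta : R) : 0 <= theta < 1 -> exists C : R,
  forall n, \sum_(0 <= k < n) (k + 1)%:R ^+ 2 * theta ^+ k <= C.
Proof.
move=> /andP[t0 t1]; have s0 : 0 < 1 - theta by rewrite subr_gt0.
pose w := (1 - theta)^-1; have w0 : 0 < w by rewrite invr_gt0.
have tw : theta = 1 - w^-1 by rewrite invrK opprB addrC subrK.
pose P n := w * (n + 1)%:R ^+ 2 + 2 * w ^+ 2 * (n + 1)%:R + 2 * w ^+ 3.
exists (P 0) => n.
have P0 m : 0 <= P m.
  by apply: addr_ge0; [apply: addr_ge0|]; rewrite !mulr_ge0 ?exprn_ge0// ltW.
suff : \sum_(0 <= k < n) (k + 1)%:R ^+ 2 * theta ^+ k + P n * theta ^+ n <= P 0.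
  by apply: le_trans; rewrite lerDl mulr_ge0 ?exprn_ge0.
elim: n => [|n IH]; first by rewrite big_geq// expr0 mulr1 add0r.
apply: le_trans IH; rewrite big_nat_recr//= -addrA lerD2l (exprS theta).
rewrite (_ : _ + _ = ((n + 1)%:R ^+ 2 + P n.+1 * theta) * theta ^+ n); last by ring.
rewrite ler_wpM2r ?exprn_ge0// -subr_ge0.
have -> : P n - ((n + 1)%:R ^+ 2 + P n.+1 * theta) = 2 * n%:R + 3 + w.
  by rewrite tw /P addn1 !natrD; field; rewrite gt_eqF.
by rewrite !addr_ge0 ?mulr_ge0// ltW.
Qed.

Section ConeIntegral.
Variables (R : realType) (a q : R).
Hypotheses (a_gt0 : 0 < a) (a_lt : 2 * a < 1).
Hypotheses (q_ge1 : 1 <= q) (q_hi : a <= 2 * a `^ q).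
Hypothesis q_lo : (2 / a) `^ (2 - q) * a `^ q < 1.
Local Notation mu := (@lebesgue_measure R).
Local Notation plane := (measurableTypeR R * measurableTypeR R)%type.

Lemma scale_shell (x : R) : 1 <= x ->
  exists k, scale a k <= x /\ x <= scale a k.+1.
Proof.
move=> x1; have [n nx] : exists n, x < scale a n.
  exists (Num.bound x); apply: (lt_le_trans (upper_nthrootP (leqnn _))).
  apply: lerXn2r; rewrite ?nnegrE ?divr_ge0 ?ltW//.
  by rewrite ltr_pdivlMr// -[ltRHS]mulr1 ltr_pM2l//; move: a_gt0 a_lt; lra.
have [[|m] mx mmin] := ex_minnP (ex_intro (fun n => x < scale a n) n nx).
  by move: mx; rewrite /scale expr0 ltNge x1.
exists m; split; last exact: ltW.
by rewrite leNgt; apply/negP => /mmin; rewrite ltnn.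
Qed.

Lemma cone_integral_lty beta :
  (\int[@lebesgue2 R]_z (cone_power a q beta z)%:E < +oo)%E.
Proof.
have a2 : 0 < 2 / a by rewrite divr_gt0.
(* As 2 / a <= 2 ^ B, the precision K = B * k suits [scale a k] and remains linear in k. *)
pose B := Num.bound (2 / a).
have hB k : scale a k <= 2 ^+ (B * k).
  rewrite exprM; apply: lerXn2r; rewrite ?nnegrE ?exprn_ge0// ltW//.
  exact: upper_nthrootP.
pose theta := (2 / a) `^ (2 - q) * a `^ q.
have theta0 : 0 <= theta by rewrite mulr_ge0 ?powR_ge0.
have [S hS] : exists C : R, forall n,
    \sum_(0 <= k < n) (k + 1)%:R ^+ 2 * theta ^+ k <= C.
  by apply: square_geometric_sum; rewrite theta0.
pose Dq := decay_const a `^ q.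
have Dq0 : 0 <= Dq by exact: powR_ge0.
pose c k := Dq * (1002 * (B * k + 1)%:R * (k + 1)%:R) * (a `^ q) ^+ k *
  scale a k `^ (1 - q).
have k0 k : 0 < scale a k by exact: scale_gt0.
have c0 k : 0 <= c k.
  apply: mulr_ge0; last exact: powR_ge0.
  apply: mulr_ge0; last by rewrite exprn_ge0 ?powR_ge0.
  exact: mulr_ge0 Dq0 (mulr_ge0 (mulr_ge0 (ler0n _ _) (ler0n _ _)) (ler0n _ _)).
(* The shell is enlarged to the full interval, whose length is of the same order. *)
pose I k : set (measurableTypeR R) := `[- scale a k.+1, scale a k.+1]%classic.
have mI k : measurable (I k) by exact: measurable_itv.
pose C := Dq * 1002 * (B + 1)%:R * (2 * (2 / a)).
have C0 : 0 <= C.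
  exact: mulr_ge0 (mulr_ge0 (mulr_ge0 Dq0 (ler0n _ _)) (ler0n _ _))
    (mulr_ge0 (ler0n _ _) (ltW a2)).
have term k : c k * (2 * scale a k.+1) <= C * ((k + 1)%:R ^+ 2 * theta ^+ k).
  have -> : theta ^+ k = scale a k `^ (1 - q) * (a `^ q) ^+ k * scale a k.
    rewrite /theta exprMn mulrAC; congr (_ * _).
    rewrite -[X in _ = _ * X]powRr1 ?ltW// -powRD; last by rewrite (gt_eqF (k0 _)) implybT.
    rewrite (_ : 1 - q + 1 = 2 - q); last by ring.
    by rewrite -powR_mulrn ?powR_ge0// powRAC powR_mulrn// ltW.
  rewrite /scale [in 2 * _]exprS -/(scale a k) /c /C.
  set u := scale a k `^ _; set v := a `^ _ ^+ _; set s := scale a k.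
  rewrite (_ : _ * (2 * _) = (Dq * 1002 * (2 * (2 / a))) * (u * v * s * (k + 1)%:R) *
    (B * k + 1)%:R); last by ring.
  rewrite [leRHS](_ : _ = (Dq * 1002 * (2 * (2 / a))) * (u * v * s * (k + 1)%:R) *
    ((B + 1) * (k + 1))%:R); last by rewrite natrM; ring.
  apply: ler_wpM2l; last by rewrite ler_nat; nia.
  apply: mulr_ge0.
    exact: mulr_ge0 (mulr_ge0 Dq0 (ler0n _ _)) (mulr_ge0 (ler0n _ _) (ltW a2)).
  by rewrite !mulr_ge0 ?powR_ge0 ?exprn_ge0 ?powR_ge0// ltW.
pose g k (eta : measurableTypeR R) : \bar R := ((c k)%:E * (\1_(I k) eta)%:E)%E.
have g0 k eta : (0 <= g k eta)%E by rewrite mule_ge0// lee_fin.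
have mg k : measurable_fun setT (g k).
  apply: emeasurable_funM => //.
  by apply: measurableT_comp => //; exact: measurable_indic.
have mcone : measurable_fun [set: plane] (fun z => (cone_power a q beta z)%:E).
  by apply: measurableT_comp => //; exact: cone_power_measurable.
have cone0 (z : plane) : (0 <= (cone_power a q beta z)%:E)%E.
  by rewrite lee_fin cone_power_ge0.
rewrite (fubini_tonelli2 _ mcone cone0).
apply: (@le_lt_trans _ _ (\int[mu]_eta \sum_(0 <= k <oo) g k eta)%E).
  apply: ge0_le_integral => //.
  - by move=> eta _; apply: integral_ge0.
  - exact: measurable_fun_fubini_tonelli_G.
  - by apply: ge0_emeasurable_sum => // k _; exact: mg.
  move=> eta _; have [e1|e1] := leP 1 `|eta|; last first.
    rewrite /fubini_G integral0_eq; first exact: nneseries_ge0.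
    move=> xi _; rewrite /cone_power indicE memNset ?mulr0//.
    by move=> -[_ /=]; rewrite leNgt e1.
  have [k [ke ke1]] := scale_shell e1.
  apply: (le_trans (cone_slice a_gt0 a_lt q_ge1 q_hi beta ke (hB k))).
  apply: (@le_trans _ _ (g k eta)).
    have Ie : I k eta by rewrite /I/= in_itv/= -ler_norml.
    by rewrite /g indicE mem_set// mule1.
  apply: (le_trans _ (@nneseries_lim_ge _ (g^~ eta) predT 0 k.+1 _)) => //.
  by rewrite big_nat_recr//= leeDr// sume_ge0.
rewrite integral_nneseries//.
apply: (@le_lt_trans _ _ (C * S)%:E); last exact: ltry.
apply: lime_le; first by apply: is_cvg_nneseries => k _ _; exact: integral_ge0.
apply: nearW => n.
apply: (@le_trans _ _ (\sum_(0 <= k < n) (C * ((k + 1)%:R ^+ 2 * theta ^+ k))%:E)%E).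
  apply: lee_sum => k _; rewrite /g ge0_integralZl//; last first.
  - by rewrite lee_fin.
  - by apply: measurableT_comp => //; exact: measurable_indic.
  rewrite integral_indic//= setIT lebesgue_measure_itv/= lte_fin.
  rewrite ifT; last by rewrite gtrN.
  rewrite -EFinB -EFinM lee_fin opprK; apply: le_trans (term k).
  by rewrite mulr_natl mulr2n.
rewrite sumEFin lee_fin -big_distrr/=; exact: ler_wpM2l.
Qed.

End ConeIntegral.

Section Membership.
Variables (R : realType) (a q : R).
Hypotheses (a_gt0 : 0 < a) (a_lt : 2 * a < 1).
Hypotheses (q_ge1 : 1 <= q) (q_hi : a <= 2 * a `^ q).
Hypothesis q_lo : (2 / a) `^ (2 - q) * a `^ q < 1.

Local Notation mu := (@lebesgue_measure R).
Local Notation plane := (measurableTypeR R * measurableTypeR R)%type.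
Local Notation dom := (dom a).
Local Open Scope complex_scope.

Let q_gt0 : 0 < q. Proof. exact: lt_le_trans q_ge1. Qed.

Lemma area_ge0 : 0 <= area a.
Proof. exact: le_trans (osc_le_area a_gt0 a_lt 0 0). Qed.

Lemma osc_power_le beta z : `|osc a beta z| `^ q <= area a `^ q.
Proof.
apply: ge0_ler_powR; rewrite ?nnegrE ?area_ge0// ?(ltW q_gt0)//.
exact: osc_le_area.
Qed.

Lemma osc_power_measurable beta :
  measurable_fun [set: plane] (fun z => (`|osc a beta z| `^ q)%:E).
Proof.
apply: measurableT_comp => //; apply: (measurableT_comp (measurable_powR q)).
by apply: measurableT_comp => //; exact: osc_measurable.
Qed.

(** The plane is covered by the square [-1, 1]^2, the cone and its mirror image in the diagonal. On
    the square the integrand is bounded through the area; the symmetry of the domain carries the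
    cone estimate to the mirror image. *)
Lemma osc_power_lty beta :
  (\int[@lebesgue2 R]_z (`|osc a beta z| `^ q)%:E < +oo)%E.
Proof.
pose J : set (measurableTypeR R) := `[- 1, 1]%classic.
pose A := area a `^ q.
have mJJ : measurable (J `*` J : set plane).
  by apply: measurableX; exact: measurable_itv.
have mcone : measurable_fun [set: plane] (fun z => (cone_power a q beta z)%:E).
  by apply: measurableT_comp => //; exact: cone_power_measurable.
have cone0 (z : plane) : (0 <= (cone_power a q beta z)%:E)%E.
  by rewrite lee_fin cone_power_ge0.
have mswap : measurable_fun [set: plane]
    (fun z => (cone_power a q beta (z.2, z.1))%:E).
  apply: (measurableT_comp (f := fun z => (cone_power a q beta z)%:E)) => //.
  exact: measurable_fun_pair.
have mJ : measurable_fun [set: plane] (fun z => (\1_(J `*` J) z)%:E : \bar R).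
  by apply: measurableT_comp => //; exact: measurable_indic.
have A0 : (0 <= A%:E)%E by rewrite lee_fin powR_ge0.
have mAJ : measurable_fun [set: plane] (fun z => A%:E * (\1_(J `*` J) z)%:E : \bar R)%E.
  exact: emeasurable_funM.
have AJ0 (z : plane) : (0 <= A%:E * (\1_(J `*` J) z)%:E :> \bar R)%E.
  by rewrite mule_ge0// lee_fin.
apply: (@le_lt_trans _ _ (\int[@lebesgue2 R]_z (A%:E * (\1_(J `*` J) z)%:E +
    ((cone_power a q beta z)%:E + (cone_power a q beta (z.2, z.1))%:E)))%E).
  apply: ge0_le_integral => //.
  - exact: osc_power_measurable.
  - by apply: emeasurable_funD => //; exact: emeasurable_funD.
  move=> -[x y] _ /=; have [xy|yx] := leP `|x| `|y|.
    have [y1|y1] := leP `|y| 1.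
      rewrite -[leLHS]adde0; apply: leeD; last exact: adde_ge0.
      have Jxy : (J `*` J) (x, y).
        by split; rewrite /J/= in_itv/= -ler_norml//; exact: le_trans y1.
      by rewrite indicE mem_set// mule1 lee_fin; exact: osc_power_le.
    rewrite -[leLHS]add0e; apply: leeD => //; rewrite -[leLHS]adde0; apply: leeD => //.
    by rewrite /cone_power indicE mem_set ?mulr1//; split => //=; exact: ltW.
  have [x1|x1] := leP `|x| 1.
    rewrite -[leLHS]adde0; apply: leeD; last exact: adde_ge0.
    have Jxy : (J `*` J) (x, y).
      by split; rewrite /J/= in_itv/= -ler_norml//; exact: le_trans (ltW yx) x1.
    by rewrite indicE mem_set// mule1 lee_fin; exact: osc_power_le.
  rewrite -[leLHS]add0e; apply: leeD => //; rewrite -[leLHS]add0e; apply: leeD => //.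
  rewrite osc_swap// /cone_power indicE mem_set ?mulr1//.
  by split => /=; exact: ltW.
rewrite ge0_integralD//; last first.
- exact: emeasurable_funD.
- by move=> z _; exact: adde_ge0.
rewrite ge0_integralD//; apply: lte_add_pinfty; last apply: lte_add_pinfty.
- rewrite ge0_integralZl// integral_indic//= setIT.
  have -> : lebesgue2 (J `*` J) = (mu J * mu J)%E.
    by rewrite -product_measure1E//; exact: measurable_itv.
  by rewrite lebesgue_measure_itv/= lte_fin gtrN// -EFinB -!EFinM ltry.
- exact: cone_integral_lty.
rewrite (fubini_tonelli1 _ mswap)//.
have := cone_integral_lty a_gt0 a_lt q_ge1 q_hi q_lo beta.
by rewrite (fubini_tonelli2 _ mcone).
Qed.

Lemma fourier_char_fun (xi : plane) :
  fourier (char_fun dom) xi = osc a 0 xi +i* osc a (pi / 2) xi.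
Proof.
congr (_ +i* _); apply: eq_Rintegral => t _; rewrite /wave /char_fun /expi /=.
  by rewrite addr0 mul0r subr0 cosN.
by rewrite mul0r addr0 sinN cosDpihalf.
Qed.

Lemma normc_le (x y : R) : ComplexField.Normc.normc (x +i* y) <= `|x| + `|y|.
Proof.
rewrite /= -[leRHS]ger0_norm ?addr_ge0// -sqrtr_sqr ler_sqrt ?sqr_ge0//.
by rewrite sqrrD !real_normK ?num_real// -addrA lerD2l lerDr mulrn_wge0 ?mulr_ge0.
Qed.

Lemma dom_in_Ap (p : \bar R) : (q%:E <= p)%E -> in_Ap p (char_fun dom).
Proof.
pose u := osc a 0; pose v := osc a (pi / 2).
move=> qp; split.
  split; first exact: (indic_integrable a_gt0 a_lt).
  by apply: (eq_integrable _ (cst 0%E)) => //; exact: integrable0.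
have mu_ beta := osc_measurable a_gt0 a_lt beta.
pose n z : R := Num.sqrt (u z ^+ 2 + v z ^+ 2).
have n0 z : 0 <= n z by exact: sqrtr_ge0.
have nuv z : n z <= `|u z| + `|v z| by exact: (normc_le (u z) (v z)).
have mn : measurable_fun [set: plane] n.
  apply: (measurableT_comp (f := @Num.sqrt R)).
    apply: continuous_measurable_fun => ?; exact: sqrt_continuous.
  by apply: measurable_funD; apply: measurable_funX; exact: mu_.
have FE z : fourier (char_fun dom) z = u z +i* v z by exact: fourier_char_fun.
have nE : (fun z => (ComplexField.Normc.normc (fourier (char_fun dom) z))%:E) = EFin \o n.
  by apply/funext => z; rewrite FE.
split.
- by under eq_fun do rewrite FE; exact: mu_.
- by under eq_fun do rewrite FE; exact: mu_.
rewrite nE.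
pose M := area a + area a; have M0 : 0 <= M by rewrite addr_ge0 ?area_ge0.
have nM z : n z <= M by apply: (le_trans (nuv z)); apply: lerD; exact: osc_le_area.
case: p qp => [p| |//]; last first.
  move=> _; rewrite unlock; case: ifP => // _; apply: (@le_lt_trans _ _ M%:E); last exact: ltry.
  by apply/ess_supP; apply: nearW => z /=; rewrite lee_fin ger0_norm.
rewrite lee_fin => qp; rewrite unlock; apply: poweR_lty.
pose C := M `^ (p - q) * 2 `^ q.
have C0 : 0 <= C by rewrite mulr_ge0 ?powR_ge0.
have np z : n z `^ p <= C * (`|u z| `^ q + `|v z| `^ q).
  have [->|nz] := eqVneq (n z) 0.
    rewrite powR0 ?gt_eqF//; last exact: lt_le_trans q_gt0 qp.
    by rewrite mulr_ge0 ?addr_ge0 ?powR_ge0.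
  rewrite -(subrK q p) powRD; last by rewrite nz implybT.
  rewrite /C -mulrA; apply: ler_pM; rewrite ?powR_ge0//.
    by apply: ge0_ler_powR; rewrite ?nnegrE ?subr_ge0.
  apply: (@le_trans _ _ ((2 * Num.max `|u z| `|v z|) `^ q)).
    apply: ge0_ler_powR; rewrite ?nnegrE ?mulr_ge0 ?le_max ?normr_ge0 ?(ltW q_gt0)//.
    apply: (le_trans (nuv z)); rewrite mulr_natl mulr2n.
    by apply: lerD; rewrite le_max lexx ?orbT.
  rewrite powRM ?le_max ?normr_ge0// ler_wpM2l ?powR_ge0//.
  by case: (leP `|u z| `|v z|) => _; [rewrite lerDr|rewrite lerDl]; exact: powR_ge0.
have intE z : (`|(EFin \o n) z| `^ p)%E = (n z `^ p)%:E.
  by rewrite /= ger0_norm.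
under eq_integral do rewrite intE.
apply: (@le_lt_trans _ _ (\int[@lebesgue2 R]_z
    (C%:E * ((`|u z| `^ q)%:E + (`|v z| `^ q)%:E)))%E).
  apply: ge0_le_integral => //.
  - by move=> z _; rewrite lee_fin powR_ge0.
  - by apply: measurableT_comp => //; exact: (measurableT_comp (measurable_powR p)).
  - apply: emeasurable_funM => //.
    by apply: emeasurable_funD; exact: osc_power_measurable.
  - by move=> z _; rewrite -EFinD -EFinM lee_fin.
rewrite ge0_integralZl//; last first.
- by move=> z _; apply: adde_ge0; rewrite lee_fin powR_ge0.
- by apply: emeasurable_funD; exact: osc_power_measurable.
rewrite ge0_integralD//; last first.
- exact: osc_power_measurable.
- exact: osc_power_measurable.
apply: lte_mul_pinfty => //.
by apply: lte_add_pinfty; exact: osc_power_lty.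
Qed.

End Membership.

(** * Choice of the parameters a and q *)

Section Exponents.
Variables (R : realType) (alpha : R).
Hypotheses (alpha_gt0 : 0 < alpha) (alpha_lt1 : alpha < 1).

Definition ratio : R := 2 `^ - alpha^-1.

Lemma ratio_gt0 : 0 < ratio.
Proof. exact: powR_gt0. Qed.

Lemma ratio_power : ratio `^ alpha = 2^-1.
Proof. by rewrite -powRrM mulNr mulVf ?gt_eqF// powRN powRr1. Qed.

Lemma pow2D (x y : R) : 2 `^ x * 2 `^ y = 2 `^ (x + y).
Proof. by rewrite powRD// pnatr_eq0 implybT. Qed.

Lemma pow2_lt1 (x : R) : x < 0 -> 2 `^ x < 1.
Proof.
move=> x0; rewrite /powR pnatr_eq0 expR_lt1 nmulr_rlt0//.
by rewrite ln_gt0// ltr1n.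
Qed.

(** The hypothesis alpha < 1 enters here: it makes the sum of a ^ j * 2 ^ j converge. *)
Lemma ratio_lt : 2 * ratio < 1.
Proof.
rewrite -[X in X * _]powRr1// pow2D; apply: pow2_lt1.
by rewrite subr_lt0 invf_gt1.
Qed.

Lemma dom_ratio_in_Ap (p : \bar R) :
  ((1 + alpha / (2 + alpha))%:E < p)%E -> in_Ap p (char_fun (dom ratio)).
Proof.
set p0 := 1 + _ => p0p.
have al2 : 0 < 2 + alpha by rewrite addr_gt0.
have p0_gt1 : 1 < p0 by rewrite ltrDl divr_gt0.
have p0_lt : p0 < 1 + alpha.
  rewrite ltrD2l ltr_pdivrMr// mulrDr.
  by move: (mulr_gt0 alpha_gt0 alpha_gt0) alpha_gt0; lra.
have [q [q0 q1 qp]] : exists q : R, [/\ p0 < q, q < 1 + alpha & (q%:E <= p)%E].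
  case: p p0p => [p| |//].
    rewrite lte_fin => pp; exists ((p0 + Num.min p (1 + alpha)) / 2).
    by have [h|h] := leP p (1 + alpha); rewrite lee_fin; split; move: p0_lt h pp; lra.
  by exists ((p0 + (1 + alpha)) / 2); split; rewrite ?leey//; move: p0_lt; lra.
have ge1 : 1 <= q by move: p0_gt1 q0; lra.
apply: (dom_in_Ap ratio_gt0 ratio_lt ge1) qp.
  rewrite -[X in X * _]powRr1// -powRrM pow2D ler_powR ?ler1n//.
  have : alpha^-1 * (q - 1) <= 1 by rewrite ler_pdivrMl// mulr1; move: q1; lra.
  by move: (alpha^-1) => s; lra.
rewrite [2 / ratio](_ : _ = 2 `^ (1 + alpha^-1)); last first.
  by rewrite -pow2D powRr1// /ratio powRN invrK.
rewrite -!powRrM pow2D; apply: pow2_lt1.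
(* After multiplication by 1 / alpha this is negativity of the exponent of 2 in the ratio of the
   series; the critical value 2 * (1 + alpha) / (2 + alpha) is p0. *)
have : 2 * (1 + alpha) < q * (2 + alpha).
  rewrite -ltr_pdivrMr//; apply: le_lt_trans q0; rewrite le_eqVlt; apply/orP; left.
  by apply/eqP; rewrite /p0; field; rewrite gt_eqF.
rewrite -(ltr_pM2l (x := alpha^-1)) ?invr_gt0//.
rewrite (_ : _ * (2 * _) = 2 + 2 * alpha^-1); last by field; rewrite gt_eqF.
rewrite (_ : _ * (q * _) = q + 2 * q * alpha^-1); last by field; rewrite gt_eqF.
by move: (alpha^-1) => s; lra.
Qed.

End Exponents.

Theorem corollary3 (R : realType) (alpha : R) (alpha_gt0 : 0 < alpha)
    (alpha_lt1 : alpha < 1) :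
  exists D : set (R * R),
    [/\ domain D,
        bounded_set D,
        C1alpha_boundary alpha D,
        forall p : \bar R, ((1 + alpha / (2 + alpha))%:E < p)%E ->
          in_Ap p (char_fun D)
      & forall x y : R * R, x <> y -> ~ (segment x y `<=` boundary D)].
Proof.
have a_gt0 := ratio_gt0 alpha; have a_lt := ratio_lt alpha_gt0 alpha_lt1.
exists (dom (ratio alpha)); split.
- exact: dom_domain.
- exact: dom_bounded.
- exact: (dom_C1alpha_boundary a_gt0 a_lt alpha_gt0 (ratio_power alpha_gt0)).
- exact: dom_ratio_in_Ap.
- exact: boundary_no_segment.
Qed.
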